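(* Let $k$ be a field, $R=k[x,y]$ standard graded, $\mathfrak m=(x,y)$, and let $M$ be a finitely generated $\mathbb Z$-graded $R$-module. Initialize $H=[H^\bullet_{\mathfrak m}(M)]$; at every stage let $H^0,H^1,H^2$ denote the three columns of the current table $H$ and $h^i_j$ the entry of $H^i$ in row $j\in\mathbb Z$. Run the following algorithm. Step 1: Replace $H$ by $H-\sum_{n\in\mathbb Z}h^0_n\,[H^\bullet_{\mathfrak m}(k(-n))]$. Step 2: If the set $\{n\in\mathbb Z\mid \Delta^2_{H^2}(n-2)\neq 0\}$ is empty, go to Step 4. Otherwise let $a$ be its maximum. If $h^1_a=0$, replace $H$ by $H-[H^\bullet_{\mathfrak m}(R(-a))]$ and repeat Step 2. If $h^1_a>0$, proceed to Step 3. Step 3: Let $K=(k_n)_{n\in\mathbb Z}$ with $k_n=\min\{h^1_n,\,n-a+1\}$ for $n\ge a$ and $k_n=0$ for $n<a$. Write $K=\sum_{n\ge 0} r_n\,[R/\mathfrak m^{n+1}(-a)]$ (a finite sum) with $r_n\in\mathbb Q_{\ge 0}$. Replace $H$ by $H-\sum_n r_n\,[H^\bullet_{\mathfrak m}(\mathfrak m^{n+1}(-a))]$ and return to Step 2. Step 4: If the set $\{n\in\mathbb Z\mid \Delta^1_{H^1}(n-1)\neq 0\}$ is empty, finish. Otherwise let $b$ be its maximum, replace $H$ by $H-[H^\bullet_{\mathfrak m}(k[x](-b))]$, and repeat Step 4. Then the algorithm terminates after finitely many steps with the trivial table $H=0$, and hence produces a decomposition of $[H^\bullet_{\mathfrak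 m}(M)]$ as a finite linear combination, with positive rational coefficients, of tables of the form $[H^\bullet_{\mathfrak m}(k(a))]$, $[H^\bullet_{\mathfrak m}(k[x](a))]$, $[H^\bullet_{\mathfrak m}(R(a))]$, $[H^\bullet_{\mathfrak m}(\mathfrak m^t(a))]$ with $t\ge 1$, $a\in\mathbb Z$.
   Context: $N(a)$ denotes the graded module with $N(a)_n=N_{a+n}$; $k=R/(x,y)$ and $k[x]=R/(y)$. For a finitely generated graded $R$-module $M$, $[H^\bullet_{\mathfrak m}(M)]$ is the $\mathbb Z\times 3$ matrix with entries $\dim_k H^i_{\mathfrak m}(M)_j$, $j\in\mathbb Z$, $i\in\{0,1,2\}$. For a graded module $L$ with finite-dimensional components, $[L]$ is the $\mathbb Z\times 1$ column $(\dim_k L_n)_{n\in\mathbb Z}$. For a column $C=(c_n)_{n\in\mathbb Z}$ set $\Delta^0_C(n)=c_n$ and $\Delta^t_C(n)=\Delta^{t-1}_C(n)-\Delta^{t-1}_C(n+1)$ for $t>0$. *)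

(* Defs.v *)
From HB Require Import structures.
From mathcomp Require Import all_boot all_order all_algebra.
From mathcomp Require Import generic_quotient ring_quotient boolp mpoly zify.

Set Implicit Arguments.
Unset Strict Implicit.
Unset Printing Implicit Defensive.

Import Order.TTheory GRing.Theory Num.Theory.
Local Open Scope ring_scope.
Local Open Scope quotient_scope.

Section Submodules.
Variables (R : comNzRingType) (V : lmodType R) (s : seq V).

Definition submod : {pred V} := fun v =>
  `[< exists c : 'I_(size s) -> R, v = \sum_i c i *: s`_i >].

Lemma submod_submod_closed : submod_closed submod.
Proof.
split=> [|a u v].
  by apply/asboolP; exists (fun=> 0); rewrite big1 // => i _; rewrite scale0r.
move=> /asboolP[c ->] /asboolP[d ->]; apply/asboolP.
exists (fun i => a * c i + d i); rewrite scaler_sumr -big_split /=.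
by apply: eq_bigr => i _; rewrite scalerDl scalerA.
Qed.

HB.instance Definition _ :=
  GRing.isSubmodClosed.Build R V submod submod_submod_closed.

Definition submod_type := {v : V | v \in submod}.
HB.instance Definition _ := SubChoice.on submod_type.
HB.instance Definition _ := [SubChoice_isSubLmodule of submod_type by <:].

Definition quotmod := Quotient.quot submod.
HB.instance Definition _ := GRing.Zmodule.on quotmod.

Definition to_quotmod (v : V) : quotmod := \pi_quotmod v.
Definition quot_scale (a : R) (q : quotmod) : quotmod := to_quotmod (a *: repr q).

Lemma to_quotmodP u v : reflect (to_quotmod u = to_quotmod v) (u - v \in submod).
Proof. by rewrite Quotient.idealrBE; exact: eqP. Qed.

Lemma to_quotmodD : {morph to_quotmod : u v / u + v}.
Proof. by move=> u v; rewrite /to_quotmod !piE. Qed.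

Lemma to_quotmodZ a v : quot_scale a (to_quotmod v) = to_quotmod (a *: v).
Proof.
apply/to_quotmodP; rewrite -scalerBr rpredZ //.
by apply/to_quotmodP; rewrite /to_quotmod reprK.
Qed.

Lemma quotmodW (q : quotmod) : exists v, q = to_quotmod v.
Proof. by exists (repr q); rewrite /to_quotmod reprK. Qed.

Fact quot_scaleA a b q : quot_scale a (quot_scale b q) = quot_scale (a * b) q.
Proof. by have [v ->] := quotmodW q; rewrite !to_quotmodZ scalerA. Qed.
Fact quot_scale1 : left_id 1 quot_scale.
Proof. by move=> q; have [v ->] := quotmodW q; rewrite to_quotmodZ scale1r. Qed.
Fact quot_scaleDr : right_distributive quot_scale +%R.
Proof.
move=> a p q; have [u ->] := quotmodW p; have [v ->] := quotmodW q.
by rewrite -to_quotmodD !to_quotmodZ scalerDr to_quotmodD.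
Qed.
Fact quot_scaleDl q : {morph quot_scale^~ q : a b / a + b}.
Proof.
by move=> a b; have [v ->] := quotmodW q; rewrite !to_quotmodZ scalerDl to_quotmodD.
Qed.
HB.instance Definition _ := GRing.Zmodule_isLmodule.Build R quotmod
  quot_scaleA quot_scale1 quot_scaleDr quot_scaleDl.

End Submodules.

(* The localization V_f: the fraction v / f^n is encoded by the pair (v, n). *)
Section Localization.
Variables (R : comNzRingType) (V : lmodType R) (f : R).

Definition frac_eqv (p q : V * nat) : bool :=
  `[< exists t, f ^+ (t + q.2) *: p.1 = f ^+ (t + p.2) *: q.1 >].

Lemma frac_eqv_equiv : equiv_class_of frac_eqv.
Proof.
split=> [p|p q|q p r].
- by apply/asboolP; exists 0%N.
- by apply/idP/idP => /asboolP[t e]; apply/asboolP; exists t.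
move=> /asboolP[t e1] /asboolP[t' e2]; apply/asboolP.
exists (t + t' + q.2)%N.
rewrite (_ : t + t' + q.2 + r.2 = t' + r.2 + (t + q.2))%N; last lia.
rewrite (_ : t + t' + q.2 + p.2 = t + p.2 + (t' + q.2))%N; last lia.
by rewrite exprD -scalerA e1 [in RHS]exprD -[in RHS]scalerA -e2 !scalerA mulrC.
Qed.

Canonical frac_eqv_equivRel := EquivRelPack frac_eqv_equiv.
Canonical frac_eqv_encModRel := defaultEncModRel frac_eqv.

Definition locmod := {eq_quot frac_eqv}.
HB.instance Definition _ := Choice.on locmod.

Definition lfrac (v : V) (n : nat) : locmod := \pi_locmod (v, n).

Lemma fracP u m v n :
  lfrac u m = lfrac v n <-> exists t, f ^+ (t + n) *: u = f ^+ (t + m) *: v.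
Proof.
split=> [/eqmodP/asboolP //|e].
by apply/eqmodP; apply/asboolP.
Qed.

Lemma frac_reprK (q : locmod) : lfrac (repr q).1 (repr q).2 = q.
Proof. by rewrite /lfrac -surjective_pairing reprK. Qed.

Lemma locmodW (q : locmod) : exists v n, q = lfrac v n.
Proof. by exists (repr q).1, (repr q).2; rewrite frac_reprK. Qed.

Definition loc_zero : locmod := lfrac 0 0.
Definition loc_opp (q : locmod) : locmod := lfrac (- (repr q).1) (repr q).2.
Definition loc_add (p q : locmod) : locmod :=
  lfrac (f ^+ (repr q).2 *: (repr p).1 + f ^+ (repr p).2 *: (repr q).1)
       ((repr p).2 + (repr q).2).
Definition loc_scale (a : R) (q : locmod) : locmod :=
  lfrac (a *: (repr q).1) (repr q).2.

Lemma loc_oppE v n : loc_opp (lfrac v n) = lfrac (- v) n.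
Proof.
have /fracP[t e] := frac_reprK (lfrac v n).
by apply/fracP; exists t; rewrite !scalerN e.
Qed.

Lemma loc_scaleE a v n : loc_scale a (lfrac v n) = lfrac (a *: v) n.
Proof.
have /fracP[t e] := frac_reprK (lfrac v n).
apply/fracP; exists t.
by rewrite scalerA mulrC -scalerA e !scalerA mulrC.
Qed.

Lemma loc_addE u m v n :
  loc_add (lfrac u m) (lfrac v n) = lfrac (f ^+ n *: u + f ^+ m *: v) (m + n).
Proof.
rewrite /loc_add.
have /fracP[t e] := frac_reprK (lfrac u m).
have /fracP[t' e'] := frac_reprK (lfrac v n).
move: (repr (lfrac u m)) (repr (lfrac v n)) e e' => [u1 m1] [v1 n1] /= e e'.
apply/fracP; exists (t + t')%N.
rewrite !scalerDr !scalerA -!exprD; congr (_ + _).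
  rewrite (_ : t + t' + (m + n) + n1 = t' + n + n1 + (t + m))%N; last lia.
  rewrite (_ : t + t' + (m1 + n1) + n = t' + n + n1 + (t + m1))%N; last lia.
  by rewrite [in LHS]exprD [in RHS]exprD -!scalerA e.
rewrite (_ : t + t' + (m + n) + m1 = t + m + m1 + (t' + n))%N; last lia.
rewrite (_ : t + t' + (m1 + n1) + m = t + m + m1 + (t' + n1))%N; last lia.
by rewrite [in LHS]exprD [in RHS]exprD -!scalerA e'.
Qed.

Fact loc_addA : associative loc_add.
Proof.
move=> p q r; have [u [m ->]] := locmodW p; have [v [n ->]] := locmodW q.
have [w [l ->]] := locmodW r; rewrite !loc_addE !scalerDr !scalerA -!exprD.
by rewrite addrA addnA (addnC l n) (addnC l m).
Qed.
Fact loc_addC : commutative loc_add.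
Proof.
move=> p q; have [u [m ->]] := locmodW p; have [v [n ->]] := locmodW q.
by rewrite !loc_addE addrC addnC.
Qed.
Fact loc_add0 : left_id loc_zero loc_add.
Proof.
move=> p; have [u [m ->]] := locmodW p.
by rewrite loc_addE scaler0 expr0 scale1r add0r add0n.
Qed.
Fact loc_addN : left_inverse loc_zero loc_opp loc_add.
Proof.
move=> p; have [u [m ->]] := locmodW p.
rewrite loc_oppE loc_addE scalerN addNr; apply/fracP.
by exists 0%N; rewrite !scaler0.
Qed.
HB.instance Definition _ :=
  GRing.isZmodule.Build locmod loc_addA loc_addC loc_add0 loc_addN.

Fact loc_scaleA a b q : loc_scale a (loc_scale b q) = loc_scale (a * b) q.
Proof. by have [v [n ->]] := locmodW q; rewrite !loc_scaleE scalerA. Qed.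
Fact loc_scale1 : left_id 1 loc_scale.
Proof. by move=> q; have [v [n ->]] := locmodW q; rewrite loc_scaleE scale1r. Qed.
Fact loc_scaleDr : right_distributive loc_scale +%R.
Proof.
move=> a p q; have [u [m ->]] := locmodW p; have [v [n ->]] := locmodW q.
rewrite /GRing.add /= loc_addE !loc_scaleE loc_addE scalerDr !scalerA.
by rewrite ![_ * a]mulrC.
Qed.
Fact loc_scaleDl q : {morph loc_scale^~ q : a b / a + b}.
Proof.
move=> a b; have [v [n ->]] := locmodW q.
rewrite !loc_scaleE [RHS]loc_addE -scalerDr -scalerDl.
by apply/fracP; exists 0%N; rewrite !add0n exprD -scalerA.
Qed.
HB.instance Definition _ := GRing.Zmodule_isLmodule.Build R locmod
  loc_scaleA loc_scale1 loc_scaleDr loc_scaleDl.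

End Localization.

Arguments lfrac {R V f} v n.

(* The natural map V_f -> V_h, v / f^n |-> g^n v / h^n, meant for h = g * f. *)
Definition loc_map (R : comNzRingType) (V : lmodType R) (f g h : R)
    (q : locmod V f) : locmod V h :=
  lfrac (g ^+ (repr q).2 *: (repr q).1) (repr q).2.

Lemma loc_mapE (R : comNzRingType) (V : lmodType R) (f g h : R) (v : V) n :
  h = g * f ->
  loc_map g h (lfrac v n : locmod V f) = lfrac (g ^+ n *: v) n.
Proof.
move=> ->; have /fracP[t e] := frac_reprK (lfrac v n : locmod V f).
rewrite /loc_map; move: (repr _) e => [v1 n1] /= e.
apply/fracP; exists t; rewrite !scalerA !exprMn.
rewrite (_ : _ * _ = g ^+ (t + n + n1) * f ^+ (t + n)); last first.
  by rewrite [in RHS]exprD mulrAC.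
rewrite (_ : g ^+ (t + n1) * _ * _ = g ^+ (t + n + n1) * f ^+ (t + n1)).
  by rewrite -!scalerA e.
by rewrite mulrAC -exprD; congr (g ^+ _ * _); lia.
Qed.

Section Graded.
Variable k : fieldType.
Local Notation R := {mpoly k[2]}.

Definition vx : R := 'X_ord0.
Definition vy : R := 'X_ord_max.

(* A grading of an R-module is a family of subsets, G n being the degree n
   component. *)
Record is_grading (M : lmodType R) (G : int -> M -> Prop) : Prop := IsGrading {
  grading0 : forall n, G n 0;
  gradingB : forall n u v, G n u -> G n v -> G n (u - v);
  gradingZ : forall (d : nat) n (p : R) v,
    p \is d.-homog -> G n v -> G (d%:Z + n) (p *: v);
  grading_sum : forall v, exists (s : seq int) (c : int -> M),
    (forall n, G n (c n)) /\ v = \sum_(n <- s) c n;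
  grading_direct : forall (s : seq int) (c : int -> M),
    uniq s -> (forall n, G n (c n)) -> \sum_(n <- s) c n = 0 ->
    {in s, forall n, c n = 0} }.

Definition fin_gen (M : lmodType R) : Prop :=
  exists s : seq M, forall v, v \in submod s.

Definition twist (M : lmodType R) (G : int -> M -> Prop) (a : int) :
    int -> M -> Prop :=
  fun n => G (a + n).

Definition sub_grading (M : lmodType R) (G : int -> M -> Prop) (s : seq M) :
    int -> submod_type s -> Prop :=
  fun n u => G n (val u).

Definition quot_grading (M : lmodType R) (G : int -> M -> Prop) (s : seq M) :
    int -> quotmod s -> Prop :=
  fun n q => exists2 v, G n v & q = to_quotmod s v.

Arguments sub_grading {M} G s n u.
Arguments quot_grading {M} G s n q.

Definition ring_grading (n : int) (p : R^o) : Prop :=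
  match n with
  | Posz d => (p : R) \is d.-homog
  | Negz _ => p = 0
  end.

Definition loc_grading (M : lmodType R) (G : int -> M -> Prop) (f : R) (d : nat) :
    int -> locmod M f -> Prop :=
  fun n q => exists (v : M) (s : nat), G (n + (s * d)%:Z) v /\ q = lfrac v s.

(* vdim Z B is dim_k (Z / B) for k-subspaces B of Z (0 by convention if this is
   infinite). The subfield k of R consists of the constants c%:MP. *)
Definition has_dim (V : lmodType R) (Z B : V -> Prop) (d : nat) : Prop :=
  exists e : 'I_d -> V,
    [/\ forall i, Z (e i),
        forall c : 'I_d -> k, B (\sum_i (c i)%:MP *: e i) -> forall i, c i = 0
      & forall z, Z z -> exists c : 'I_d -> k, B (z - \sum_i (c i)%:MP *: e i)].

Definition vdim (V : lmodType R) (Z B : V -> Prop) : nat :=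
  if pselect (exists d, has_dim Z B d) is left h then projT1 (cid h) else 0%N.

(* Local cohomology at m = (x, y) is the cohomology of the Cech complex
     0 -> M -> M_x (+) M_y -> M_xy -> 0. *)
Section LocalCohomology.
Variables (M : lmodType R) (G : int -> M -> Prop).

Definition cech1 : lmodType R := (locmod M vx * locmod M vy)%type.
Definition cech2 : lmodType R := locmod M (vx * vy).

Definition cech_d0 (v : M) : cech1 := (lfrac v 0, lfrac v 0).
Definition cech_d1 (w : cech1) : cech2 :=
  loc_map vx (vx * vy) w.2 - loc_map vy (vx * vy) w.1.

Definition cech1_grading (n : int) (w : cech1) : Prop :=
  loc_grading G 1 n w.1 /\ loc_grading G 1 n w.2.
Definition cech2_grading (n : int) (w : cech2) : Prop := loc_grading G 2 n w.

Definition lc_dim (j : int) (i : nat) : nat :=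
  match i with
  | 0 => vdim (fun v => G j v /\ cech_d0 v = 0) (fun v => v = 0)
  | 1 => vdim (fun w => cech1_grading j w /\ cech_d1 w = 0)
              (fun w => exists2 v, G j v & w = cech_d0 v)
  | 2 => vdim (fun w => cech2_grading j w)
              (fun w => exists2 u, cech1_grading j u & w = cech_d1 u)
  | _ => 0%N
  end.

End LocalCohomology.

Definition table := int -> 'I_3 -> rat.
Definition column := int -> rat.

Definition ht0 : 'I_3 := @Ordinal 3 0 isT.
Definition ht1 : 'I_3 := @Ordinal 3 1 isT.
Definition ht2 : 'I_3 := @Ordinal 3 2 isT.

Definition lc_table (M : lmodType R) (G : int -> M -> Prop) : table :=
  fun j i => (lc_dim G j i)%:R.

Definition hilbert (M : lmodType R) (G : int -> M -> Prop) : column :=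
  fun n => (vdim (G n) (fun v => v = 0))%:R.

Definition tcol (H : table) (i : 'I_3) : column := fun j => H j i.

Fixpoint Delta (t : nat) (C : column) (n : int) : rat :=
  if t is t'.+1 then Delta t' C n - Delta t' C (n + 1) else C n.

(* The t-fold products of x and y; they generate m^t. *)
Fixpoint max_pow_gens (t : nat) : seq R^o :=
  if t is t'.+1 then [seq p * q | p <- [:: vx; vy], q <- max_pow_gens t']
  else [:: 1].

(* k(a), k[x](a), R(a) and m^t(a). *)
Inductive piece := Sk of int | Skx of int | SR of int | Sm of nat & int.

Definition piece_table (S : piece) : table :=
  match S with
  | Sk a => lc_table (twist (quot_grading ring_grading [:: vx : R^o; vy : R^o]) a)
  | Skx a => lc_table (twist (quot_grading ring_grading [:: vy : R^o]) a)
  | SR a => lc_table (twist ring_grading a)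
  | Sm t a => lc_table (twist (sub_grading ring_grading (max_pow_gens t)) a)
  end.

Definition artin_column (t : nat) (a : int) : column :=
  hilbert (twist (quot_grading ring_grading (max_pow_gens t)) a).

Definition lincomb (D : seq (rat * piece)) : table :=
  fun j i => \sum_(p <- D) p.1 * piece_table p.2 j i.

Definition table_sub (H1 H2 : table) : table := fun j i => H1 j i - H2 j i.

Definition is_max (P : int -> Prop) (a : int) : Prop :=
  P a /\ forall n, P n -> n <= a.

Inductive stage := Step1 | Step2 | Step3 of int | Step4 | Finished.
(* st_output lists the multiples of tables subtracted so far. *)
Record state := State {
  st_stage : stage;
  st_table : table;
  st_output : seq (rat * piece) }.

Definition emit (s : stage) (H : table) (out D : seq (rat * piece)) : state :=
  State s (table_sub H (lincomb D)) (out ++ D).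

Definition step2_set (H : table) (n : int) : Prop :=
  Delta 2 (tcol H ht2) (n - 2) <> 0.

Definition step4_set (H : table) (n : int) : Prop :=
  Delta 1 (tcol H ht1) (n - 1) <> 0.

Definition step3_column (H : table) (a : int) : column := fun n =>
  if a <= n then Num.min (H n ht1) (n - a + 1)%:~R else 0.

(* In step_1, s enumerates the support of H^0, which must be finite for the sum
   over Z to be a finite combination. In step_3, zero coefficients are left out
   of the subtracted combination. *)
Inductive step : state -> state -> Prop :=
| step_1 (H : table) out (s : seq int) :
    uniq s -> (forall n, reflect (H n ht0 <> 0) (n \in s)) ->
    step (State Step1 H out)
         (emit Step2 H out [seq (H n ht0, Sk (- n)) | n <- s])
| step_2_empty H out :
    (forall n, ~ step2_set H n) ->
    step (State Step2 H out) (State Step4 H out)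
| step_2_sub H out a :
    is_max (step2_set H) a -> H a ht1 = 0 ->
    step (State Step2 H out) (emit Step2 H out [:: (1, SR (- a))])
| step_2_go H out a :
    is_max (step2_set H) a -> 0 < H a ht1 ->
    step (State Step2 H out) (State (Step3 a) H out)
| step_3 H out a (r : seq rat) :
    (forall c, c \in r -> 0 <= c) ->
    (forall j, step3_column H a j =
               \sum_(n < size r) r`_n * artin_column n.+1 (- a) j) ->
    step (State (Step3 a) H out)
         (emit Step2 H out
            [seq p <- [seq (r`_n, Sm n.+1 (- a)) | n <- iota 0 (size r)]
                 | p.1 != 0])
| step_4_empty H out :
    (forall n, ~ step4_set H n) ->
    step (State Step4 H out) (State Finished H out)
| step_4_sub H out b :
    is_max (step4_set H) b ->
    step (State Step4 H out) (emit Step4 H out [:: (1, Skx (- b))]).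

(* Runs are not literally unique: s in step_1 may be reordered and r in step_3
   padded with zeros. terminates_in P st says that every maximal run from st is
   finite and ends at stage Finished, in a state satisfying P. *)
Inductive terminates_in (P : state -> Prop) (st : state) : Prop :=
| terminates_now : st_stage st = Finished -> P st -> terminates_in P st
| terminates_later :
    (exists st', step st st') ->
    (forall st', step st st' -> terminates_in P st') -> terminates_in P st.

Definition piece_ok (S : piece) : bool := if S is Sm t _ then (0 < t)%N else true.

Definition is_decomposition (D : seq (rat * piece)) (H : table) : Prop :=
  all (fun p => (0 < p.1) && piece_ok p.2) D /\
  (forall j i, H j i = lincomb D j i).

End Graded.

(* Main.v *)
Require Import Defs.
From mathcomp Require Import all_boot all_order all_algebra mpoly.
From mathcomp Require Import boolp zify ring lra.

(** Why the algorithm succeeds.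

Write h^i for the columns of the table of M. The run is governed by a finite
multiset A of degrees and one inequality. First, h^2_j is the sum over a in A of
max(0, a - 1 - j), as for the direct sum of the R(-a). Second, for every n there is
a part E of A, with degrees at most n + 1, such that the sum over b in E of
n - b + 1 is at most h^1_n and h^1_(n+1) <= h^1_n + |E| (this is [macaulay_bound]).

The table of M has this shape ([lc_shape]). Let S be the module of sections, the
kernel of the map from M_x (+) M_y to M_xy, so that H^1 is the cokernel of M -> S.
The Koszul complex of x and y is exact on the localizations, and two connecting
homomorphisms identify S_n / (xS_(n-1) + yS_(n-1)) with the socle of H^2 in degree
n - 2 ([socle_dim]). The second differences of the Hilbert functions of S and of
H^2 are therefore both the number of minimal generators of S ([secs_gens],
[h2_finite]). This number is zero outside a finite range, because the dimension of
S_n stays bounded as n tends to minus infinity ([secs_bound], [secs_small]); A is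
the multiset of degrees of the minimal generators. Above a degree n0, H^1 is
generated by a basis of S_n0 and the generators with degrees in A. Counting
standard monomials gives the inequality with these generators ([macaulay]), and
those of degree n0 drop out when n0 is so low that n - n0 + 1 exceeds h^1_n
([h1_macaulay]). The same count shows that graded submodules are finitely generated
([noetherian]), which yields the vanishing of H^0 and H^1 in large degrees and the
finiteness of all dimensions.

The pieces are computed by the same means ([table_k], [table_kx], [table_R],
[table_mt]): R(a) and m^t(a) have the same sections, and H^1(m^t) is R/m^t.

In step 2 the algorithm finds the largest element a of A. Both when h^1_a = 0 and
through step 3, the outcome is that a leaves A and h^1_n becomes
h^1_n - min(h^1_n, max(0, n - a + 1)). The inequality survives ([bound_peel]), because in E
the degree a can stand for any other one. It also shows that h^1 does not increase
at n when h^1_n < n - a + 1, so the ratios min(h^1_n, n - a + 1) / (n - a + 1) are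
nonincreasing; their differences are the coefficients of step 3 ([peel_ratio],
[step3_solution]). When A is empty, h^2 is zero and the inequality says that h^1 is
nonincreasing. It vanishes in large degrees, and step 4 lowers its constant value
in low degrees by one in each round ([step4_ends]). *)

Set Implicit Arguments.
Unset Strict Implicit.
Unset Printing Implicit Defensive.

Import Order.TTheory GRing.Theory Num.Theory.
Local Open Scope ring_scope.

(** * Dimensions of subquotients *)

Section Dimension.
Variable k : fieldType.
Local Notation R := {mpoly k[2]}.

(** Subspaces over [k], which acts through the constants of [R]. They are
predicates and not types because the graded pieces, the cycles and the
boundaries whose dimensions are compared are given as predicates. *)
Record subsp (V : lmodType R) (B : V -> Prop) : Prop := Subsp {
  subsp0 : B 0;
  subsp_lin : forall (c : k) u v, B u -> B v -> B (c%:MP *: u + v) }.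

Definition klin (V W : lmodType R) (f : V -> W) : Prop :=
  forall (c : k) u v, f (c%:MP *: u + v) = c%:MP *: f u + f v.

Definition null (V : lmodType R) (v : V) : Prop := v = 0.

Section Subspaces.
Variables (V : lmodType R) (B : V -> Prop).
Variable hB : subsp B.

Lemma subspD u v : B u -> B v -> B (u + v).
Proof. by move=> hu hv; have := subsp_lin hB 1 hu hv; rewrite mpolyC1 scale1r. Qed.

Lemma subspZ (c : k) u : B u -> B (c%:MP *: u).
Proof. by move=> hu; have := subsp_lin hB c hu (subsp0 hB); rewrite addr0. Qed.

Lemma subspN u : B u -> B (- u).
Proof. by move=> /(subspZ (-1)); rewrite mpolyCN mpolyC1 scaleN1r. Qed.

Lemma subspB u v : B u -> B v -> B (u - v).
Proof. by move=> hu hv; apply: subspD => //; exact: subspN. Qed.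

Lemma subsp_sum (I : Type) (r : seq I) (P : pred I) (F : I -> V) :
  (forall i, P i -> B (F i)) -> B (\sum_(i <- r | P i) F i).
Proof. by move=> h; apply: (big_ind B) => //; [exact: subsp0|exact: subspD]. Qed.

End Subspaces.

Lemma klin0 (V W : lmodType R) (f : V -> W) : klin f -> f 0 = 0.
Proof. by move=> hf; have := hf (-1) 0 0; rewrite mpolyCN mpolyC1 !scaleN1r oppr0 addr0 addNr. Qed.

Lemma klinZ (V W : lmodType R) (f : V -> W) (c : k) v :
  klin f -> f (c%:MP *: v) = c%:MP *: f v.
Proof. by move=> hf; rewrite -[in LHS](addr0 (_ *: v)) hf klin0 // addr0. Qed.

Lemma klinD (V W : lmodType R) (f : V -> W) : klin f -> {morph f : u v / u + v}.
Proof. by move=> hf u v; have := hf 1 u v; rewrite mpolyC1 !scale1r. Qed.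

Lemma klinB (V W : lmodType R) (f : V -> W) : klin f -> {morph f : u v / u - v}.
Proof.
move=> hf u v; rewrite klinD //; congr (_ + _).
by have := klinZ (-1) v hf; rewrite mpolyCN mpolyC1 !scaleN1r.
Qed.

Lemma klin_scale (V : lmodType R) (p : R) : klin (fun v : V => p *: v).
Proof. by move=> c u v; rewrite scalerDr !scalerA mulrC. Qed.

Lemma subsp_null (V : lmodType R) : subsp (@null V).
Proof. by split=> // c u v -> ->; rewrite /null scaler0 addr0. Qed.

Lemma subsp_preim (V W : lmodType R) (f : V -> W) (Z : V -> Prop) (B : W -> Prop) :
  klin f -> subsp Z -> subsp B -> subsp (fun v => Z v /\ B (f v)).
Proof.
move=> hf hZ hB; split; first by rewrite (klin0 hf); split; apply: subsp0.
move=> c u v [zu bu] [zv bv]; split; first exact: subsp_lin.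
by rewrite hf; exact: subsp_lin.
Qed.

Lemma subsp_im (V W : lmodType R) (f : V -> W) (Z : V -> Prop) :
  klin f -> subsp Z -> subsp (fun w => exists2 v, Z v & w = f v).
Proof.
move=> hf hZ; split; first by exists 0; [exact: subsp0|rewrite klin0].
move=> c _ _ [u zu ->] [v zv ->]; exists (c%:MP *: u + v); last by rewrite hf.
exact: subsp_lin.
Qed.

Section HasDim.
Variables (V : lmodType R).
Implicit Types Z B : V -> Prop.

(** Steinitz exchange: if [m > n], a row of the left kernel of the coefficient
matrix is a relation between the vectors [e]. *)
Lemma has_dim_le Z B n m (e : 'I_m -> V) (f : 'I_n -> V) :
  subsp B -> (forall i, Z (e i)) ->
  (forall c : 'I_m -> k, B (\sum_i (c i)%:MP *: e i) -> forall i, c i = 0) ->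
  (forall z, Z z -> exists c : 'I_n -> k, B (z - \sum_i (c i)%:MP *: f i)) ->
  (m <= n)%N.
Proof.
move=> hB Ze ind sp.
have /choice [A hA] : forall i, exists c : 'I_n -> k, B (e i - \sum_j (c j)%:MP *: f j).
  by move=> i; apply: sp.
pose Am := \matrix_(i < m, j < n) A i j.
rewrite leqNgt; apply/negP => nm.
have: kermx Am != 0.
  by rewrite kermx_eq0 /row_free neq_ltn (leq_ltn_trans (rank_leq_col _)).
move=> /rowV0Pn[u /sub_kermxP uA /eqP]; apply.
apply/rowP => i; rewrite mxE; apply: (ind (fun i => u 0 i)).
have -> : \sum_i (u 0 i)%:MP *: e i =
    \sum_i (u 0 i)%:MP *: (e i - \sum_j (A i j)%:MP *: f j).
  under [RHS]eq_bigr => l _ do rewrite scalerBr.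
  rewrite sumrB [X in _ - X](_ : _ = 0) ?subr0 //.
  under eq_bigr => l _ do rewrite scaler_sumr.
  rewrite exchange_big big1 // => j _ /=.
  under eq_bigr => l _ do rewrite scalerA -mpolyCM.
  rewrite -scaler_suml -(big_morph _ (@mpolyCD _ _) (@mpolyC0 _ _)).
  rewrite (_ : \sum_l u 0 l * A l j = 0) ?mpolyC0 ?scale0r //.
  transitivity ((u *m Am) 0 j); last by rewrite uA mxE.
  by rewrite mxE; apply: eq_bigr => l _; rewrite /Am mxE.
by apply: subsp_sum => // l _; exact: subspZ.
Qed.

Lemma has_dim_uniq Z B m n : subsp B -> has_dim Z B m -> has_dim Z B n -> m = n.
Proof.
move=> hB [e [Ze ie se]] [f [Zf jf sf]]; apply/eqP; rewrite eqn_leq.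
by rewrite (has_dim_le hB Ze ie sf) (has_dim_le hB Zf jf se).
Qed.

Lemma vdimE Z B d : subsp B -> has_dim Z B d -> vdim Z B = d.
Proof.
move=> hB h; rewrite /vdim; case: pselect => [h'|[]]; last by exists d.
by case: cid => d' /= h''; apply: has_dim_uniq h'' h.
Qed.

(** An independent family of maximal length is a basis. *)
Lemma has_dim_ex Z B n (f : 'I_n -> V) : subsp B ->
  (forall z, Z z -> exists c : 'I_n -> k, B (z - \sum_i (c i)%:MP *: f i)) ->
  subsp Z -> exists2 d, has_dim Z B d & (d <= n)%N.
Proof.
move=> hB sp hZ.
pose P m := `[< exists e : 'I_m -> V, (forall i, Z (e i)) /\
  (forall c : 'I_m -> k, B (\sum_i (c i)%:MP *: e i) -> forall i, c i = 0) >].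
have Pn m : P m -> (m <= n)%N.
  by move=> /asboolP[e [Ze ie]]; apply: has_dim_le Ze ie sp.
have P0 : exists m, P m.
  by exists 0%N; apply/asboolP; exists (fun=> 0); split=> [[]|c _ []].
case: (ex_maxnP P0 Pn) => d Pd dmax; exists d; last exact: Pn.
have /asboolP[e [Ze ie]] := Pd; exists e; split=> // z Zz.
apply: contrapT => nz; suff /dmax : P d.+1 by rewrite ltnn.
apply/asboolP.
pose e' (i : 'I_d.+1) := if unlift ord0 i is Some j then e j else z.
exists e'; split.
  by move=> i; rewrite /e'; case: unliftP => [j _|_].
move=> c; rewrite big_ord_recl.
have -> : e' ord0 = z by rewrite /e' unlift_none.
under eq_bigr => i _ do rewrite /e' liftK.
move=> Bc.
have c0 : c ord0 = 0.
  apply: contrapT => /eqP c0; apply: nz.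
  exists (fun i => - (c ord0)^-1 * c (lift ord0 i)).
  have := subspZ hB (c ord0)^-1 Bc.
  rewrite scalerDr scalerA -mpolyCM mulVf // mpolyC1 scale1r scaler_sumr.
  congr (B (_ + _)); rewrite -sumrN; apply: eq_bigr => i _.
  by rewrite scalerA -mpolyCM mulNr mpolyCN scaleNr opprK.
move=> i; case: (unliftP ord0 i) => [j ->|-> //].
move: Bc; rewrite c0 mpolyC0 scale0r add0r => /ie; exact.
Qed.

Lemma has_dim0 Z B : (forall z, Z z -> B z) -> has_dim Z B 0.
Proof.
move=> ZB; exists (fun=> 0); split=> [[]|c _ []|z /ZB hz] //.
by exists (fun=> 0); rewrite big_ord0 subr0.
Qed.

Lemma has_dim_eq0 Z B : has_dim Z B 0 -> forall z, Z z -> B z.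
Proof. by move=> [e [_ _ sp]] z /sp[c]; rewrite big_ord0 subr0. Qed.

(** A basis of [Y] modulo [B] followed by one of [Z] modulo [Y] is a basis of [Z]
modulo [B]. *)
Lemma has_dimD Z Y B m n : subsp B -> subsp Y ->
  (forall v, B v -> Y v) -> (forall v, Y v -> Z v) ->
  has_dim Y B m -> has_dim Z Y n -> has_dim Z B (m + n).
Proof.
move=> hB hY BY YZ [e [Ye ie se]] [f [Zf jf sf]].
pose h (i : 'I_(m + n)) := match split i with inl j => e j | inr j => f j end.
have hs (c : 'I_(m + n) -> k) : \sum_i (c i)%:MP *: h i =
    \sum_i (c (lshift n i))%:MP *: e i + \sum_i (c (rshift m i))%:MP *: f i.
  rewrite big_split_ord /=; congr (_ + _); apply: eq_bigr => i _; rewrite /h.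
    by rewrite (unsplitK (inl i)).
  by rewrite (unsplitK (inr i)).
exists h; split.
- by move=> i; rewrite /h; case: split => j //; apply: YZ.
- move=> c; rewrite hs => Bc.
  have c2 : forall i, c (rshift m i) = 0.
    apply: jf; rewrite -[X in Y X](addKr (\sum_i (c (lshift n i))%:MP *: e i)).
    apply: subspD => //; last exact: BY.
    by apply: subspN => //; apply: subsp_sum => // i _; apply: subspZ.
  move: Bc; rewrite [X in _ + X]big1 ?addr0 => [|i _]; last by rewrite c2 mpolyC0 scale0r.
  move=> /ie c1 i; rewrite -(splitK i); case: (split i) => j /=; [exact: c1|exact: c2].
- move=> z /sf[c /se[d hd]].
  exists (fun i => match split i with inl j => d j | inr j => c j end).
  rewrite hs (eq_bigr (fun i => (d i)%:MP *: e i)) => [|i _]; last first.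
    by rewrite (unsplitK (inl i)).
  rewrite [X in _ - (_ + X)](eq_bigr (fun i => (c i)%:MP *: f i)) => [|i _]; last first.
    by rewrite (unsplitK (inr i)).
  by rewrite opprD addrA addrAC.
Qed.

(** Both pieces of a filtration are finite dimensional: a basis of [Z] modulo [B]
spans each of them, although its vectors need not lie in [Y]. *)
Lemma has_dim_sub Z Y B d : subsp B -> subsp Y -> subsp Z ->
  (forall v, B v -> Y v) -> (forall v, Y v -> Z v) -> has_dim Z B d ->
  exists m n, [/\ has_dim Y B m, has_dim Z Y n & d = (m + n)%N].
Proof.
move=> hB hY hZ BY YZ hd; have [e [Ze ie se]] := hd.
have [|m hm _] := has_dim_ex (f := e) (Z := Y) hB _ hY; first by move=> z /YZ /se.
have [|n hn _] := has_dim_ex (f := e) (Z := Z) hY _ hZ.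
  by move=> z /se[c /BY]; exists c.
exists m, n; split=> //; apply: has_dim_uniq hd _ => //.
exact: has_dimD hm hn.
Qed.

Lemma eq_has_dim Z Z' B B' d : (forall v, Z v <-> Z' v) -> (forall v, B v <-> B' v) ->
  has_dim Z B d -> has_dim Z' B' d.
Proof.
move=> hZ hB; have -> : Z' = Z by apply/funext => v; apply/propext; symmetry.
by have -> : B' = B by apply/funext => v; apply/propext; symmetry.
Qed.

End HasDim.

(** An isomorphism between [Z / B] and [Z' / B'] may be given by a linear relation
instead of a map. This is the form in which connecting homomorphisms come, where
the element of the target depends on choices. *)
Lemma has_dim_rel (V W : lmodType R) (Rel : V -> W -> Prop)
    (Z B : V -> Prop) (Z' B' : W -> Prop) d :
  Rel 0 0 ->
  (forall (c : k) u u' v v', Rel u u' -> Rel v v' -> Rel (c%:MP *: u + v) (c%:MP *: u' + v')) ->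
  subsp Z -> subsp Z' ->
  (forall z, Z z -> exists2 w, Z' w & Rel z w) ->
  (forall w, Z' w -> exists2 z, Z z & Rel z w) ->
  (forall z w, Z z -> Z' w -> Rel z w -> (B z <-> B' w)) ->
  has_dim Z B d -> has_dim Z' B' d.
Proof.
move=> r0 rl hZ hZ' tot sur cmp [e [Ze ie se]].
have /choice [e' he] : forall i, exists w, Z' w /\ Rel (e i) w.
  by move=> i; have [w] := tot _ (Ze i); exists w.
have Zs c : Z (\sum_i (c i)%:MP *: e i).
  by apply: subsp_sum => // i _; apply: subspZ.
have Zs' c : Z' (\sum_i (c i)%:MP *: e' i).
  by apply: subsp_sum => // i _; apply: subspZ => //; case: (he i).
have rs (c : 'I_d -> k) : Rel (\sum_i (c i)%:MP *: e i) (\sum_i (c i)%:MP *: e' i).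
  apply: (big_ind2 Rel) => // [u u' v v' h h'|i _].
    by have := rl 1 _ _ _ _ h h'; rewrite mpolyC1 !scale1r.
  by have := rl (c i) _ _ _ _ (proj2 (he i)) r0; rewrite !addr0.
exists e'; split=> [i|c|w Zw]; first by case: (he i).
  by move=> /(cmp _ _ (Zs c) (Zs' c) (rs c)) /ie.
have [z Zz rz] := sur w Zw; have [c hc] := se z Zz; exists c.
have := rl (-1) _ _ _ _ (rs c) rz; rewrite mpolyCN mpolyC1 !scaleN1r ![- _ + _]addrC.
by move=> /cmp[]; [exact: subspB|exact: subspB|move=> h _; exact: h].
Qed.

Section Iso.
Variables (V W : lmodType R) (f : V -> W) (Z B : V -> Prop) (Z' B' : W -> Prop).
Variables (hf : klin f) (hZ : subsp Z) (hZ' : subsp Z') (hB' : subsp B').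
Variable fZ : forall z, Z z -> Z' (f z).
Variable fB : forall z, Z z -> (B' (f z) <-> B z).
Variable fS : forall w, Z' w -> exists2 z, Z z & B' (w - f z).

Lemma has_dim_iso d : has_dim Z B d <-> has_dim Z' B' d.
Proof.
have r0 : B' (0 - f 0) by rewrite klin0 // subr0; apply: subsp0.
have rl (c : k) u u' v v' : B' (u' - f u) -> B' (v' - f v) ->
    B' ((c%:MP *: u' + v') - f (c%:MP *: u + v)).
  by move=> h h'; rewrite hf opprD addrACA -scalerBr; apply: subsp_lin.
have tot z : Z z -> exists2 w, Z' w & B' (w - f z).
  by move=> zz; exists (f z); [exact: fZ|rewrite subrr; apply: subsp0].
have cmp z w : Z z -> Z' w -> B' (w - f z) -> (B z <-> B' w).
  move=> zz zw h; rewrite -fB //; split=> h'.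
    by rewrite -(subrK (f z) w); apply: subspD.
  by rewrite -(subKr w (f z)); apply: subspB.
split; first exact: (has_dim_rel (Rel := fun z w => B' (w - f z))).
apply: (has_dim_rel (Rel := fun w z => B' (w - f z))) => // [c u u' v v'|w z zw zz h].
  exact: rl.
by symmetry; apply: cmp.
Qed.

End Iso.

Lemma has_dim_prod (V W : lmodType R) (Z B : V -> Prop) (Z' B' : W -> Prop) m n :
  subsp B -> subsp B' -> subsp Z -> subsp Z' ->
  (forall v, B v -> Z v) -> (forall v, B' v -> Z' v) ->
  has_dim Z B m -> has_dim Z' B' n ->
  has_dim (fun p : V * W => Z p.1 /\ Z' p.2) (fun p : V * W => B p.1 /\ B' p.2) (m + n).
Proof.
move=> hB hB' hZ hZ' BZ BZ' hm hn.
have sub2 (P : V -> Prop) (Q : W -> Prop) : subsp P -> subsp Q ->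
    subsp (fun p : V * W => P p.1 /\ Q p.2).
  move=> hP hQ; split; first by split; apply: subsp0.
  by move=> c [u u'] [v v'] /= [? ?] [? ?]; split; apply: subsp_lin.
apply: (@has_dimD _ _ (fun p => Z p.1 /\ B' p.2)); try exact: sub2.
- by move=> [v w] /= [? ?]; split=> //; apply: BZ.
- by move=> [v w] /= [? ?]; split=> //; apply: BZ'.
- apply: (has_dim_rel (Rel := fun v p => v = p.1)) hm => //; try exact: sub2.
  + by move=> c u [u' u''] v [v' v''] /= -> ->.
  + by move=> z ?; exists (z, 0) => //; split=> //; apply: subsp0.
  + by move=> [v w] [/= ? _]; exists v.
  + by move=> z [v w] ? [/= _ ?] ->; split=> [|[]].
- apply: (has_dim_rel (Rel := fun v p => v = p.2)) hn => //; try exact: sub2.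
  + by move=> c u [u' u''] v [v' v''] /= -> ->.
  + by move=> z ?; exists (0, z) => //; split=> //; apply: subsp0.
  + by move=> [v w] [/= _ ?]; exists w.
  + by move=> z [v w] ? [/= ? _] ->; split=> [|[]].
Qed.

Section Exact.
Variables (V W : lmodType R) (f : V -> W) (Z B : V -> Prop) (Z' B' : W -> Prop).
Variables (hf : klin f) (hZ : subsp Z) (hB : subsp B) (hZ' : subsp Z') (hB' : subsp B').
Variable fZ : forall z, Z z -> Z' (f z).
Variable fB : forall z, B z -> B' (f z).
Variable BZ : forall z, B z -> Z z.
Variable BZ' : forall z, B' z -> Z' z.

Definition kernel_mod := fun v => Z v /\ B' (f v).
(** The image of [Z] thickened by [B'], so that it is a subspace between [B'] and
[Z']. *)
Definition image_mod := fun w => exists2 v, Z v & B' (w - f v).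

Lemma subsp_kernel_mod : subsp kernel_mod. Proof. exact: subsp_preim. Qed.

Lemma subsp_image_mod : subsp image_mod.
Proof.
split; first by exists 0; [exact: subsp0|rewrite klin0 // subr0; exact: subsp0].
move=> c u v [u' zu hu] [v' zv hv]; exists (c%:MP *: u' + v'); first exact: subsp_lin.
by rewrite hf opprD addrACA -scalerBr; apply: subsp_lin.
Qed.

Lemma has_dim_image_mod d : has_dim Z kernel_mod d <-> has_dim image_mod B' d.
Proof.
have a1 z : Z z -> image_mod (f z) by move=> zz; exists z => //; rewrite subrr; apply: subsp0.
have a2 z : Z z -> (B' (f z) <-> kernel_mod z) by move=> zz; split=> [|[]].
have a3 w : image_mod w -> exists2 z, Z z & B' (w - f z) by case=> z; exists z.
exact: has_dim_iso hf hZ subsp_image_mod hB' a1 a2 a3 d.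
Qed.

Lemma rank_nullity d : has_dim Z B d ->
  exists m n, [/\ has_dim kernel_mod B m, has_dim image_mod B' n & d = (m + n)%N].
Proof.
move=> hd; have [] := has_dim_sub hB subsp_kernel_mod hZ _ _ hd.
- by move=> v bv; split; [exact: BZ|exact: fB].
- by move=> v [].
by move=> m [n [h1 /has_dim_image_mod h2 ->]]; exists m, n.
Qed.

(** Finite dimension passes from the kernel and the target of a map to its source.
Applied to multiplication by [x] and [y], it propagates finiteness from one degree
to the degree below. *)
Lemma has_dim_of_ker m d' : has_dim kernel_mod B m -> has_dim Z' B' d' ->
  exists d, has_dim Z B d.
Proof.
move=> hm hd'; have [] := has_dim_sub hB' subsp_image_mod hZ' _ _ hd'.
- move=> v bv; exists 0; first exact: subsp0.
  by rewrite klin0 // subr0.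
- by move=> w [v zv /BZ' h]; rewrite -(subrK (f v) w); apply: subspD => //; apply: fZ.
move=> n [_ [/has_dim_image_mod hn _ _]]; exists (m + n)%N.
apply: has_dimD hm hn => //; first exact: subsp_kernel_mod.
  by move=> v bv; split; [exact: BZ|exact: fB].
by move=> v [].
Qed.

End Exact.

(** Additivity along the exact sequence 0 -> K/B1 -> Z1/B1 -> Z2/B2 -> Z3/B3 -> 0. *)
Lemma dim_exact (V1 V2 V3 : lmodType R) (f : V1 -> V2) (g : V2 -> V3)
    (Z1 B1 : V1 -> Prop) (Z2 B2 : V2 -> Prop) (Z3 B3 : V3 -> Prop) :
  klin f -> klin g -> subsp Z1 -> subsp B1 -> subsp Z2 -> subsp B2 ->
  subsp Z3 -> subsp B3 ->
  (forall v, B1 v -> Z1 v) -> (forall v, B2 v -> Z2 v) -> (forall v, B3 v -> Z3 v) ->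
  (forall v, Z1 v -> Z2 (f v)) -> (forall v, Z2 v -> Z3 (g v)) ->
  (forall v, B1 v -> B2 (f v)) -> (forall v, B2 v -> B3 (g v)) ->
  (forall v, Z1 v -> B3 (g (f v))) ->
  (forall v, Z2 v -> B3 (g v) -> exists2 u, Z1 u & B2 (v - f u)) ->
  (forall w, Z3 w -> exists2 v, Z2 v & B3 (w - g v)) ->
  forall c d1 d2 d3,
  has_dim (fun v => Z1 v /\ B2 (f v)) B1 c ->
  has_dim Z1 B1 d1 -> has_dim Z2 B2 d2 -> has_dim Z3 B3 d3 ->
  (d1 + d3 = d2 + c)%N.
Proof.
move=> hf hg hZ1 hB1 hZ2 hB2 hZ3 hB3 BZ1 BZ2 BZ3 fZ gZ fB gB gf ex sj c d1 d2 d3 hc h1 h2 h3.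
have [m [n [hm hn ->]]] := rank_nullity hf hZ1 hB1 hB2 fB BZ1 h1.
have [m' [n' [hm' hn' ->]]] := rank_nullity hg hZ2 hB2 hB3 gB BZ2 h2.
have -> : c = m by apply: has_dim_uniq hc hm.
have -> : d3 = n'.
  apply: has_dim_uniq h3 _ => //; apply: eq_has_dim hn' => // w.
  split=> [[v zv /BZ3 bw]|/sj //]; rewrite -(subrK (g v) w); apply: subspD => //.
  exact: gZ.
have -> : n = m'.
  apply: has_dim_uniq hn _ => //; apply: eq_has_dim hm' => // w.
  split=> [[zw bw]|[v zv bw]]; first by have [v] := ex w zw bw; exists v.
  split; rewrite -(subrK (f v) w); first by apply: subspD => //; [exact: BZ2|exact: fZ].
  by rewrite klinD //; apply: subspD => //; [exact: gB|exact: gf].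
lia.
Qed.

End Dimension.

(** * Standard monomials and the growth of Hilbert functions *)

Section Growth.
Variable k : fieldType.
Local Notation R := {mpoly k[2]}.
Local Notation x := (vx k).
Local Notation y := (vy k).

Section Adjoin.
Variable V : lmodType R.
Implicit Types (B P : V -> Prop) (s t : seq V).

Definition adjoin B (w : V) : V -> Prop := fun v => exists c : k, B (v - c%:MP *: w).

Fixpoint adjoins B s := if s is w :: s' then adjoins (adjoin B w) s' else B.

(** The number of entries of [s] that are not combinations, modulo [B], of the
entries before them. For a list of monomials these are the standard monomials of
Groebner basis theory. *)
Fixpoint std_count B s : nat :=
  if s is w :: s' then (~~ `[< B w >] + std_count (adjoin B w) s')%N else 0%N.

Lemma subsp_adj B w : subsp B -> subsp (adjoin B w).
Proof.
move=> hB; split; first by exists 0; rewrite mpolyC0 scale0r subr0; apply: subsp0.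
move=> c u v [a hu] [b hv]; exists (c * a + b).
rewrite mpolyCD mpolyCM scalerDl -scalerA opprD addrACA -scalerBr.
exact: subsp_lin.
Qed.

Lemma subsp_adjs B s : subsp B -> subsp (adjoins B s).
Proof. by elim: s B => //= w s IH B hB; apply: IH; apply: subsp_adj. Qed.

Lemma adj_incl B w v : B v -> adjoin B w v.
Proof. by move=> hv; exists 0; rewrite mpolyC0 scale0r subr0. Qed.

Lemma adj_mem B w : subsp B -> adjoin B w w.
Proof. by move=> hB; exists 1; rewrite mpolyC1 scale1r subrr; apply: subsp0. Qed.

Lemma adjs_incl B s v : B v -> adjoins B s v.
Proof. by elim: s B => //= w s IH B hv; apply: IH; apply: adj_incl. Qed.

Lemma adjs_mem B s v : subsp B -> v \in s -> adjoins B s v.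
Proof.
elim: s B => //= w s IH B hB; rewrite inE => /orP[/eqP ->|vs].
  by apply: adjs_incl; apply: adj_mem.
by apply: IH => //; apply: subsp_adj.
Qed.

Lemma adjs_min B s P : subsp P -> (forall v, B v -> P v) ->
  (forall v, v \in s -> P v) -> forall v, adjoins B s v -> P v.
Proof.
move=> hP; elim: s B => //= w s IH B BP sP; apply: IH => [v [c bv]|v vs].
  rewrite -(subrK (c%:MP *: w) v); apply: subspD => //; first exact: BP.
  by apply: subspZ => //; apply: sP; rewrite inE eqxx.
by apply: sP; rewrite inE vs orbT.
Qed.

Lemma adjs_cat B s t : adjoins B (s ++ t) = adjoins (adjoins B s) t.
Proof. by elim: s B => /=. Qed.

Lemma std_count_cat B s t : std_count B (s ++ t) = (std_count B s + std_count (adjoins B s) t)%N.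
Proof. by elim: s B => //= w s IH B; rewrite IH addnA. Qed.

Lemma std_count_size B s : (std_count B s <= size s)%N.
Proof. by elim: s B => //= w s IH B; have := IH (adjoin B w); case: asbool => /=; lia. Qed.

Lemma has_dim_adj B w : subsp B -> has_dim (adjoin B w) B (~~ `[< B w >]).
Proof.
move=> hB; case: asboolP => Bw /=.
  apply: has_dim0 => z [c hz]; rewrite -(subrK (c%:MP *: w) z).
  by apply: subspD => //; apply: subspZ.
exists (fun=> w); split=> [i|c|z [c hz]]; first exact: adj_mem.
  rewrite big_ord_recl big_ord0 addr0 => Bc i; rewrite ord1.
  apply: contrapT => /eqP c0; apply: Bw.
  have := subspZ hB (c ord0)^-1 Bc.
  by rewrite scalerA -mpolyCM mulVf // mpolyC1 scale1r.
by exists (fun=> c); rewrite big_ord_recl big_ord0 addr0.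
Qed.

Lemma has_dim_adjs B s : subsp B -> has_dim (adjoins B s) B (std_count B s).
Proof.
elim: s B => [|w s IH] B hB /=; first by apply: has_dim0.
apply: (@has_dimD _ _ _ (adjoin B w)) => //.
- exact: subsp_adj.
- by move=> v; apply: adj_incl.
- by move=> v; apply: adjs_incl.
- exact: has_dim_adj.
- by apply: IH; apply: subsp_adj.
Qed.

Lemma std_countE B s : std_count B s =
  (\sum_(0 <= i < size s) ~~ `[< adjoins B (take i s) s`_i >])%N.
Proof.
elim: s B => [|w s IH] B /=; first by rewrite big_geq.
by rewrite big_nat_recl //= IH.
Qed.

End Adjoin.

Lemma adjs_map (V W : lmodType R) (f : V -> W) (B : V -> Prop) (B' : W -> Prop) s s' :
  klin f -> subsp B' -> (forall v, B v -> adjoins B' s' (f v)) ->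
  (forall v, v \in s -> adjoins B' s' (f v)) ->
  forall v, adjoins B s v -> adjoins B' s' (f v).
Proof.
move=> hf hB' h1 h2.
apply: (@adjs_min _ _ _ (fun v => adjoins B' s' (f v))) => //.
have hP := subsp_adjs s' hB'.
split; first by rewrite klin0 //; apply: subsp0.
by move=> c u v ? ?; rewrite hf; apply: subsp_lin.
Qed.

(** The number of monomials of degree [n - b] in [x] and [y], that is
max(0, n - b + 1). *)
Definition mon_dim (n b : int) : nat := if b <= n then `|n - b|.+1%N else 0%N.

Lemma mon_dimS n b : b <= n + 1 -> mon_dim (n + 1) b = (mon_dim n b).+1.
Proof. by rewrite /mon_dim; case: ifP; case: ifP; lia. Qed.

Lemma mon_dim0 n b : n < b -> mon_dim n b = 0%N.
Proof. by rewrite /mon_dim; case: ifP; lia. Qed.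

Lemma mon_dim_exp n b i : (i < mon_dim n b)%N -> n = b + i%:Z + ((mon_dim n b).-1 - i)%N%:Z.
Proof. by rewrite /mon_dim; case: ifP; lia. Qed.

Section Monomials.
Variable V : lmodType R.
Implicit Types (B : V -> Prop) (g : int * V).

(** The [i]-th monomial of degree [n - b], in increasing order of the power of
[x]. From degree [n] to [n + 1], multiplication by [y] keeps the index and
multiplication by [x] raises it by one. *)
Definition mon (n b : int) (i : nat) : R := x ^+ i * y ^+ ((mon_dim n b).-1 - i).

Definition mons n g : seq V := mkseq (fun i => mon n g.1 i *: g.2) (mon_dim n g.1).

Definition allmons n (gens : seq (int * V)) := flatten [seq mons n g | g <- gens].

Lemma size_mons n g : size (mons n g) = mon_dim n g.1.
Proof. by rewrite size_mkseq. Qed.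

Lemma monsx n g i : (i < mon_dim n g.1)%N -> x *: (mons n g)`_i = (mons (n + 1) g)`_i.+1.
Proof.
move=> h; rewrite !nth_mkseq //; last by rewrite /mon_dim in h *; move: h; do 2 case: ifP; lia.
rewrite scalerA /mon mulrA -exprS; congr ((_ * y ^+ _) *: _).
by rewrite mon_dimS /=; move: h; rewrite /mon_dim; case: ifP; lia.
Qed.

Lemma monsy n g i : (i < mon_dim n g.1)%N -> y *: (mons n g)`_i = (mons (n + 1) g)`_i.
Proof.
move=> h; rewrite !nth_mkseq //; last by rewrite /mon_dim in h *; move: h; do 2 case: ifP; lia.
rewrite scalerA /mon mulrCA -exprS; congr ((_ * y ^+ _) *: _).
by rewrite mon_dimS /=; move: h; rewrite /mon_dim; case: ifP; lia.
Qed.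

Definition xyclosed B B' := forall v, B v -> B' (x *: v) /\ B' (y *: v).

Lemma mons_xy n g v : v \in mons n g ->
  (x *: v \in mons (n + 1) g) /\ (y *: v \in mons (n + 1) g).
Proof.
move=> /(nthP 0)[i]; rewrite size_mons => hi <-.
rewrite monsx // monsy //; split; apply: mem_nth; rewrite size_mons;
  by move: hi; rewrite /mon_dim; do 2 case: ifP; lia.
Qed.

Lemma xyclosed_mons B B' n g : subsp B' -> xyclosed B B' ->
  xyclosed (adjoins B (mons n g)) (adjoins B' (mons (n + 1) g)).
Proof.
move=> hB' xy v hv; split; move: v hv; apply: adjs_map => //;
  (try exact: klin_scale) => v.
- by move=> /xy[? _]; apply: adjs_incl.
- by move=> /mons_xy[? _]; apply: adjs_mem.
- by move=> /xy[_ ?]; apply: adjs_incl.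
- by move=> /mons_xy[_ ?]; apply: adjs_mem.
Qed.

(** For indicator functions: a nonempty subset of [{0, ..., d-1}] together with its
shift by one has more elements than the subset alone; [f] and [f'] indicate the
complements. *)
Lemma shifted_sum d (f f' : nat -> nat) :
  (forall i, (i < d)%N -> (f' i <= f i)%N /\ (f' i.+1 <= f i)%N) ->
  (exists2 i, (i < d)%N & f i = 0%N) ->
  (\sum_(0 <= i < d.+1) f' i <= \sum_(0 <= i < d) f i)%N.
Proof.
move=> h [j jd fj].
rewrite (@big_cat_nat _ _ _ j.+1) //=; last by lia.
rewrite [X in (_ <= X)%N](@big_cat_nat _ _ _ j.+1) //=.
rewrite [X in (_ + X <= _)%N]big_add1 /=.
rewrite [X in (_ + X <= _)%N]big_ltn //.
have := h j jd; rewrite fj => -[_ fj'].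
apply: leq_add.
  by rewrite big_nat_cond [X in (_ <= X)%N]big_nat_cond; apply: leq_sum => i; have := h i; lia.
rewrite (_ : f' j.+1 = 0%N); last by lia.
by rewrite big_nat_cond [X in (_ <= X)%N]big_nat_cond; apply: leq_sum => i; have := h i; lia.
Qed.

(** Macaulay growth for a single generator: if a monomial is a combination of the
earlier ones, so are its products with [x] and with [y]. The nonstandard monomials
therefore gain at least one element from one degree to the next, as soon as there is
one. *)
Lemma std_count_mons_growth B B' n g : subsp B -> subsp B' -> xyclosed B B' ->
  (std_count B (mons n g) < mon_dim n g.1)%N ->
  (std_count B' (mons (n + 1) g) <= std_count B (mons n g))%N.
Proof.
move=> hB hB' xy; have [nb|] := boolP (n < g.1); first by rewrite mon_dim0.
rewrite -leNgt => nb.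
have sz : size (mons (n + 1) g) = (mon_dim n g.1).+1 by rewrite size_mons mon_dimS //; lia.
have sz0 : size (mons n g) = mon_dim n g.1 by rewrite size_mons.
rewrite !std_countE sz sz0 => lt; apply: shifted_sum => [i id|].
  case: (asboolP (adjoins B _ _)) => /= [hi|]; last by split; apply: leq_b1.
  have hP s : subsp (adjoins B' s) by apply: subsp_adjs.
  have tk j : (j <= mon_dim n g.1)%N -> forall v, v \in take j (mons n g) ->
      y *: v \in take j (mons (n + 1) g) /\ x *: v \in take j.+1 (mons (n + 1) g).
    move=> jd v /(nthP 0)[l]; rewrite size_take_min sz0 => hl <-.
    rewrite nth_take; last by lia.
    rewrite monsx ?monsy; try by lia.
    split; [rewrite -(@nth_take j) //|rewrite -(@nth_take j.+1) //]; try by lia.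
      by apply: mem_nth; rewrite size_take_min sz; lia.
    by apply: mem_nth; rewrite size_take_min sz; lia.
  have := tk i (ltnW id) => tki.
  split.
    rewrite (introT (asboolP _)) // -monsy //.
    move: hi; apply: adjs_map => // [|v /xy[_ ?]|v /tki[? _]]; first exact: klin_scale.
      exact: adjs_incl.
    exact: adjs_mem.
  rewrite (introT (asboolP _)) // -monsx //.
  move: hi; apply: adjs_map => // [|v /xy[? _]|v /tki[_ ?]]; first exact: klin_scale.
    exact: adjs_incl.
  exact: adjs_mem.
apply: contrapT => ne; move: lt; rewrite (eq_big_nat _ _ (F2 := fun=> 1%N)).
  by rewrite sum_nat_const_nat subn0 muln1 ltnn.
move=> i /andP[_ id]; case: asboolP => //= hi; case: ne; exists i => //.
by rewrite (introT (asboolP _)).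
Qed.

Lemma std_count_mons_le B n g : (std_count B (mons n g) <= mon_dim n g.1)%N.
Proof. by rewrite -(size_mons n); apply: std_count_size. Qed.

(** Macaulay's bound on the growth of the Hilbert function of a module with
generators in prescribed degrees. The list [E] collects the degrees of those
generators all of whose multiples in degree [n] are standard. *)
Lemma macaulay gens B B' n : subsp B -> subsp B' -> xyclosed B B' ->
  exists E : seq int,
  [/\ forall b, (count_mem b E <= count_mem b (map fst gens))%N,
      forall b, b \in E -> b <= n + 1,
      (\sum_(b <- E) mon_dim n b <= std_count B (allmons n gens))%N &
      (std_count B' (allmons (n + 1) gens) <= std_count B (allmons n gens) + size E)%N].
Proof.
elim: gens B B' => [|g gens IH] B B' hB hB' xy.
  by exists [::]; split=> //; rewrite big_nil.
have [E [E1 E2 E3 E4]] := IH _ _ (subsp_adjs (mons n g) hB)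
  (subsp_adjs (mons (n + 1) g) hB') (xyclosed_mons hB' xy).
rewrite /allmons /= !std_count_cat -/(allmons n gens) -/(allmons (n + 1) gens).
have le1 := std_count_mons_le B n g; have le2 := std_count_mons_le B' (n + 1) g.
have gr := @std_count_mons_growth B B' n g hB hB' xy.
have [lt|ge] := ltnP (std_count B (mons n g)) (mon_dim n g.1).
  exists E; split=> //; first by move=> b; exact: leq_trans (E1 b) (leq_addl _ _).
    exact: leq_trans E3 (leq_addl _ _).
  by rewrite -addnA; apply: leq_add => //; apply: gr.
have [gn|gn] := leP g.1 (n + 1).
  exists (g.1 :: E); split=> /=; first by move=> b; rewrite leq_add2l.
  - by move=> b; rewrite inE => /orP[/eqP -> //|/E2].
  - by rewrite big_cons leq_add.
  - rewrite addnS -!addSn -addnA leq_add //.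
    by rewrite (leq_trans le2) // mon_dimS.
exists E; split=> //; first by move=> b; exact: leq_trans (E1 b) (leq_addl _ _).
  exact: leq_trans E3 (leq_addl _ _).
by rewrite -addnA leq_add // (leq_trans le2) // mon_dim0.
Qed.

Lemma int_up (P : int -> Prop) n0 : P n0 ->
  (forall n, n0 <= n -> P n -> P (n + 1)) -> forall n, n0 <= n -> P n.
Proof.
move=> h0 h n hn; suff z (j : nat) : P (n0 + j%:Z).
  by have := z (absz (n - n0)); rewrite gez0_abs ?subr_ge0 // (addrC n0) subrK.
elim: j => [|j /h]; first by rewrite addr0.
by rewrite -addrA -PoszD addn1; apply; lia.
Qed.

Lemma int_down (P : int -> Prop) n0 : P n0 ->
  (forall n, n <= n0 -> P n -> P (n - 1)) -> forall n, n <= n0 -> P n.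
Proof.
move=> h0 h n hn; rewrite -(opprK n).
apply: (@int_up (fun n => P (- n)) (- n0)); rewrite ?opprK ?lerN2 // => i hi.
by rewrite opprD; apply: h; rewrite lerNl.
Qed.

Lemma eventually_const (f : int -> nat) (n0 : int) :
  (forall n, n0 <= n -> (f (n + 1)%R <= f n)%N) ->
  exists2 n1, n0 <= n1 & forall n, n1 <= n -> f (n + 1) = f n.
Proof.
have [m] := ubnP (f n0); elim: m n0 => // m IH n0 hm h.
case: (pselect (forall n, n0 <= n -> f (n + 1) = f n)) => [?|]; first by exists n0.
move=> /existsNP[n1 /not_implyP[h1 ne]].
have le : (f n1 <= f n0)%N.
  by apply: (@int_up (fun n => f n <= f n0)%N n0) h1 => // n /h /leq_trans le /le.
have lt : (f (n1 + 1)%R < f n1)%N by rewrite ltn_neqAle h // andbT; apply/eqP.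
have [||n2 h2 H2] := IH (n1 + 1); first by exact: leq_trans lt (leq_trans le hm).
  by move=> n hn; apply: h; lia.
by exists n2 => //; lia.
Qed.

(** A family closed under [x] and [y] eventually attains the maximal growth
allowed by [std_count_mons_growth]: for each generator, either all monomials stay
standard or the number of standard ones is nonincreasing, hence eventually
constant. The quotient then has a linear Hilbert function,
and the family can no longer acquire generators. *)
Lemma eventual_growth gens (B : int -> V -> Prop) :
  (forall n, subsp (B n)) -> (forall n, xyclosed (B n) (B (n + 1))) ->
  exists n1 r, forall n, n1 <= n ->
    std_count (B (n + 1)) (allmons (n + 1) gens) = (std_count (B n) (allmons n gens) + r)%N /\
    forall B', subsp B' -> xyclosed (B n) B' ->
      (std_count B' (allmons (n + 1) gens) <= std_count (B n) (allmons n gens) + r)%N.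
Proof.
elim: gens B => [|g gens IH] B hB xy; first by exists 0, 0%N.
have [|n1 [r h]] := IH (fun n => adjoins (B n) (mons n g)) _ (fun n => xyclosed_mons (hB _) (xy n)).
  by move=> n; apply: subsp_adjs.
suff [n2 [r' h']] : exists n2 r', forall n, n2 <= n ->
    std_count (B (n + 1)) (mons (n + 1) g) = (std_count (B n) (mons n g) + r')%N /\
    forall B', subsp B' -> xyclosed (B n) B' ->
      (std_count B' (mons (n + 1) g) <= std_count (B n) (mons n g) + r')%N.
  exists (Num.max n1 n2), (r + r')%N => n; rewrite ge_max => /andP[/h[e1 l1] /h'[e2 l2]].
  rewrite /allmons /= !std_count_cat e2; split; first by move: e1; rewrite /allmons; lia.
  move=> B' hB' xy'; rewrite std_count_cat.
  have := l2 B' hB' xy'; have := l1 _ (subsp_adjs (mons (n + 1) g) hB') (xyclosed_mons hB' xy').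
  rewrite /allmons; lia.
case: (pselect (exists2 n, g.1 <= n & (std_count (B n) (mons n g) < mon_dim n g.1)%N)).
  move=> [n0 gn0 lt0].
  have lt' n : n0 <= n -> (std_count (B n) (mons n g) < mon_dim n g.1)%N.
    move: n; apply: int_up => // n hn lt.
    have := std_count_mons_growth (hB _) (hB _) (xy n) lt.
    by rewrite mon_dimS => [/leq_ltn_trans|]; [apply; exact: leqW|lia].
  have [|n2 n02 h2] := @eventually_const (fun n => std_count (B n) (mons n g)) n0.
    by move=> n hn; apply: std_count_mons_growth => //; apply: lt'.
  exists n2, 0%N => n hn; rewrite addn0; split; first exact: h2.
  by move=> B' hB' xy'; apply: std_count_mons_growth => //; apply: lt'; lia.
move=> full.
have eq n : g.1 <= n -> std_count (B n) (mons n g) = mon_dim n g.1.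
  move=> hn; have := std_count_mons_le (B n) n g; rewrite leq_eqVlt => /orP[/eqP //|lt].
  by case: full; exists n.
exists g.1, 1%N => n hn; rewrite !eq ?mon_dimS ?addn1; try lia; split=> // B' _ _.
by rewrite -mon_dimS; [apply: std_count_mons_le|lia].
Qed.

End Monomials.
End Growth.

(** * Localizations and the Cech complex *)

Section Cech.
Variable (k : fieldType).
Local Notation R := {mpoly k[2]}.
Local Notation x := (vx k).
Local Notation y := (vy k).

(** Graded pieces of a submodule: only the action of [x] and [y] between them
matters for dimension counts. *)
Record gfam (V : lmodType R) (Z : int -> V -> Prop) : Prop := Gfam {
  gfam_subsp : forall n, subsp (Z n);
  gfam_xy : forall n, xyclosed (Z n) (Z (n + 1)) }.

Section GradedFamily.
Variables (V : lmodType R) (Z : int -> V -> Prop).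
Variable hZ : gfam Z.

Lemma gfam_x n v : Z n v -> Z (n + 1) (x *: v).
Proof. by move=> /(gfam_xy hZ)[]. Qed.
Lemma gfam_y n v : Z n v -> Z (n + 1) (y *: v).
Proof. by move=> /(gfam_xy hZ)[]. Qed.

Lemma gfam_xs i n v : Z n v -> Z (n + i%:Z) (x ^+ i *: v).
Proof.
elim: i => [|i IH] hv; first by rewrite scale1r addr0.
rewrite exprS -scalerA (_ : n + i.+1%:Z = n + i%:Z + 1); last by lia.
exact/gfam_x/IH.
Qed.

Lemma gfam_ys i n v : Z n v -> Z (n + i%:Z) (y ^+ i *: v).
Proof.
elim: i => [|i IH] hv; first by rewrite scale1r addr0.
rewrite exprS -scalerA (_ : n + i.+1%:Z = n + i%:Z + 1); last by lia.
exact/gfam_y/IH.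
Qed.

End GradedFamily.

Definition rlin (V W : lmodType R) (f : V -> W) : Prop :=
  forall (c : R) u v, f (c *: u + v) = c *: f u + f v.

Lemma rlin_klin (V W : lmodType R) (f : V -> W) : rlin f -> klin f.
Proof. by move=> hf c u v; apply: hf. Qed.

Lemma rlinZ (V W : lmodType R) (f : V -> W) (c : R) v : rlin f -> f (c *: v) = c *: f v.
Proof.
by move=> hf; rewrite -[c *: v]addr0 hf (klin0 (rlin_klin hf)) addr0.
Qed.

Lemma scale_comm (V : lmodType R) (p q : R) (v : V) : p *: (q *: v) = q *: (p *: v).
Proof. by rewrite !scalerA mulrC. Qed.

Lemma scale_xy_comm (V : lmodType R) (v : V) : x *: (y *: v) = y *: (x *: v).
Proof. by rewrite !scalerA mulrC. Qed.

(** The features of the Cech complex M -> M_x (+) M_y -> M_xy, with its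
grading, on which the computation of local cohomology rests: the three
localizations are recognized by the invertibility of [x] or [y], by
denominators, and by the kernels of the localization maps. Stating these features
for abstract modules [X], [Y], [W] keeps the arguments below independent of the
construction of fractions. *)
Record cech_data (M X Y W : lmodType R) (G : int -> M -> Prop)
    (GX : int -> X -> Prop) (GY : int -> Y -> Prop) (GW : int -> W -> Prop)
    (a : M -> X) (b : M -> Y) (al : X -> W) (be : Y -> W) : Prop := CechData {
  cd_G : gfam G; cd_GX : gfam GX; cd_GY : gfam GY; cd_GW : gfam GW;
  cd_a : rlin a; cd_b : rlin b; cd_al : rlin al; cd_be : rlin be;
  cd_comm : forall v, al (a v) = be (b v);
  cd_ga : forall n v, G n v -> GX n (a v);
  cd_gb : forall n v, G n v -> GY n (b v);
  cd_gal : forall n p, GX n p -> GW n (al p);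
  cd_gbe : forall n q, GY n q -> GW n (be q);
  cd_xX : forall p : X, x *: p = 0 -> p = 0;
  cd_yY : forall q : Y, y *: q = 0 -> q = 0;
  cd_xW : forall z : W, x *: z = 0 -> z = 0;
  cd_yW : forall z : W, y *: z = 0 -> z = 0;
  cd_divX : forall n p, GX n p -> exists2 p', GX (n - 1) p' & p = x *: p';
  cd_divY : forall n q, GY n q -> exists2 q', GY (n - 1) q' & q = y *: q';
  cd_divxW : forall n z, GW n z -> exists2 z', GW (n - 1) z' & z = x *: z';
  cd_divyW : forall n z, GW n z -> exists2 z', GW (n - 1) z' & z = y *: z';
  cd_denX : forall n p, GX n p -> exists t v, G (n + t%:Z) v /\ x ^+ t *: p = a v;
  cd_denY : forall n q, GY n q -> exists t v, G (n + t%:Z) v /\ y ^+ t *: q = b v;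
  cd_denW : forall n z, GW n z ->
    exists t v, G (n + t%:Z + t%:Z) v /\ x ^+ t *: (y ^+ t *: z) = al (a v);
  cd_kera : forall v, a v = 0 -> exists t, x ^+ t *: v = 0;
  cd_kerb : forall v, b v = 0 -> exists t, y ^+ t *: v = 0;
  cd_keral : forall p, al p = 0 -> exists t, y ^+ t *: p = 0;
  cd_kerbe : forall q, be q = 0 -> exists t, x ^+ t *: q = 0 }.

Section Localization.
Variables (M : lmodType R).

Section Fractions.
Variable f : R.
Implicit Types (u v : M) (q : locmod M f).

Lemma lfracZ (a : R) v n : a *: (lfrac v n : locmod M f) = lfrac (a *: v) n.
Proof. exact: loc_scaleE. Qed.

Lemma lfracD u m v n : (lfrac u m : locmod M f) + lfrac v n =
  lfrac (f ^+ n *: u + f ^+ m *: v) (m + n).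
Proof. exact: loc_addE. Qed.

Lemma lfracZD (a : R) u m v n : a *: (lfrac u m : locmod M f) + lfrac v n =
  lfrac (f ^+ n *: (a *: u) + f ^+ m *: v) (m + n).
Proof. by rewrite lfracZ lfracD. Qed.

Lemma lfracK v n m : lfrac (f ^+ m *: v) (m + n) = lfrac v n :> locmod M f.
Proof. by apply/fracP; exists 0%N; rewrite !add0n scalerA -exprD addnC. Qed.

Lemma lfrac_lin n (a : R) u v :
  lfrac (a *: u + v) n = a *: lfrac u n + lfrac v n :> locmod M f.
Proof. by rewrite lfracZ lfracD -scalerDr lfracK. Qed.

Lemma lfracB u v n : lfrac (u - v) n = lfrac u n - lfrac v n :> locmod M f.
Proof. by rewrite -[u - v]addrC -scaleN1r lfrac_lin scaleN1r addrC. Qed.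

Lemma lfrac0 n : lfrac 0 n = 0 :> locmod M f.
Proof. by rewrite -[in LHS](subrr 0) lfracB subrr. Qed.

Lemma lfrac_eq0 v n : lfrac v n = 0 :> locmod M f <-> exists t, f ^+ t *: v = 0.
Proof.
rewrite -(lfrac0 0); split=> [/fracP[t]|[t h]]; last first.
  by apply/fracP; exists t; rewrite scaler0 addn0.
by rewrite scaler0 addn0; exists t.
Qed.

Lemma scale_frac h h' v n : h * h' = f -> h *: lfrac (h' *: v) n.+1 = lfrac v n :> locmod M f.
Proof. by move=> hh; rewrite lfracZ scalerA hh -[in RHS](lfracK _ n 1). Qed.

Lemma loc_inj h h' q : h * h' = f -> h *: q = 0 -> q = 0.
Proof.
move=> hh hq; have [v [n e]] := locmodW q; rewrite e in hq *.
have := congr1 (fun q => h' *: q) hq; rewrite /= scalerA (mulrC h') hh scaler0 lfracZ.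
move=> /lfrac_eq0[t ht]; apply/lfrac_eq0; exists t.+1.
by rewrite exprSr -scalerA.
Qed.

End Fractions.

Lemma loc_map_lin (f g h : R) : h = g * f -> forall (a : R) (p q : locmod M f),
  loc_map g h (a *: p + q) = a *: loc_map g h p + loc_map g h q :> locmod M h.
Proof.
move=> e a p q; have [u [m ->]] := locmodW p; have [v [n ->]] := locmodW q.
apply: etrans (congr1 (loc_map g h) (@lfracZD f a u m v n)) _.
rewrite (loc_mapE u m e) (loc_mapE v n e) (loc_mapE _ _ e).
rewrite (@lfracZD h a); congr lfrac.
rewrite scalerDr !scalerA e !exprMn !exprD.
by congr (_ *: _ + _ *: _); ring.
Qed.

Variable G : int -> M -> Prop.
Variable hG : gfam G.

Lemma G_sub n : subsp (G n). Proof. exact: gfam_subsp. Qed.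
Hint Resolve G_sub : core.

Lemma G_pow (f : R) (d : nat) : (forall n v, G n v -> G (n + d%:Z) (f *: v)) ->
  forall s n v, G n v -> G (n + (s * d)%:Z) (f ^+ s *: v).
Proof.
move=> hf; elim=> [|s IH] n v hv; first by rewrite scale1r mul0n addr0.
by rewrite exprS -scalerA mulSn addnC PoszD addrA; apply/hf/IH.
Qed.

Section LocGrading.
Variables (f h h' : R) (d : nat).
Variable hh : h * h' = f.
Variable Gf : forall n v, G n v -> G (n + d.+1%:Z) (f *: v).
Variable Gh' : forall n v, G n v -> G (n + d%:Z) (h' *: v).

Local Notation LG := (loc_grading G (f := f) d.+1).

Lemma subsp_loc n : subsp (LG n).
Proof.
split; first by exists 0, 0%N; rewrite lfrac0; split=> //; apply: subsp0.
move=> c _ _ [u [s [hu ->]]] [v [t [hv ->]]].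
rewrite lfracZ lfracD; do 2 eexists; split; last by reflexivity.
rewrite scalerA mulrC -scalerA; apply: subsp_lin => //.
  rewrite (_ : n + ((s + t) * d.+1)%:Z = n + (s * d.+1)%:Z + (t * d.+1)%:Z); last by lia.
  exact: (G_pow Gf).
rewrite (_ : n + ((s + t) * d.+1)%:Z = n + (t * d.+1)%:Z + (s * d.+1)%:Z); last by lia.
exact: (G_pow Gf).
Qed.

Lemma loc_xy n : xyclosed (LG n) (LG (n + 1)).
Proof.
move=> _ [u [s [hu ->]]]; rewrite !lfracZ; split; do 2 eexists; split;
  try reflexivity; rewrite addrAC; [exact: (gfam_x hG)|exact: (gfam_y hG)].
Qed.

Lemma loc_div n q : LG n q -> exists2 q', LG (n - 1) q' & q = h *: q'.
Proof.
move=> [u [s [hu ->]]]; exists (lfrac (h' *: u) s.+1); last by rewrite scale_frac.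
do 2 eexists; split; last by reflexivity.
rewrite (_ : n - 1 + _ = n + (s * d.+1)%:Z + d%:Z); last by lia.
exact: Gh'.
Qed.

End LocGrading.

Lemma Gxy n v : G n v -> G (n + 2%:Z) ((x * y) *: v).
Proof.
move=> hv; rewrite -scalerA (_ : n + 2%:Z = n + 1 + 1); last by lia.
by apply: (gfam_x hG); apply: (gfam_y hG).
Qed.

Lemma G0 (n : int) v : G n v -> G (n + 0%:Z) ((1 : R) *: v).
Proof. by rewrite scale1r addr0. Qed.

Lemma loc_gfam (f : R) (d : nat) : (forall n v, G n v -> G (n + d.+1%:Z) (f *: v)) ->
  gfam (loc_grading G (f := f) d.+1).
Proof. by move=> Gf; split=> n; [exact: subsp_loc|exact: loc_xy]. Qed.

Lemma loc_map_ker (f g h : R) (q : locmod M f) : h = g * f ->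
  loc_map g h q = 0 :> locmod M h -> exists t, g ^+ t *: q = 0.
Proof.
move=> e; have [v [n ->]] := locmodW q; rewrite loc_mapE // => /lfrac_eq0[t ht].
exists (t + n)%N; rewrite lfracZ; apply/lfrac_eq0; exists t.
by rewrite scalerA exprD mulrA (mulrC (f ^+ t)) -exprMn -e -scalerA.
Qed.

Lemma loc_den (f : R) (v : M) n : f ^+ n *: (lfrac v n : locmod M f) = lfrac v 0.
Proof. by rewrite lfracZ -[X in lfrac _ X](addn0 n) lfracK. Qed.

Lemma cech_data_loc : cech_data G
  (loc_grading G (f := x) 1) (loc_grading G (f := y) 1) (loc_grading G (f := x * y) 2)
  (fun v => lfrac v 0) (fun v => lfrac v 0)
  (loc_map y (x * y)) (loc_map x (x * y)).
Proof.
have yx : x * y = y * x :> R by rewrite mulrC.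
have x1 : x * 1 = x :> R by rewrite mulr1.
have y1 : y * 1 = y :> R by rewrite mulr1.
split.
- exact: hG.
- by apply: loc_gfam => n v; apply: (gfam_x hG).
- by apply: loc_gfam => n v; apply: (gfam_y hG).
- by apply: loc_gfam => n v; apply: Gxy.
- by move=> c u v; exact: lfrac_lin.
- by move=> c u v; exact: lfrac_lin.
- exact: loc_map_lin.
- exact: loc_map_lin.
- by move=> v; rewrite !loc_mapE // !expr0 !scale1r.
- by move=> n v hv; exists v, 0%N; rewrite mul0n addr0.
- by move=> n v hv; exists v, 0%N; rewrite mul0n addr0.
- move=> n _ [u [s [hu ->]]]; rewrite loc_mapE //; exists (y ^+ s *: u), s; split=> //.
  by rewrite (_ : n + (s * 2)%:Z = n + (s * 1)%:Z + s%:Z); [exact: (gfam_ys hG)|lia].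
- move=> n _ [u [s [hu ->]]]; rewrite loc_mapE //; exists (x ^+ s *: u), s; split=> //.
  by rewrite (_ : n + (s * 2)%:Z = n + (s * 1)%:Z + s%:Z); [exact: (gfam_xs hG)|lia].
- move=> p; exact: (loc_inj x1).
- move=> p; exact: (loc_inj y1).
- move=> p; exact: (@loc_inj (x * y) x y p erefl).
- move=> p; exact: (@loc_inj (x * y) y x p (esym yx)).
- move=> n p; exact: (loc_div x1 G0).
- move=> n p; exact: (loc_div y1 G0).
- move=> n p; exact: (@loc_div (x * y) x y 1 erefl (gfam_y hG)).
- move=> n p; exact: (@loc_div (x * y) y x 1 (esym yx) (gfam_x hG)).
- move=> n _ [u [s [hu ->]]]; exists s, u; split; first by rewrite muln1 in hu.
  exact: loc_den.
- move=> n _ [u [s [hu ->]]]; exists s, u; split; first by rewrite muln1 in hu.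
  exact: loc_den.
- move=> n _ [u [s [hu ->]]]; exists s, u; split.
    by rewrite (_ : n + s%:Z + s%:Z = n + (s * 2)%:Z) //; lia.
  by rewrite scalerA -exprMn loc_den loc_mapE // expr0 scale1r.
- by move=> v /lfrac_eq0.
- by move=> v /lfrac_eq0.
- by move=> p; apply: loc_map_ker.
- by move=> p; apply: loc_map_ker.
Qed.

End Localization.
End Cech.

(** * Finite generation *)

Section Families.
Variable k : fieldType.
Local Notation R := {mpoly k[2]}.
Local Notation x := (vx k).
Local Notation y := (vy k).

Section One.
Variables (V : lmodType R) (Z : int -> V -> Prop).
Variable hZ : gfam Z.

Definition generated (gens : seq (int * V)) : Prop :=
  (forall g, g \in gens -> Z g.1 g.2) /\
  forall n v, Z n v -> adjoins (@null _ V) (allmons n gens) v.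

Lemma mons_in n g v : Z g.1 g.2 -> v \in mons n g -> Z n v.
Proof.
move=> hg /(nthP 0)[i]; rewrite size_mons => hi <-; rewrite nth_mkseq //.
rewrite /mon -scalerA.
have hi' : g.1 + ((mon_dim n g.1).-1 - i)%N%:Z + i%:Z = n.
  by move: hi; rewrite /mon_dim; case: ifP; lia.
by have := gfam_xs hZ i (gfam_ys hZ ((mon_dim n g.1).-1 - i) hg); rewrite hi'.
Qed.

Lemma allmons_in n gens v : (forall g, g \in gens -> Z g.1 g.2) ->
  v \in allmons n gens -> Z n v.
Proof.
by move=> h /flattenP[s /mapP[g /h hg ->]]; apply: mons_in.
Qed.

Lemma adjs_allmons B n gens : (forall g, g \in gens -> Z g.1 g.2) ->
  (forall v, B v -> Z n v) -> forall v, adjoins B (allmons n gens) v -> Z n v.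
Proof.
move=> h hB; apply: adjs_min => //; first exact: gfam_subsp hZ n.
by move=> v; apply: allmons_in.
Qed.

Lemma adjs_mono (B B' : V -> Prop) s v : subsp B' -> (forall v, B v -> B' v) ->
  adjoins B s v -> adjoins B' s v.
Proof.
move=> hB' BB'; apply: adjs_min; first exact: subsp_adjs.
  by move=> u /BB'; apply: adjs_incl.
by move=> u; apply: adjs_mem.
Qed.

Lemma generated_adjs gens n B : generated gens -> subsp B -> (forall v, B v -> Z n v) ->
  forall v, adjoins B (allmons n gens) v <-> Z n v.
Proof.
move=> [g1 g2] hB BZ v; split; first exact: adjs_allmons.
by move=> /g2; apply: adjs_mono => // u ->; apply: subsp0.
Qed.

Lemma generated_dim gens n B : generated gens -> subsp B -> (forall v, B v -> Z n v) ->
  has_dim (Z n) B (std_count B (allmons n gens)).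
Proof.
move=> hg hB BZ; apply: eq_has_dim (has_dim_adjs (allmons n gens) hB) => //.
exact: generated_adjs.
Qed.

End One.

Definition xysum (V : lmodType R) (B : V -> Prop) (v : V) : Prop :=
  exists u w, [/\ B u, B w & v = y *: u - x *: w].

Lemma xysumP (V : lmodType R) (B : V -> Prop) v : subsp B ->
  xysum B v <-> exists u w, [/\ B u, B w & v = x *: u + y *: w].
Proof.
move=> hB; split=> [[u [w [hu hw ->]]]|[u [w [hu hw ->]]]].
  by exists (- w), u; split=> //; [exact: subspN|rewrite scalerN addrC].
by exists w, (- u); split=> //; [exact: subspN|rewrite scalerN opprK addrC].
Qed.

Lemma subsp_xysum (V : lmodType R) (B : V -> Prop) : subsp B -> subsp (xysum B).
Proof.
move=> hB; split.
  by exists 0, 0; split; try (exact: subsp0); rewrite !scaler0 subr0.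
move=> c _ _ [u [w [hu hw ->]]] [u' [w' [hu' hw' ->]]].
exists (c%:MP *: u + u'), (c%:MP *: w + w'); split; try exact: subsp_lin.
rewrite !scalerDr scalerN opprD addrACA !scalerA.
by rewrite !(mulrC c%:MP).
Qed.

Lemma xyclosed_xysum (V : lmodType R) (B : V -> Prop) : subsp B -> xyclosed B (xysum B).
Proof.
move=> hB v hv; split; apply/xysumP => //.
  by exists v, 0; split=> //; [exact: subsp0|rewrite scaler0 addr0].
by exists 0, v; split=> //; [exact: subsp0|rewrite scaler0 add0r].
Qed.

Lemma null_gfam (V : lmodType R) : gfam (fun _ : int => @null _ V).
Proof.
split=> n; first exact: subsp_null.
by move=> v ->; rewrite /null !scaler0.
Qed.

Lemma xysum_in (V : lmodType R) (Z : int -> V -> Prop) n v :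
  gfam Z -> xysum (Z n) v -> Z (n + 1) v.
Proof.
move=> hZ [u [w [hu hw ->]]]; apply: subspB; first exact: gfam_subsp hZ _.
  exact: gfam_y.
exact: gfam_x.
Qed.

(** Graded submodules of a finitely generated module are finitely generated: by
[eventual_growth], the products of [B n] with [x] and [y] already have codimension
at most that of [B (n + 1)]. *)
Lemma noetherian (V : lmodType R) (Z B : int -> V -> Prop) gens :
  gfam Z -> gfam B -> generated Z gens -> (forall n v, B n v -> Z n v) ->
  exists n1, forall n, n1 <= n -> forall v, B (n + 1) v -> xysum (B n) v.
Proof.
move=> hZ hB hg BZ.
have [n1 [r h]] := eventual_growth gens (gfam_subsp hB) (gfam_xy hB).
exists n1 => n hn.
have sB := gfam_subsp hB.
have sX := subsp_xysum (sB n).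
have XB v : xysum (B n) v -> B (n + 1) v by exact: xysum_in.
have [e le] := h n hn.
have d1 := generated_dim hZ hg (sB (n + 1)) (BZ (n + 1)).
have d2 := generated_dim hZ hg sX (fun v hv => BZ (n + 1) v (XB v hv)).
have [m [m' [hm hm' em]]] :=
  has_dim_sub sX (sB (n + 1)) (gfam_subsp hZ (n + 1)) XB (BZ (n + 1)) d2.
have := has_dim_uniq (sB (n + 1)) d1 hm'.
have := le _ sX (xyclosed_xysum (sB n)).
move: hm; case: m em => [|m] em hm; first by move=> *; apply: (has_dim_eq0 hm).
by rewrite -e em => + h1; rewrite h1 addSn ltnNge leq_addl.
Qed.

Lemma has_dim_mono (V : lmodType R) (Y Z : V -> Prop) m n : subsp Y -> subsp Z ->
  (forall v, Y v -> Z v) -> has_dim Y (@null _ V) m -> has_dim Z (@null _ V) n ->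
  (m <= n)%N.
Proof.
move=> hY hZ YZ hm hn.
have [|m' [n' [hm' _ ->]]] := has_dim_sub (subsp_null V) hY hZ _ YZ hn.
  by move=> v ->; apply: subsp0.
by rewrite (has_dim_uniq (subsp_null V) hm hm') leq_addr.
Qed.

Lemma has_dim_full (V : lmodType R) (Y Z : V -> Prop) n : subsp Y -> subsp Z ->
  (forall v, Y v -> Z v) -> has_dim Y (@null _ V) n -> has_dim Z (@null _ V) n ->
  forall v, Z v -> Y v.
Proof.
move=> hY hZ YZ hm hn.
have [|m' [n' [hm' h e]]] := has_dim_sub (subsp_null V) hY hZ _ YZ hn.
  by move=> v ->; apply: subsp0.
have em := has_dim_uniq (subsp_null V) hm hm'.
have n0 : n' = 0%N by lia.
by move: h; rewrite n0 => /has_dim_eq0.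
Qed.

(** The two maps of the Koszul complex of [x] and [y]. *)
Definition kos1 (V : lmodType R) (v : V) : (V * V)%type := (x *: v, y *: v).
Definition kos2 (V : lmodType R) (p : V * V) : V := y *: p.1 - x *: p.2.

Lemma klin_kos1 (V : lmodType R) : klin (@kos1 V : V -> (V * V)%type).
Proof.
move=> c u v; rewrite /kos1 !scalerDr !scalerA !(mulrC _ c%:MP) -!scalerA.
by [].
Qed.

Lemma klin_kos2 (V : lmodType R) : klin (@kos2 V : (V * V)%type -> V).
Proof.
move=> c [u1 u2] [v1 v2]; rewrite /kos2 /=.
by rewrite !scalerDr opprD addrACA scalerN !scalerA !(mulrC _ c%:MP).
Qed.

Lemma kos21 (V : lmodType R) (v : V) : kos2 (kos1 v) = 0.
Proof. by rewrite /kos2 /= scale_xy_comm subrr. Qed.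

Definition square (V : lmodType R) (Z : V -> Prop) : (V * V)%type -> Prop :=
  fun p => Z p.1 /\ Z p.2.

Lemma subsp_square (V : lmodType R) (Z : V -> Prop) : subsp Z -> subsp (square Z).
Proof.
move=> hZ; split; first by split; apply: subsp0.
by move=> c [u1 u2] [v1 v2] [? ?] [? ?]; split; apply: subsp_lin.
Qed.

Lemma has_dim_square (V : lmodType R) (Z B : V -> Prop) d : subsp B -> subsp Z ->
  (forall v, B v -> Z v) -> has_dim Z B d -> has_dim (square Z) (square B) (d + d).
Proof. by move=> hB hZ BZ hd; apply: has_dim_prod. Qed.

Lemma square_null (V : lmodType R) (p : (V * V)%type) : square (@null _ V) p <-> null p.
Proof. by case: p => u v; split=> [[/= -> ->]|[-> ->]]. Qed.

End Families.

(** * Exactness of the Koszul complex on sections and on H^2 *)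

Section CechTheory.
Variable k : fieldType.
Local Notation R := {mpoly k[2]}.
Local Notation x := (vx k).
Local Notation y := (vy k).
Variables (M X Y W : lmodType R) (G : int -> M -> Prop).
Variables (GX : int -> X -> Prop) (GY : int -> Y -> Prop) (GW : int -> W -> Prop).
Variables (a : M -> X) (b : M -> Y) (al : X -> W) (be : Y -> W).
Variable cd : cech_data G GX GY GW a b al be.

Local Notation XY := (X * Y)%type.

Definition diff0 (v : M) : XY := (a v, b v).
Definition diff1 (w : XY) : W := be w.2 - al w.1.
Definition chain1 n (w : XY) : Prop := GX n w.1 /\ GY n w.2.
Definition secs n (w : XY) : Prop := chain1 n w /\ diff1 w = 0.
Definition msecs n (w : XY) : Prop := exists2 v, G n v & w = diff0 v.
Definition ims n (z : W) : Prop := exists2 w, chain1 n w & z = diff1 w.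
Definition tors n (v : M) : Prop := G n v /\ diff0 v = 0.

Lemma rlin_d0 : rlin (diff0 : M -> XY).
Proof. by move=> c u v; rewrite /diff0 (cd_a cd) (cd_b cd). Qed.

Lemma rlin_d1 : rlin (diff1 : XY -> W).
Proof.
move=> c [u1 u2] [v1 v2]; rewrite /diff1 /= (cd_al cd) (cd_be cd).
by rewrite scalerBr opprD addrACA.
Qed.

Let klin_d0 : klin (diff0 : M -> XY) := rlin_klin rlin_d0.
Let klin_d1 : klin (diff1 : XY -> W) := rlin_klin rlin_d1.

Lemma d1d0 v : diff1 (diff0 v) = 0.
Proof. by rewrite /diff1 /= (cd_comm cd) subrr. Qed.

Lemma gfam_chain1 : gfam (chain1 : int -> XY -> Prop).
Proof.
split=> n; first split.
- split; [exact: subsp0 (gfam_subsp (cd_GX cd) n)|exact: subsp0 (gfam_subsp (cd_GY cd) n)].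
- move=> c [u1 u2] [v1 v2] [? ?] [? ?]; split.
    exact: (subsp_lin (gfam_subsp (cd_GX cd) n)).
  exact: (subsp_lin (gfam_subsp (cd_GY cd) n)).
- move=> [u v] [hu hv]; split; split.
  + exact: gfam_x (cd_GX cd) _ _ hu.
  + exact: gfam_x (cd_GY cd) _ _ hv.
  + exact: gfam_y (cd_GX cd) _ _ hu.
  + exact: gfam_y (cd_GY cd) _ _ hv.
Qed.

Lemma gfam_secs : gfam (secs : int -> XY -> Prop).
Proof.
split=> n; first exact: subsp_preim klin_d1 (gfam_subsp gfam_chain1 n) (@subsp_null _ _).
move=> w [/(gfam_xy gfam_chain1)[h1 h2] e].
by split; split=> //; rewrite rlinZ ?e ?scaler0 //; exact: rlin_d1.
Qed.

Lemma gfam_msecs : gfam (msecs : int -> XY -> Prop).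
Proof.
split=> n; first exact: subsp_im klin_d0 (gfam_subsp (cd_G cd) n).
move=> _ [v /(gfam_xy (cd_G cd))[h1 h2] ->].
by rewrite -!(rlinZ _ _ rlin_d0); split; eexists; try reflexivity.
Qed.

Lemma gfam_ims : gfam ims.
Proof.
split=> n; first exact: subsp_im klin_d1 (gfam_subsp gfam_chain1 n).
move=> _ [v /(gfam_xy gfam_chain1)[h1 h2] ->].
by rewrite -!(rlinZ _ _ rlin_d1); split; eexists; try reflexivity.
Qed.

Lemma gfam_tors : gfam tors.
Proof.
split=> n; first exact: subsp_preim klin_d0 (gfam_subsp (cd_G cd) n) (@subsp_null _ _).
move=> w [/(gfam_xy (cd_G cd))[h1 h2] e].
by split; split=> //; rewrite rlinZ ?e ?scaler0 //; exact: rlin_d0.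
Qed.

Let sG n := gfam_subsp (cd_G cd) n.
Let sC n := gfam_subsp gfam_chain1 n.
Let sS n := gfam_subsp gfam_secs n.
Let sM n := gfam_subsp gfam_msecs n.
Let sI n := gfam_subsp gfam_ims n.
Let sW n := gfam_subsp (cd_GW cd) n.
Let sT n := gfam_subsp gfam_tors n.
Let sN V := @subsp_null k V.

Lemma msecs_secs n w : msecs n w -> secs n w.
Proof.
move=> [v hv ->]; split; last exact: d1d0.
by split; [exact: cd_ga cd _ _ hv|exact: cd_gb cd _ _ hv].
Qed.

Lemma d1_graded n w : chain1 n w -> GW n (diff1 w).
Proof.
move=> [h1 h2]; apply: subspB; [exact: sW|exact: cd_gbe cd _ _ h2|exact: cd_gal cd _ _ h1].
Qed.

Lemma ims_GW n z : ims n z -> GW n z.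
Proof. by move=> [w h ->]; apply: d1_graded. Qed.

Lemma tors_G n v : tors n v -> G n v. Proof. by case. Qed.

Lemma XY_inj (w : XY) : x *: w = 0 -> y *: w = 0 -> w = 0.
Proof.
by case: w => u v [/(cd_xX cd) -> _] [_ /(cd_yY cd) ->].
Qed.

Lemma eq_of_inj (V : lmodType R) (c : R) (u v : V) :
  (forall w : V, c *: w = 0 -> w = 0) -> c *: u = c *: v -> u = v.
Proof.
move=> inj e; apply/eqP; rewrite -subr_eq0; apply/eqP/inj.
by rewrite scalerBr e subrr.
Qed.

(** The Koszul complex is exact on each localization, since [x] or [y] is invertible
there; the two components are divided by [x] and [y] respectively. *)
Lemma chain1_koszul n u v : chain1 (n + 1) u -> chain1 (n + 1) v ->
  y *: u = x *: v -> exists2 w, chain1 n w & u = x *: w /\ v = y *: w.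
Proof.
case: u v => [u1 u2] [v1 v2] [/= gu1 gu2] [/= gv1 gv2] [e1 e2].
have [w1 gw1 ew1] := cd_divX cd gu1; have [w2 gw2 ew2] := cd_divY cd gv2.
rewrite addrK in gw1 gw2.
have f1 : v1 = y *: w1.
  by apply: (eq_of_inj (cd_xX cd)); rewrite -e1 ew1 scale_xy_comm.
have f2 : u2 = x *: w2.
  by apply: (eq_of_inj (cd_yY cd)); rewrite e2 ew2 scale_xy_comm.
by exists (w1, w2) => //; rewrite ew1 ew2 f1 f2.
Qed.

Lemma secs_koszul n u v : secs (n + 1) u -> secs (n + 1) v ->
  y *: u = x *: v -> exists2 w, secs n w & u = x *: w /\ v = y *: w.
Proof.
move=> [gu du] [gv _] /(chain1_koszul gu gv)[w gw [eu ev]].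
exists w => //; split=> //.
by apply: (cd_xW cd); rewrite -(rlinZ _ _ rlin_d1) -eu.
Qed.

Lemma koszul_h2 n (p q : W) : GW (n + 1) p -> GW (n + 1) q ->
  ims (n + 2) (y *: p - x *: q) ->
  exists2 z, GW n z & ims (n + 1) (p - x *: z) /\ ims (n + 1) (q - y *: z).
Proof.
move=> gp gq [[u1 u2] [/= /(cd_divX cd)[w1 gw1 ->] /(cd_divY cd)[w2 gw2 ->]] e].
rewrite (_ : n + 2 - 1 = n + 1) in gw1 gw2; last by lia.
have sX := gfam_subsp (cd_GX cd) (n + 1); have sY := gfam_subsp (cd_GY cd) (n + 1).
pose s : XY := (0, w2); pose t : XY := (- w1, 0).
have gs : chain1 (n + 1) s by split; [exact: subsp0 sX|].
have gt : chain1 (n + 1) t by split; [exact: subspN|exact: subsp0 sY].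
have est : diff1 (x *: w1, y *: w2) = y *: diff1 s - x *: diff1 t.
  rewrite -!(rlinZ _ _ rlin_d1) -(klinB klin_d1); congr diff1.
  rewrite /s /t; congr (_, _) => /=; first by rewrite scaler0 scalerN opprK add0r.
  by rewrite scaler0 subr0.
have gp' := subspB (sW _) gp (d1_graded gs).
have [z gz ez] := cd_divxW cd gp'; rewrite addrK in gz.
exists z => //; split; first by rewrite -ez subKr; exists s.
exists t => //; apply: (eq_of_inj (cd_xW cd)).
rewrite scalerBr scale_xy_comm -ez scalerBr opprB.
have -> : x *: q = y *: p - diff1 (x *: w1, y *: w2) by rewrite -e subKr.
by rewrite est opprB -addrA subrKA addrC subrK.
Qed.

(** The connecting isomorphism from the generators of the section module to
the socle of H^2. The class [z] corresponds to [y u - x v], where [x z] and [y z]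
are the coboundaries of [u] and [v]. *)
Lemma socle_dim n d : has_dim (secs (n + 2)) (xysum (secs (n + 1))) d ->
  has_dim (fun z => GW n z /\ square (ims (n + 1)) (kos1 z)) (ims n) d.
Proof.
have n2 : n + 2 = n + 1 + 1 by lia.
have sX := gfam_subsp (cd_GX cd) (n + 1); have sY := gfam_subsp (cd_GY cd) (n + 1).
have a0 := klin0 (rlin_klin (cd_al cd)); have b0 := klin0 (rlin_klin (cd_be cd)).
apply: (has_dim_rel (Rel := fun (w : XY) z => exists u v,
  [/\ chain1 (n + 1) u, chain1 (n + 1) v, x *: z = diff1 u, y *: z = diff1 v & w = kos2 ((u, v) : XY * XY)])).
- exists 0, 0; rewrite !scaler0 (klin0 klin_d1) (klin0 (@klin_kos2 _ XY)).
  by split=> //; apply: subsp0.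
- move=> c w w' z z' [u [v [gu gv eu ev ew]]] [u' [v' [gu' gv' eu' ev' ew']]].
  exists (c%:MP *: u + u'), (c%:MP *: v + v').
  split; try exact: subsp_lin; last by rewrite ew ew' -klin_kos2.
    by rewrite klin_d1 -eu -eu'; exact: klin_scale.
  by rewrite klin_d1 -ev -ev'; exact: klin_scale.
- exact: sS.
- exact: (subsp_preim (@klin_kos1 k W) (sW n) (subsp_square (sI (n + 1)))).
- move=> [w1 w2] [[/= g1 g2] e].
  have [u gu eu] := cd_divY cd g2; have [v gv ev] := cd_divX cd g1.
  rewrite (_ : n + 2 - 1 = n + 1) in gu gv; last by lia.
  have [z gz ez] := cd_divxW cd (cd_gbe cd gu); rewrite addrK in gz.
  have ee : x *: (y *: z) = be w2.
    by rewrite scale_xy_comm -ez -(rlinZ _ _ (cd_be cd)) -eu.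
  have gu' : chain1 (n + 1) (0, u) by split=> //; apply: subsp0.
  have gv' : chain1 (n + 1) (- v, 0) by split; [apply: subspN|apply: subsp0].
  have du : x *: z = diff1 (0, u) by rewrite -ez /diff1 /= a0 subr0.
  have dv : y *: z = diff1 (- v, 0).
    rewrite /diff1 /= b0 sub0r -[in RHS](sub0r v) (klinB (rlin_klin (cd_al cd))) a0 sub0r opprK.
    apply: (eq_of_inj (cd_xW cd)); rewrite -(rlinZ _ _ (cd_al cd)) -ev ee.
    by move/eqP: e; rewrite /diff1 /= subr_eq0 => /eqP.
  exists z; first by split=> //; split; [exists (0, u)|exists (- v, 0)].
  exists (0, u), (- v, 0); split=> //; rewrite /kos2; congr (_, _) => /=.
    by rewrite scaler0 scalerN opprK add0r -ev.
  by rewrite scaler0 subr0 -eu.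
- move=> z [gz [[u gu eu] [v gv ev]]]; rewrite /= in eu ev.
  exists (y *: u - x *: v); last by exists u, v.
  split; last by rewrite (klinB klin_d1) !(rlinZ _ _ rlin_d1) -eu -ev scale_xy_comm subrr.
  by rewrite n2; apply: (subspB (sC _)); [exact: (gfam_y gfam_chain1 gu)|exact: (gfam_x gfam_chain1 gv)].
- move=> w z _ _ [u [v [gu gv eu ev ->]]]; split.
    move=> [u' [v' [[gu' du'] [gv' dv'] e]]].
    have [|t gt [et1 et2]] := chain1_koszul (subspB (sC _) gu gu') (subspB (sC _) gv gv').
      rewrite !scalerBr; move/eqP: e; rewrite /kos2 /= subr_eq addrAC => /eqP ->.
      by rewrite -addrA addrC addrK.
    exists t => //; apply: (eq_of_inj (cd_xW cd)).
    by rewrite -(rlinZ _ _ rlin_d1) -et1 (klinB klin_d1) du' subr0.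
  move=> [t gt ez]; exists (u - x *: t), (v - y *: t); split.
  + split; first by apply: subspB => //; apply: (gfam_x gfam_chain1).
    by rewrite (klinB klin_d1) (rlinZ _ _ rlin_d1) -ez eu subrr.
  + split; first by apply: subspB => //; apply: (gfam_y gfam_chain1).
    by rewrite (klinB klin_d1) (rlinZ _ _ rlin_d1) -ez ev subrr.
  + by rewrite /kos2 /= !scalerBr scale_xy_comm opprB addrA addrNK.
Qed.

End CechTheory.

(** * Finiteness of local cohomology *)

Section Finiteness.
Variable k : fieldType.
Local Notation R := {mpoly k[2]}.
Local Notation x := (vx k).
Local Notation y := (vy k).
Variables (M X Y W : lmodType R) (G : int -> M -> Prop).
Variables (GX : int -> X -> Prop) (GY : int -> Y -> Prop) (GW : int -> W -> Prop).
Variables (a : M -> X) (b : M -> Y) (al : X -> W) (be : Y -> W).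
Variable cd : cech_data G GX GY GW a b al be.
Variable gens : seq (int * M).
Variable hgens : generated G gens.

Local Notation XY := (X * Y)%type.
Local Notation d0 := (diff0 a b).
Local Notation d1 := (diff1 al be).
Local Notation chain1 := (chain1 GX GY).
Local Notation secs := (secs GX GY al be).
Local Notation msecs := (msecs G a b).
Local Notation ims := (ims GX GY al be).
Local Notation tors := (tors G a b).

Let klin_d0 : klin (d0 : M -> XY) := rlin_klin (rlin_d0 cd).
Let klin_d1 : klin (d1 : XY -> W) := rlin_klin (rlin_d1 cd).
Let sG n := gfam_subsp (cd_G cd) n.
Let sC n := gfam_subsp (gfam_chain1 cd) n.
Let sS n := gfam_subsp (gfam_secs cd) n.
Let sM n := gfam_subsp (gfam_msecs cd) n.
Let sI n := gfam_subsp (gfam_ims cd) n.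
Let sW n := gfam_subsp (cd_GW cd) n.
Let sT n := gfam_subsp (gfam_tors cd) n.
Let sN V := @subsp_null k V.

Lemma secs_x n w : secs n w -> exists t : nat, msecs (n + t%:Z) (x ^+ t *: w).
Proof.
case: w => p q [[/= gp gq] e].
have [t [v [gv ev]]] := cd_denX cd gp.
have [|s hs] := cd_kerbe cd (q := b v - x ^+ t *: q).
  rewrite (klinB (rlin_klin (cd_be cd))) -(cd_comm cd) -ev !(rlinZ _ _ (cd_al cd)).
  rewrite (rlinZ _ _ (cd_be cd)) -scalerBr -opprB.
  by move: e; rewrite /diff1 /= => ->; rewrite oppr0 scaler0.
exists (t + s)%N; exists (x ^+ s *: v).
  by rewrite PoszD addrA; apply: gfam_xs (cd_G cd) _ _ _ gv.
rewrite /diff0 (rlinZ _ _ (cd_a cd)) (rlinZ _ _ (cd_b cd)) -ev addnC exprD.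
congr (_, _) => /=; first by rewrite scalerA.
by move/eqP: hs; rewrite scalerBr subr_eq0 => /eqP ->; rewrite scalerA.
Qed.

Lemma secs_y n w : secs n w -> exists t : nat, msecs (n + t%:Z) (y ^+ t *: w).
Proof.
case: w => p q [[/= gp gq] e].
have [t [v [gv ev]]] := cd_denY cd gq.
have [|s hs] := cd_keral cd (p := a v - y ^+ t *: p).
  rewrite (klinB (rlin_klin (cd_al cd))) (cd_comm cd) -ev !(rlinZ _ _ (cd_al cd)).
  rewrite (rlinZ _ _ (cd_be cd)) -scalerBr.
  by move: e; rewrite /diff1 /= => ->; rewrite scaler0.
exists (t + s)%N; exists (y ^+ s *: v).
  by rewrite PoszD addrA; apply: gfam_ys (cd_G cd) _ _ _ gv.
rewrite /diff0 (rlinZ _ _ (cd_a cd)) (rlinZ _ _ (cd_b cd)) -ev addnC exprD.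
congr (_, _) => /=; last by rewrite scalerA.
by move/eqP: hs; rewrite scalerBr subr_eq0 => /eqP ->; rewrite scalerA.
Qed.

(** Every section is carried into [M] by powers of [x] and of [y]; minimal such
powers lead from a section outside [M] to one in the socle of H^1. *)
Lemma secs_descend n w : secs n w -> ~ msecs n w ->
  exists n' w', [/\ n <= n', secs n' w', ~ msecs n' w',
    msecs (n' + 1) (x *: w') & msecs (n' + 1) (y *: w')].
Proof.
move=> hw nw.
have ex1 : exists t, `[< msecs (n + t%:Z) (x ^+ t *: w) >].
  by have [t ht] := secs_x hw; exists t; apply/asboolP.
case: (ex_minnP ex1) => -[|i] /asboolP hi mini; first by move: hi; rewrite addr0 scale1r.
have nw1 : ~ msecs (n + i%:Z) (x ^+ i *: w).
  by move=> /asboolP /mini; rewrite ltnn.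
have hw1 : secs (n + i%:Z) (x ^+ i *: w) := gfam_xs (gfam_secs cd) _ hw.
have xw1 : msecs (n + i%:Z + 1) (x *: (x ^+ i *: w)).
  by rewrite scalerA -exprS (_ : n + i%:Z + 1 = n + i.+1%:Z) //; lia.
have : n <= n + i%:Z by lia.
move: (n + i%:Z) (x ^+ i *: w) nw1 hw1 xw1 => n1 w1 nw1 hw1 xw1 nn1 {mini hi}.
have ex2 : exists t, `[< msecs (n1 + t%:Z) (y ^+ t *: w1) >].
  by have [t ht] := secs_y hw1; exists t; apply/asboolP.
case: (ex_minnP ex2) => -[|j] /asboolP hj minj; first by move: hj; rewrite addr0 scale1r.
exists (n1 + j%:Z), (y ^+ j *: w1); split.
- by lia.
- exact: gfam_ys (gfam_secs cd) _ _ _ hw1.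
- by move=> /asboolP /minj; rewrite ltnn.
- have := gfam_ys (gfam_msecs cd) j xw1.
  by rewrite !scalerA (mulrC x) (_ : n1 + 1 + j%:Z = n1 + j%:Z + 1) //; lia.
- by rewrite scalerA -exprS (_ : n1 + j%:Z + 1 = n1 + j.+1%:Z) //; lia.
Qed.

(** The torsion is generated in some degree [n1] by elements killed by [x ^+ T] and
[y ^+ T], hence by all monomials of degree [2 T]. In degree [n1 + j] it is then
killed by the monomials of degree [2 T - j]. *)
Lemma tors_vanish : exists N, forall n, N <= n -> forall v, tors n v -> v = 0.
Proof.
have [n1 hn1] := noetherian (cd_G cd) (gfam_tors cd) hgens (@tors_G _ _ _ _ _ _ _).
have [T hT] : exists T, forall v, tors n1 v -> x ^+ T *: v = 0 /\ y ^+ T *: v = 0.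
  have d1 := generated_dim (cd_G cd) hgens (sN M) (fun v e => eq_ind_r _ (subsp0 (sG n1)) e).
  have [|m [_ [[e [te _ se]] _ _]]] := has_dim_sub (sN M) (sT n1) (sG n1) _ (@tors_G _ _ _ _ _ _ _ _) d1.
    by move=> v ->; apply: subsp0.
  have /choice[t ht] : forall i, exists t : nat, x ^+ t *: e i = 0 /\ y ^+ t *: e i = 0.
    move=> i; have [_ [ha hb]] := te i.
    have [s hs] := cd_kera cd ha; have [s' hs'] := cd_kerb cd hb.
    exists (s + s')%N; split; first by rewrite addnC exprD -scalerA hs scaler0.
    by rewrite exprD -scalerA hs' scaler0.
  exists (\sum_i t i)%N => v /se[c]; rewrite /null => /eqP; rewrite subr_eq0 => /eqP ->.
  split; rewrite scaler_sumr big1 // => i _; rewrite scalerA mulrC -scalerA (bigD1 i) //= addnC exprD.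
    by rewrite -[_ *: e i]scalerA (proj1 (ht i)) !scaler0.
  by rewrite -[_ *: e i]scalerA (proj2 (ht i)) !scaler0.
have step j v : (j <= 2 * T)%N -> tors (n1 + j%:Z) v ->
    forall i l, (i + l = 2 * T - j)%N -> x ^+ i *: (y ^+ l *: v) = 0.
  elim: j v => [|j IH] v jT.
    rewrite addr0 => /hT[h1 h2] i l e.
    have [iT|lT] : (T <= i)%N \/ (T <= l)%N by lia.
      by rewrite -(subnK iT) exprD -scalerA (scale_comm (x ^+ T)) h1 !scaler0.
    by rewrite -(subnK lT) exprD -[_ *: v]scalerA h2 !scaler0.
  rewrite (_ : n1 + j.+1%:Z = n1 + j%:Z + 1); last by lia.
  move=> /hn1 h i l e; have {h} [|u [w [hu hw ->]]] := h; first by lia.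
  have h1 := IH u (ltnW jT) hu i l.+1; have h2 := IH w (ltnW jT) hw i.+1 l.
  rewrite !scalerBr (scale_comm _ x) [y ^+ l *: (y *: _)]scalerA.
  rewrite [x ^+ i *: (x *: _)]scalerA -!exprSr.
  by rewrite h1 ?h2 ?subr0 //; lia.
exists (n1 + (2 * T)%:Z); apply: int_up => [v tv|n hn IH v].
  by have := step (2 * T)%N v (leqnn _) tv 0%N 0%N; rewrite !scale1r subnn; apply.
move=> /hn1 h; have {h} [|u [w [/IH -> /IH -> ->]]] := h; first by lia.
by rewrite !scaler0 subr0.
Qed.

(** In large degrees the Hilbert function of [M] is linear, so the Euler
characteristic of the Koszul complex vanishes; exactness at both ends forces
exactness in the middle. *)
Lemma koszul_exact_large : exists N, forall n, N <= n -> forall p q,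
  G (n + 1) p -> G (n + 1) q -> y *: p = x *: q ->
  exists2 v, G n v & p = x *: v /\ q = y *: v.
Proof.
have [N1 h1] := tors_vanish.
have [N2 h2] := noetherian (cd_G cd) (cd_G cd) hgens (fun n v h => h).
have [N3 [r h3]] := eventual_growth gens (gfam_subsp (null_gfam M)) (gfam_xy (null_gfam M)).
have nullG n (v : M) : null v -> G n v by move=> ->; apply: subsp0.
pose m n := std_count (@null _ M) (allmons n gens).
have dm n : has_dim (G n) (@null _ M) (m n).
  exact: (generated_dim (cd_G cd) hgens (sN M) (nullG n)).
exists (Num.max N1 (Num.max N2 N3)) => n; rewrite !ge_max => /and3P[n1 n2 n3] p q gp gq e.
have n3' : N3 <= n + 1 by lia.
have e1 : m (n + 1) = (m n + r)%N := proj1 (h3 n n3).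
have e2 : m (n + 1 + 1) = (m (n + 1)%R + r)%N := proj1 (h3 (n + 1) n3').
have k1 := @klin_kos1 k M; have k2 := @klin_kos2 k M.
have sq1 : subsp (square (G (n + 1))) := subsp_square (sG (n + 1)).
have nsq : has_dim (square (G (n + 1))) (@null _ (M * M)%type) (m (n + 1)%R + m (n + 1)%R)%N.
  apply: eq_has_dim (has_dim_square (sN M) (sG (n + 1)) (nullG (n + 1)) (dm (n + 1))) => //.
  exact: square_null.
have [m1 [m2 [d1 d2 em]]] := rank_nullity k1 (sG n) (sN M) (sN (M * M)%type)
  (fun v e => etrans (congr1 _ e) (klin0 k1)) (nullG n) (dm n).
have m10 : m1 = 0%N.
  apply: (has_dim_uniq (sN M) d1); apply: has_dim0 => v [gv [xv yv]].
  apply: (h1 n n1); split=> //; congr (_, _).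
    by apply: (cd_xX cd); rewrite -(rlinZ _ _ (cd_a cd)) xv (klin0 (rlin_klin (cd_a cd))).
  by apply: (cd_yY cd); rewrite -(rlinZ _ _ (cd_b cd)) yv (klin0 (rlin_klin (cd_b cd))).
have [|m1' [m2' [d1' d2' em']]] := rank_nullity k2 sq1 (sN (M * M)%type) (sN M)
  (fun v e => etrans (congr1 _ e) (klin0 k2)) _ nsq.
  by move=> v ->; apply: subsp0.
have m2E : m2' = m (n + 1 + 1).
  apply: (has_dim_uniq (sN M) d2'); apply: eq_has_dim (dm (n + 1 + 1)) => // v.
  split=> [/h2 [|u [w [hu hw ->]]]|[[u w] [/= hu hw] /eqP]]; first by lia.
    by exists (u, w) => //; rewrite /null /kos2 subrr.
  rewrite subr_eq0 => /eqP ->; apply: subspB; first exact: sG.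
    exact: gfam_y (cd_G cd) _ _ hu.
  exact: gfam_x (cd_G cd) _ _ hw.
have m2m1 : m2 = m1' by lia.
rewrite -m2m1 in d1'.
have [v gv /eqP] : image_mod (@kos1 k M : M -> (M * M)%type) (G n) (@null _ (M * M)%type) (p, q).
  apply: (has_dim_full (subsp_image_mod k1 (sG n) (sN _)) (subsp_kernel_mod k2 sq1 (sN M)) _ d2 d1').
    move=> [u w] [v gv /eqP]; rewrite subr_eq0 => /eqP ->; split.
      by split; [exact: gfam_x (cd_G cd) _ _ gv|exact: gfam_y (cd_G cd) _ _ gv].
    exact: kos21.
  by split=> //; rewrite /null /kos2 /= e subrr.
by rewrite subr_eq0 => /eqP[-> ->]; exists v.
Qed.

(** H^1 vanishes in large degrees: for [w] in its socle, [(x w, y w)] is a Koszul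
cocycle of [M], hence comes from an element of [M], which must be [w]. *)
Lemma secs_large : exists N, forall n, N <= n -> forall w, secs n w -> msecs n w.
Proof.
have [N1 h1] := tors_vanish; have [N2 h2] := koszul_exact_large.
exists (Num.max N1 N2) => n; rewrite ge_max => /andP[n1 n2] w hw; apply: contrapT => nw.
have [n' [w' [nn' hw' nw' [p gp ep] [q gq eq]]]] := secs_descend hw nw.
have [||v gv [ep' eq']] := h2 n' _ p q gp gq; first by lia.
  apply/eqP; rewrite -subr_eq0; apply/eqP; apply: (h1 (n' + 1 + 1)); first by lia.
  split; first by apply: subspB => //; [exact: gfam_y (cd_G cd) _ _ gp|exact: gfam_x (cd_G cd) _ _ gq].
  rewrite (klinB klin_d0) !(rlinZ _ _ (rlin_d0 cd)) -ep -eq.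
  by rewrite scale_xy_comm subrr.
apply: nw'; exists v => //; apply/eqP; rewrite -subr_eq0; apply/eqP.
apply: (XY_inj cd); rewrite scalerBr -(rlinZ _ _ (rlin_d0 cd)).
  by rewrite -ep' -ep subrr.
by rewrite -eq' -eq subrr.
Qed.

(** In large degrees sections are elements of [M]; below, a section is determined
by its products with [x] and [y]. *)
Lemma secs_finite : exists s : int -> nat, forall n, has_dim (secs n) (@null _ XY) (s n).
Proof.
suff h : forall n, exists d, has_dim (secs n) (@null _ XY) d.
  by have [s hs] := choice h; exists s.
have [N hN] := secs_large.
have large n : N <= n -> exists d, has_dim (secs n) (@null _ XY) d.
  move=> nN; have nullG (v : M) : null v -> G n v by move=> ->; apply: subsp0.
  have dm := generated_dim (cd_G cd) hgens (sN M) nullG.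
  have [m1 [m2 [_ d2 _]]] := rank_nullity klin_d0 (sG n) (sN M) (sN XY)
    (fun v e => etrans (congr1 _ e) (klin0 klin_d0)) nullG dm.
  exists m2; apply: eq_has_dim d2 => // w; split=> [[v gv /eqP]|/(hN n nN)[v gv ->]].
    by rewrite subr_eq0 => /eqP ->; apply: (msecs_secs cd); exists v.
  by exists v => //; rewrite /null subrr.
have small n : n <= N -> exists d, has_dim (secs n) (@null _ XY) d.
  move: n; apply: int_down => [|n nN [d hd]]; first exact: large.
  have d2 := has_dim_square (sN XY) (sS n) (fun v e => eq_ind_r _ (subsp0 (sS n)) e) hd.
  apply: (@has_dim_of_ker k XY (XY * XY)%type (@kos1 k XY) _ _ (square (secs n))
    (square (@null _ XY)) _ (sS (n - 1)) (sN XY) (subsp_square (sS n)) (subsp_square (sN XY)) _ _ _ _ 0%N (d + d)).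
  - exact: klin_kos1.
  - move=> w hw; rewrite -(subrK 1 n).
    by split; [exact: gfam_x (gfam_secs cd) _ _ hw|exact: gfam_y (gfam_secs cd) _ _ hw].
  - by move=> w ->; split; rewrite /null /= scaler0.
  - by move=> w ->; exact: (subsp0 (sS _)).
  - by move=> [w1 w2] [/= -> ->]; split; exact: (subsp0 (sS _)).
  - by apply: has_dim0 => w [_ [e1 e2]]; apply: (XY_inj cd).
  - exact: d2.
by move=> n; have [/small|/ltW /large] := leP n N.
Qed.

(** Minimal generators of the section module are counted by the second
difference of its Hilbert function. *)
Lemma secs_gens (s : int -> nat) : (forall n, has_dim (secs n) (@null _ XY) (s n)) ->
  exists g : int -> nat,
    (forall n, has_dim (secs (n + 1)) (xysum (secs n)) (g (n + 1)%R)) /\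
    forall n, (s n + s (n + 2)%R = s (n + 1)%R + s (n + 1)%R + g (n + 2)%R)%N.
Proof.
move=> hs.
have nullS n (v : XY) : null v -> secs n v by move=> ->; apply: subsp0.
have nullX n (v : XY) : null v -> xysum (secs n) v.
  by move=> ->; apply: subsp0; apply: subsp_xysum.
have sX n := subsp_xysum (sS n).
have XS n v : xysum (secs n) v -> secs (n + 1) v := xysum_in (gfam_secs cd).
have /choice [m /choice [g0 hg]] : forall n, exists m g, [/\ has_dim (xysum (secs n)) (@null _ XY) m,
    has_dim (secs (n + 1)) (xysum (secs n)) g & s (n + 1) = (m + g)%N].
  by move=> n; exact: (has_dim_sub (sN XY) (sX n) (sS (n + 1)) (nullX n) (XS n) (hs (n + 1))).
exists (fun n => g0 (n - 1)); split=> n; first by rewrite addrK; case: (hg n).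
rewrite (_ : n + 2 - 1 = n + 1); last by lia.
have [d1 d2] := hg (n + 1); rewrite (_ : n + 1 + 1 = n + 2); last by lia.
move=> ->.
have hsq := has_dim_square (sN XY) (sS (n + 1)) (nullS (n + 1)) (hs (n + 1)).
have := @dim_exact k XY (XY * XY)%type XY (@kos1 k XY) (@kos2 k XY)
  (secs n) (@null _ XY) (square (secs (n + 1))) (square (@null _ XY))
  (xysum (secs (n + 1))) (@null _ XY) (@klin_kos1 k XY) (@klin_kos2 k XY) (sS n) (sN XY)
  (subsp_square (sS (n + 1))) (subsp_square (sN XY)) (sX (n + 1)) (sN XY) (nullS n).
move/(_ _ (nullX (n + 1)) _ _ _ _ _ _ _ 0%N _ _ _ _ (hs n) hsq d1) => h.
suff : (s n + m (n + 1)%R = s (n + 1)%R + s (n + 1)%R + 0)%N by rewrite addn0; lia.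
apply: h.
- by move=> [u v] [/= -> ->]; split; exact: (subsp0 (sS _)).
- by move=> w hw; split; [exact: gfam_x (gfam_secs cd) _ _ hw|exact: gfam_y (gfam_secs cd) _ _ hw].
- by move=> [u v] [/= hu hv]; exists u, v.
- by move=> w ->; split; rewrite /null /= scaler0.
- by move=> [u v] [/= -> ->]; rewrite /null /kos2 /= !scaler0 subrr.
- by move=> w _; exact: kos21.
- move=> [u v] [/= hu hv] /eqP; rewrite /kos2 /= subr_eq0 => /eqP e.
  have [w hw [-> ->]] := secs_koszul cd hu hv e.
  by exists w => //; split; rewrite /null /= subrr.
- by move=> w [u [v [hu hv ->]]]; exists (u, v) => //; rewrite /null /kos2 /= subrr.
- by apply: has_dim0 => w [_ [e1 e2]]; apply: (XY_inj cd).
Qed.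

Lemma divX_iter t n p : GX (n + t%:Z) p -> exists2 q, GX n q & p = x ^+ t *: q.
Proof.
elim: t n p => [|t IH] n p hp; first by exists p; rewrite ?scale1r // -(addr0 n).
have [p' hp' ->] := cd_divX cd hp.
have [|q hq ->] := IH n p'; first by rewrite (_ : n + t%:Z = n + t.+1%:Z - 1) //; lia.
by exists q => //; rewrite exprS scalerA.
Qed.

Lemma divY_iter t n p : GY (n + t%:Z) p -> exists2 q, GY n q & p = y ^+ t *: q.
Proof.
elim: t n p => [|t IH] n p hp; first by exists p; rewrite ?scale1r // -(addr0 n).
have [p' hp' ->] := cd_divY cd hp.
have [|q hq ->] := IH n p'; first by rewrite (_ : n + t%:Z = n + t.+1%:Z - 1) //; lia.
by exists q => //; rewrite exprS scalerA.
Qed.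

Lemma inj_iter (V : lmodType R) (c : R) t (v : V) :
  (forall w : V, c *: w = 0 -> w = 0) -> c ^+ t *: v = 0 -> v = 0.
Proof.
move=> inj; elim: t => [|t IH]; first by rewrite scale1r.
by rewrite exprS -scalerA => /inj.
Qed.

(** Every fraction of large degree is a sum of fractions with a power of [x]
alone, or of [y] alone, in the denominator. *)
Lemma h2_large : exists N, forall n, N <= n -> forall z, GW n z -> ims n z.
Proof.
have [N hN] : exists N : int, forall g, g \in gens -> g.1 <= N.
  elim: (gens) => [|g s [N hN]]; first by exists 0.
  exists (Num.max g.1 N) => h; rewrite inE le_max => /orP[/eqP ->|/hN ->].
    by rewrite lexx.
  by rewrite orbT.
exists N => n nN z gz; have [t [v [gv ev]]] := cd_denW cd gz.
suff [z' hz' ez'] : exists2 z', ims n z' & x ^+ t *: (y ^+ t *: z') = al (a v).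
  suff -> : z = z' by [].
  apply/eqP; rewrite -subr_eq0; apply/eqP.
  apply: (inj_iter (t := t) (cd_yW cd)); apply: (inj_iter (t := t) (cd_xW cd)).
  by rewrite !scalerBr ev ez' subrr.
have := proj2 hgens _ _ gv; move: v {gv ev z gz}; apply: adjs_min.
- split; first by exists 0; rewrite ?scaler0 ?(klin0 (rlin_klin (cd_a cd))) ?(klin0 (rlin_klin (cd_al cd))) //; apply: subsp0.
  move=> c u v [p hp ep] [q hq eq]; exists (c%:MP *: p + q); first exact: subsp_lin.
  rewrite (cd_a cd) (cd_al cd) -ep -eq !scalerDr; congr (_ + _).
  by rewrite !(scale_comm _ c%:MP).
- move=> v ->; exists 0; rewrite ?scaler0 ?(klin0 (rlin_klin (cd_a cd))) ?(klin0 (rlin_klin (cd_al cd))) //.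
  exact: subsp0.
- move=> v /flattenP[s /mapP[g gg ->]] /(nthP 0)[i]; rewrite size_mons => id <-.
  have gN := hN g gg; have hg := proj1 hgens g gg; have /= := nth_mkseq 0 _ id => ->.
  rewrite /mon; set l := ((mon_dim _ _).-1 - i)%N.
  have e : n + t%:Z + t%:Z = g.1 + i%:Z + l%:Z.
    exact: mon_dim_exp.
  have [it|lt] : (t <= i)%N \/ (t <= l)%N by lia.
    have gb : GY (n + t%:Z) (b (x ^+ (i - t) *: (y ^+ l *: g.2))).
      apply: (cd_gb cd); rewrite (_ : n + t%:Z = g.1 + l%:Z + (i - t)%N%:Z); last by lia.
      exact: gfam_xs (cd_G cd) _ _ _ (gfam_ys (cd_G cd) _ hg).
    have [q gq eq] := divY_iter gb.
    exists (be q).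
      exists (0, q); first by split=> //; exact: (subsp0 (gfam_subsp (cd_GX cd) n)).
      by rewrite /diff1 /= (klin0 (rlin_klin (cd_al cd))) subr0.
    rewrite -!(rlinZ _ _ (cd_be cd)) -eq (cd_comm cd) -(rlinZ _ _ (cd_b cd)).
    by rewrite !scalerA -exprD subnKC.
  have gb : GX (n + t%:Z) (a (x ^+ i *: (y ^+ (l - t) *: g.2))).
    apply: (cd_ga cd); rewrite (_ : n + t%:Z = g.1 + (l - t)%N%:Z + i%:Z); last by lia.
    exact: gfam_xs (cd_G cd) _ _ _ (gfam_ys (cd_G cd) _ hg).
  have [q gq eq] := divX_iter gb.
  exists (al q).
    exists (- q, 0).
      by split; [exact: (subspN (gfam_subsp (cd_GX cd) n))|exact: (subsp0 (gfam_subsp (cd_GY cd) n))].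
    rewrite /diff1 /= (klin0 (rlin_klin (cd_be cd))) -(sub0r q).
    by rewrite (klinB (rlin_klin (cd_al cd))) (klin0 (rlin_klin (cd_al cd))) !sub0r opprK.
  rewrite scale_comm -!(rlinZ _ _ (cd_al cd)) -eq -(rlinZ _ _ (cd_a cd)).
  by rewrite (scale_comm (y ^+ t)) !scalerA -mulrA -exprD subnKC.
Qed.

(** The second difference of the Hilbert function of H^2 is the dimension of its
socle, because the Koszul complex on H^2 is exact elsewhere. Finiteness in each
degree descends from large degrees by the same sequence. *)
Lemma h2_finite (g : int -> nat) :
  (forall n, has_dim (secs (n + 1)) (xysum (secs n)) (g (n + 1)%R)) ->
  exists h2 : int -> nat,
    (forall n, has_dim (GW n) (ims n) (h2 n)) /\
    (exists N, forall n, N <= n -> h2 n = 0%N) /\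
    forall n, (h2 n + h2 (n + 2)%R = h2 (n + 1)%R + h2 (n + 1)%R + g (n + 2)%R)%N.
Proof.
move=> hg; have [N hN] := h2_large.
have IW n z : ims n z -> GW n z := @ims_GW _ _ _ _ _ _ _ _ _ _ _ _ _ cd n z.
have fW n z : GW n z -> square (GW (n + 1)) (kos1 z).
  by move=> hz; split; [exact: gfam_x (cd_GW cd) _ _ hz|exact: gfam_y (cd_GW cd) _ _ hz].
have fI n z : ims n z -> square (ims (n + 1)) (kos1 z).
  by move=> hz; split; [exact: gfam_x (gfam_ims cd) _ _ hz|exact: gfam_y (gfam_ims cd) _ _ hz].
have IIWW n p : square (ims n) p -> square (GW n) p.
  by move=> [h1 h2]; split; exact: (ims_GW cd).
have soc n : has_dim (fun z => GW n z /\ square (ims (n + 1)) (kos1 z)) (ims n) (g (n + 2)).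
  apply: (socle_dim cd); rewrite (_ : n + 2 = n + 1 + 1); last by lia.
  exact: hg.
have large n : N <= n -> has_dim (GW n) (ims n) 0 by move=> nN; apply/has_dim0/hN.
have small n : n <= N -> exists d, has_dim (GW n) (ims n) d.
  move: n; apply: int_down => [|n nN [d hd]]; first by exists 0%N; apply: large.
  have hd2 := has_dim_square (sI n) (sW n) (IW n) hd.
  have s1 := soc (n - 1); rewrite (_ : n - 1 + 1 = n) in s1; last by lia.
  have f1 := fW (n - 1); rewrite (_ : n - 1 + 1 = n) in f1; last by lia.
  have i1 := fI (n - 1); rewrite (_ : n - 1 + 1 = n) in i1; last by lia.
  exact: (has_dim_of_ker (@klin_kos1 k W) (sW (n - 1)) (sI (n - 1)) (subsp_square (sW n))
    (subsp_square (sI n)) f1 i1 (IW (n - 1)) (@IIWW n) s1 hd2).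
have /choice [h2 hh2] : forall n, exists d, has_dim (GW n) (ims n) d.
  by move=> n; have [/small|/ltW /large] := leP n N => //; exists 0%N.
exists h2; split=> //; split.
  by exists N => n /large; apply: has_dim_uniq (sI n) (hh2 n).
move=> n.
have hsq := has_dim_square (sI (n + 1)) (sW (n + 1)) (IW (n + 1)) (hh2 (n + 1)).
have n2 : n + 2 = n + 1 + 1 by lia.
have := @dim_exact k W (W * W)%type W (@kos1 k W) (@kos2 k W)
  (GW n) (ims n) (square (GW (n + 1))) (square (ims (n + 1)))
  (GW (n + 2)) (ims (n + 2)) (@klin_kos1 k W) (@klin_kos2 k W) (sW n) (sI n)
  (subsp_square (sW (n + 1))) (subsp_square (sI (n + 1))) (sW (n + 2)) (sI (n + 2))
  (IW n) (@IIWW (n + 1)) (IW (n + 2)) (fW n) _ (fI n) _ _ _ _ _ _ _ _ (soc n) (hh2 n) hsq (hh2 (n + 2)).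
apply.
- by move=> [u v] [hu hv]; rewrite n2; apply: (subspB (sW _)); [exact: gfam_y (cd_GW cd) _ _ hu|exact: gfam_x (cd_GW cd) _ _ hv].
- by move=> [u v] [hu hv]; rewrite n2; apply: (subspB (sI _)); [exact: gfam_y (gfam_ims cd) _ _ hu|exact: gfam_x (gfam_ims cd) _ _ hv].
- by move=> w _; rewrite kos21; exact: (subsp0 (sI _)).
- move=> [u v] [/= hu hv] /(koszul_h2 cd hu hv)[z gz [e1 e2]].
  by exists z.
- move=> z hz; have [z' gz' ->] := cd_divyW cd hz.
  rewrite (_ : n + 2 - 1 = n + 1) in gz'; last by lia.
  exists (z', 0); first by split=> //; exact: (subsp0 (sW _)).
  by rewrite /kos2 /= scaler0 subr0 subrr; exact: (subsp0 (sI _)).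
Qed.

(** Sections are bounded in negative degrees: those killed by a power of [x]
embed in degree [n + t] by a power of [y], and the others by a power of [x]. *)
Lemma secs_bound n t d d' : has_dim (secs n) (@null _ XY) d ->
  has_dim (secs (n + t%:Z)) (@null _ XY) d' -> (d <= d' + d')%N.
Proof.
move=> hd hd'.
have nullS m (v : XY) : null v -> secs m v by move=> ->; exact: (subsp0 (sS _)).
have kx := @klin_scale k XY (x ^+ t); have ky := @klin_scale k XY (y ^+ t).
have [m1 [m2 [h1 h2 ->]]] := rank_nullity kx (sS n) (sN XY) (sN XY)
  (fun v e => etrans (congr1 _ e) (klin0 kx)) (nullS n) hd.
apply: leq_add.
  have sK := subsp_kernel_mod kx (sS n) (sN XY).
  have [|m3 [m4 [h3 h4 e]]] := rank_nullity ky sK (sN XY) (sN XY)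
    (fun v e => etrans (congr1 _ e) (klin0 ky)) _ h1.
    by move=> v ->; apply: (subsp0 sK).
  have m30 : m3 = 0%N.
    apply: (has_dim_uniq (sN XY) h3); apply: has_dim0 => -[p q] [[_ [ep _]] [_ eq]].
    by congr (_, _); [exact: inj_iter (cd_xX cd) ep|exact: inj_iter (cd_yY cd) eq].
  rewrite e m30 add0n; apply: has_dim_mono (subsp_image_mod ky sK (sN XY)) (sS _) _ h4 hd'.
  move=> w [v [hv _] /eqP]; rewrite subr_eq0 => /eqP ->.
  exact: gfam_ys (gfam_secs cd) _ _ _ hv.
apply: has_dim_mono (subsp_image_mod kx (sS n) (sN XY)) (sS _) _ h2 hd'.
move=> w [v hv /eqP]; rewrite subr_eq0 => /eqP ->.
exact: gfam_xs (gfam_secs cd) _ _ _ hv.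
Qed.

End Finiteness.

(** * The shape of a local cohomology table *)
Definition submset (E A : seq int) : Prop :=
  forall b, (count_mem b E <= count_mem b A)%N.

(** Macaulay's bound for a module generated in the degrees [A] and, in addition, by
elements of arbitrarily low degree: a generator of degree [b] can contribute to the
growth at [n] only if all of its [n - b + 1] multiples in degree [n] are standard,
which is impossible for [b] very negative. *)
Definition macaulay_bound (A : seq int) (h : int -> nat) : Prop :=
  forall n : int, exists E, [/\ submset E A, forall b, b \in E -> b <= n + 1,
    (\sum_(b <- E) mon_dim n b <= h n)%N & (h (n + 1)%R <= h n + size E)%N].

Lemma int_support_seq (g : int -> nat) lo (K : nat) :
  exists A : seq int, forall b,
    count_mem b A = if (lo <= b) && (b < lo + K%:Z) then g b else 0%N.
Proof.
elim: K => [|K [A hA]].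
  by exists [::] => b; case: ifP => //; lia.
exists (A ++ nseq (g (lo + K%:Z)) (lo + K%:Z)) => b.
rewrite count_cat hA count_nseq /=.
have [e|/eqP ne] := eqVneq (lo + K%:Z) b.
  have [c1 c2] : (lo <= b) && (b < lo + K%:Z) = false /\ (lo <= b) && (b < lo + K.+1%:Z).
    by lia.
  by rewrite c1 c2 mul1n -e.
by rewrite mul0n addn0; case: ifP; case: ifP; lia.
Qed.

Lemma bounded_support_seq (g : int -> nat) lo hi :
  (forall n, n <= lo -> g n = 0%N) -> (forall n, hi <= n -> g n = 0%N) ->
  exists A : seq int, forall b, count_mem b A = g b.
Proof.
move=> hlo hhi; have [A hA] := int_support_seq g lo (absz (hi - lo)).
exists A => b; rewrite hA; case: ifP => // hb.
have [|blo] := leP b lo; first by move=> /hlo.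
have [|bhi] := leP hi b; first by move=> /hhi.
by move: hb; lia.
Qed.

(** The Hilbert function of H^2 of the direct sum of the modules R(-a), for [a] in
[A]: the summand of R(-a) is max(0, a - 1 - n). *)
Definition h2sum (A : seq int) (n : int) : nat := \sum_(a <- A) mon_dim (a - 2) n.

Lemma mon_dim_diff2 (a n : int) :
  (mon_dim (a - 2)%R n + mon_dim (a - 2)%R (n + 2)%R =
   mon_dim (a - 2)%R (n + 1)%R + mon_dim (a - 2)%R (n + 1)%R + (a == (n + 2)%R))%N.
Proof. by rewrite /mon_dim; case: eqP; do 3 case: ifP; lia. Qed.

Lemma h2sum_diff2 A n :
  (h2sum A n + h2sum A (n + 2)%R =
   h2sum A (n + 1)%R + h2sum A (n + 1)%R + count_mem (n + 2)%R A)%N.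
Proof.
rewrite /h2sum; elim: A => [|a A IH]; first by rewrite !big_nil.
rewrite !big_cons /=; have := mon_dim_diff2 a n; move: IH.
by move: (\sum_(j <- A) _)%N (\sum_(j <- A) _)%N (\sum_(j <- A) _)%N (count_mem _ A); lia.
Qed.

Lemma h2sum_large A : exists N, forall n, N <= n -> h2sum A n = 0%N.
Proof.
elim: A => [|a A [N hN]]; first by exists 0 => n _; rewrite /h2sum big_nil.
exists (Num.max N (a - 1)) => n; rewrite ge_max => /andP[/hN h1 h2].
by move: h1; rewrite /h2sum big_cons => ->; rewrite addn0 mon_dim0 //; lia.
Qed.

Lemma diff2_uniq (f f' g : int -> nat) N :
  (forall n, N <= n -> f n = 0%N) -> (forall n, N <= n -> f' n = 0%N) ->
  (forall n, (f n + f (n + 2)%R = f (n + 1)%R + f (n + 1)%R + g (n + 2)%R)%N) ->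
  (forall n, (f' n + f' (n + 2)%R = f' (n + 1)%R + f' (n + 1)%R + g (n + 2)%R)%N) ->
  forall n, f n = f' n.
Proof.
move=> h h' e e'.
have small n : n <= N -> f n = f' n /\ f (n + 1) = f' (n + 1).
  move: n; apply: int_down => [|n nN [e1 e2]]; first by rewrite !h ?h' //; lia.
  rewrite subrK; split=> //; have := e (n - 1); have := e' (n - 1).
  rewrite subrK (_ : n - 1 + 2 = n + 1); last by lia.
  by rewrite e1 e2 => <- /addIn.
by move=> n; have [/small[]//|/ltW nN] := leP n N; rewrite h ?h'.
Qed.

Section Shape.
Variable k : fieldType.
Local Notation R := {mpoly k[2]}.
Local Notation x := (vx k).
Local Notation y := (vy k).

Lemma xyclosed_allmons (V : lmodType R) (B B' : V -> Prop) n gens :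
  subsp B' -> xyclosed B B' ->
  xyclosed (adjoins B (allmons n gens)) (adjoins B' (allmons (n + 1) gens)).
Proof.
elim: gens B B' => [|g gens IH] B B' hB' xy; first exact: xy.
rewrite /allmons /= !adjs_cat; apply: IH; first exact: subsp_adjs.
exact: xyclosed_mons.
Qed.

Lemma mons_self (V : lmodType R) n (v : V) : v \in mons n (n, v).
Proof.
have e : mon_dim n n = 1%N by rewrite /mon_dim lexx subrr.
by rewrite /mons /mkseq /= e /= inE /mon e /= !expr0 mulr1 scale1r.
Qed.

Lemma allmons_self (V : lmodType R) n (v : V) gens :
  (n, v) \in gens -> v \in allmons n gens.
Proof.
move=> h; apply/flattenP; exists (mons n (n, v)); last exact: mons_self.
by apply: map_f.
Qed.

Variables (M X Y W : lmodType R) (G : int -> M -> Prop).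
Variables (GX : int -> X -> Prop) (GY : int -> Y -> Prop) (GW : int -> W -> Prop).
Variables (a : M -> X) (b : M -> Y) (al : X -> W) (be : Y -> W).
Variable cd : cech_data G GX GY GW a b al be.
Variable gens : seq (int * M).
Variable hgens : generated G gens.

Local Notation XY := (X * Y)%type.
Local Notation secs := (secs GX GY al be).
Local Notation msecs := (msecs G a b).
Local Notation ims := (ims GX GY al be).
Local Notation tors := (tors G a b).

Let sS n := gfam_subsp (gfam_secs cd) n.
Let sM n := gfam_subsp (gfam_msecs cd) n.
Let sN V := @subsp_null k V.

(** Generators of the section module in degrees [n0] to [n0 + l]: a basis in degree
[n0], and minimal generators above. *)
Lemma secs_gens_seq (s g : int -> nat) n0 (l : nat) :
  (forall n, has_dim (secs n) (@null _ XY) (s n)) ->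
  (forall n, has_dim (secs (n + 1)) (xysum (secs n)) (g (n + 1)%R)) ->
  exists L : seq (int * XY),
  [/\ forall e, e \in L -> secs e.1 e.2,
      forall e, e \in L -> e.1 <= n0 + l%:Z,
      forall c, c != n0 -> (count_mem c (map fst L) <= g c)%N &
      forall m, n0 <= m -> m <= n0 + l%:Z ->
        forall w, secs m w -> adjoins (@null _ XY) (allmons m L) w].
Proof.
move=> hs hg; elim: l => [|l [L [L1 L2 L3 L4]]].
  have [e [he _ se]] := hs n0.
  exists [seq (n0, e i) | i <- enum 'I_(s n0)]; split.
  - by move=> _ /mapP[i _ ->]; exact: he.
  - by move=> _ /mapP[i _ ->]; rewrite addr0.
  - move=> c /negPf cn; rewrite -map_comp count_map (@eq_count _ _ pred0) ?count_pred0 //.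
    by move=> i /=; rewrite eq_sym cn.
  - move=> m m1 m2; have -> : m = n0 by lia.
    move=> w /se[c]; rewrite /null => /eqP; rewrite subr_eq0 => /eqP ->.
    have sA := subsp_adjs (allmons n0 [seq (n0, e i) | i <- enum 'I_(s n0)]) (sN XY).
    apply: subsp_sum => // i _; apply: subspZ => //; apply: adjs_mem => //.
    by apply: allmons_self; apply: map_f; rewrite mem_enum.
have := hg (n0 + l%:Z); rewrite (_ : n0 + l%:Z + 1 = n0 + l.+1%:Z); last by lia.
set n1 := n0 + l.+1%:Z => -[e [he _ se]].
set L' := [seq (n1, e i) | i <- enum 'I_(g n1)].
exists (L ++ L'); split.
- by move=> c; rewrite mem_cat => /orP[/L1 //|/mapP[i _ ->]]; exact: he.
- by move=> c; rewrite mem_cat => /orP[/L2|/mapP[i _ ->]] //; lia.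
- move=> c cn; rewrite map_cat count_cat -map_comp [X in (_ + X)%N]count_map.
  have [->|cn1] := eqVneq c n1.
    rewrite (_ : count_mem n1 (map fst L) = 0%N) ?add0n.
      by rewrite (leq_trans (count_size _ _)) // size_enum_ord.
    by apply/count_memPn/mapP => -[c' /L2 h e']; move: h; rewrite -e'; lia.
  rewrite [X in (_ + X)%N](@eq_count _ _ pred0) ?count_pred0 ?addn0 ?L3 //.
  by move=> i /=; rewrite eq_sym (negPf cn1).
- have cat m : allmons m (L ++ L') = allmons m L ++ allmons m L'.
    by rewrite /allmons map_cat flatten_cat.
  move=> m m1 m2 w hw; rewrite cat adjs_cat.
  have [mle|] := leP m (n0 + l%:Z); first by apply: adjs_incl; apply: L4.
  move=> lm; have em : m = n1 by lia.
  rewrite em in hw *; have [c [u [v [hu hv /eqP]]]] := se w hw.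
  rewrite subr_eq => /eqP ->.
  have sA := subsp_adjs (allmons n1 L) (sN XY); have sA' := subsp_adjs (allmons n1 L') sA.
  have xc := @xyclosed_allmons XY _ _ (n0 + l%:Z) L (sN XY) (@gfam_xy _ _ _ (null_gfam XY) 0).
  rewrite (_ : n0 + l%:Z + 1 = n1) in xc; last by lia.
  apply: subspD => //; first apply: adjs_incl.
    have hl : n0 + l%:Z <= n0 + l%:Z by []; have h0 : n0 <= n0 + l%:Z by lia.
    have [_ yu] := xc _ (L4 _ h0 hl _ hu); have [xv _] := xc _ (L4 _ h0 hl _ hv).
    exact: subspB.
  apply: subsp_sum => // i _; apply: subspZ => //; apply: adjs_mem => //.
  by apply: allmons_self; apply: map_f; rewrite mem_enum.
Qed.

Lemma mem_mon_dim_le (E : seq int) n c : c \in E -> (mon_dim n c <= \sum_(e <- E) mon_dim n e)%N.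
Proof. by move=> h; rewrite (big_rem c) //= leq_addr. Qed.

(** H^1 is the quotient of the section module by [M]. To bound its growth at [n],
generate it from degree [n0 = n - h1 n] on: a generator of degree [n0] has
[h1 n + 1] multiples in degree [n], too many to be all standard. *)
Lemma h1_macaulay (s g h1 : int -> nat) A :
  (forall n, has_dim (secs n) (@null _ XY) (s n)) ->
  (forall n, has_dim (secs (n + 1)) (xysum (secs n)) (g (n + 1)%R)) ->
  (forall n, has_dim (secs n) (msecs n) (h1 n)) ->
  (forall c, count_mem c A = g c) ->
  macaulay_bound A h1.
Proof.
move=> hs hg hh hA n.
have [L [L1 L2 L3 L4]] := secs_gens_seq (n - (h1 n)%:Z) (h1 n).+1 hs hg.
have adjsE m : n - (h1 n)%:Z <= m -> m <= n + 1 -> std_count (msecs m) (allmons m L) = h1 m.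
  move=> m1 m2; apply: (has_dim_uniq (sM m)) (hh m).
  apply: eq_has_dim (has_dim_adjs (allmons m L) (sM m)) => // w; split.
    by apply: (adjs_allmons (gfam_secs cd)) => // v; exact: (msecs_secs cd).
  move=> /L4 h; apply: adjs_mono (sM m) _ (h _ _) => //; last by lia.
  by move=> v ->; apply: subsp0.
have [E [E1 E2 E3 E4]] := macaulay L n (sM n) (sM (n + 1)) (@gfam_xy _ _ _ (gfam_msecs cd) n).
rewrite !adjsE in E3 E4; try by lia.
exists E; split=> // c; rewrite hA.
have [ec|cn] := eqVneq c (n - (h1 n)%:Z); last exact: leq_trans (E1 c) (L3 c cn).
rewrite (_ : count_mem c E = 0%N) //; apply/count_memPn/negP => cE.
by have := leq_trans (mem_mon_dim_le n cE) E3; rewrite ec /mon_dim; case: ifP; lia.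
Qed.

(** The Hilbert function of the section module is convex, and bounded near minus
infinity; it is therefore nondecreasing, and constant in low degrees. *)
Lemma secs_small (s : int -> nat) g : (forall n, has_dim (secs n) (@null _ XY) (s n)) ->
  (forall n, (s n + s (n + 2)%R = s (n + 1)%R + s (n + 1)%R + g (n + 2)%R)%N) ->
  exists L, forall n, n <= L -> s n = s L /\ g n = 0%N.
Proof.
move=> hs e.
have mono n : (s n <= s (n + 1)%R)%N.
  rewrite leqNgt; apply/negP => lt.
  have grow j : (s n + j <= s (n - j%:Z)%R)%N /\ (s (n + 1 - j%:Z)%R < s (n - j%:Z)%R)%N.
    elim: j => [|j [IH1 IH2]]; first by rewrite !subr0 addn0.
    have := e (n - j.+1%:Z).
    rewrite (_ : n - j.+1%:Z + 2 = n + 1 - j%:Z); last by lia.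
    rewrite (_ : n - j.+1%:Z + 1 = n - j%:Z); last by lia.
    rewrite (_ : n + 1 - j.+1%:Z = n - j%:Z); last by lia.
    set p := s (n - j.+1%:Z); set q := s (n - j%:Z) in IH1 IH2 *.
    set r := s (n + 1 - j%:Z) in IH2 *; move: (g _) (s n) p q r IH1 IH2; clear.
    lia.
  have [h _] := grow (s n).+1.
  have := secs_bound cd (t := (s n).+1) (hs (n - (s n).+1%:Z)).
  by rewrite subrK => /(_ _ (hs n)); move: h; lia.
have [|n1 _ h1] := @eventually_const (fun n => s (- n)) 0.
  move=> n _; have := mono (- (n + 1)); rewrite (_ : - (n + 1) + 1 = - n) //; lia.
have cst : forall n, n <= - n1 -> s n = s (- n1).
  apply: int_down => // n nn IH; have := h1 (- n).
  by rewrite opprD !opprK IH; apply; lia.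
exists (- n1) => n nn; split; first exact: cst.
have := e (n - 2); rewrite subrK (_ : n - 2 + 1 = n - 1); last by lia.
by rewrite !cst; lia.
Qed.

Theorem lc_shape : exists (h0 h1 h2 : int -> nat) (A : seq int),
  [/\ forall n, has_dim (tors n) (@null _ M) (h0 n),
      forall n, has_dim (secs n) (msecs n) (h1 n) &
      forall n, has_dim (GW n) (ims n) (h2 n)] /\
  [/\ exists N, forall n, n <= - N \/ N <= n -> h0 n = 0%N,
      exists N, forall n, N <= n -> h1 n = 0%N,
      exists N, forall n, n <= N -> h1 n = h1 N,
      forall n, h2 n = h2sum A n & macaulay_bound A h1].
Proof.
have sG n := gfam_subsp (cd_G cd) n; have sT n := gfam_subsp (gfam_tors cd) n.
have sI n := gfam_subsp (gfam_ims cd) n.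
have [s hs] := secs_finite cd hgens.
have [g [hg es]] := secs_gens cd hs.
have [h2 [hh2 [[N2 l2] e2]]] := h2_finite cd hgens hg.
have nullG n (v : M) : null v -> G n v by move=> ->; apply: subsp0.
have nullT n (v : M) : null v -> tors n v by move=> ->; apply: subsp0.
have nullM n (v : XY) : null v -> msecs n v by move=> ->; exact: (subsp0 (sM n)).
have MS := msecs_secs cd.
have TG n v : tors n v -> G n v by case.
have /choice [h0 hh0] : forall n, exists d, has_dim (tors n) (@null _ M) d.
  move=> n; have dG := generated_dim (cd_G cd) hgens (sN M) (nullG n).
  by have [d [_ [hd _ _]]] := has_dim_sub (sN M) (sT n) (sG n) (nullT n) (TG n) dG; exists d.
have /choice [h1 hh1] : forall n, exists d, has_dim (secs n) (msecs n) d.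
  move=> n.
  by have [_ [d [_ hd _]]] := has_dim_sub (sN XY) (sM n) (sS n) (nullM n) (MS n) (hs n); exists d.
have [lo hlo] : exists N, forall n, n <= N -> forall v, G n v -> v = 0.
  have [N hN] : exists N : int, forall e, e \in gens -> N <= e.1.
    elim: (gens) => [|e l [N hN]]; first by exists 0.
    exists (Num.min e.1 N) => f; rewrite inE ge_min => /orP[/eqP ->|/hN ->].
      by rewrite lexx.
    by rewrite orbT.
  exists (N - 1) => n nN v /(proj2 hgens n).
  rewrite (_ : allmons n gens = [::]) //.
  rewrite /allmons; elim: (gens) hN => //= e l IH hN; rewrite IH => [|f fl].
    by have := hN e (mem_head _ _); rewrite /mons => ?; rewrite mon_dim0 //; lia.
  by apply: hN; rewrite inE fl orbT.
have [L hL] := secs_small hs es.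
have g2 n : N2 + 2 <= n -> g n = 0%N.
  move=> hn; have := e2 (n - 2); rewrite subrK (_ : n - 2 + 1 = n - 1); last by lia.
  by rewrite !l2; lia.
have [A hA] := bounded_support_seq (fun n nL => proj2 (hL n nL)) g2.
exists h0, h1, h2, A; split; first by split.
split.
- have [N hN] := tors_vanish cd hgens.
  exists (Num.max (- lo) N) => n hn; apply: (has_dim_uniq (sN M) (hh0 n)); apply: has_dim0.
  move=> v tv; case: hn => hn; last by apply: (hN n) => //; lia.
  by apply: (hlo n) (TG _ _ tv); lia.
- have [N hN] := secs_large cd hgens; exists N => n nN.
  by apply: (has_dim_uniq (sM n) (hh1 n)); apply: has_dim0; apply: hN.
- exists (Num.min L lo).
  suff h n : n <= Num.min L lo -> h1 n = s L by move=> n nN; rewrite !h.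
  rewrite le_min => /andP[nL nlo]; rewrite -(proj1 (hL n nL)).
  apply: (has_dim_uniq (sM n) (hh1 n)); apply: eq_has_dim (hs n) => // w.
  split; first exact: nullM.
  move=> [v /(hlo n nlo) -> ->]; exact: klin0 (rlin_klin (rlin_d0 cd)).
- have [N' hN'] := h2sum_large A.
  apply: (@diff2_uniq _ _ g (Num.max N2 N')) => // [n|n|n].
  + by rewrite ge_max => /andP[/l2].
  + by rewrite ge_max => /andP[_ /hN'].
  + by rewrite h2sum_diff2 hA.
- exact: h1_macaulay hs hg hh1 hA.
Qed.

End Shape.

(** * Graded modules over k[x, y] *)

Section LC.
Variable k : fieldType.
Local Notation R := {mpoly k[2]}.
Local Notation x := (vx k).
Local Notation y := (vy k).

Section Link.
Variables (M : lmodType R) (G : int -> M -> Prop).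
Variable hG : gfam G.

Local Notation Mx := (locmod M x).
Local Notation My := (locmod M y).
Local Notation ax := (fun v : M => lfrac v 0 : Mx).
Local Notation ay := (fun v : M => lfrac v 0 : My).
Local Notation GX := (loc_grading G (f := x) 1).
Local Notation GY := (loc_grading G (f := y) 1).
Local Notation GW := (loc_grading G (f := x * y) 2).
Local Notation al := (loc_map y (x * y) : Mx -> locmod M (x * y)).
Local Notation be := (loc_map x (x * y) : My -> locmod M (x * y)).

Lemma lc_dim0 n d : has_dim (tors G ax ay n) (@null _ M) d -> lc_dim G n 0 = d.
Proof. exact: (vdimE (@subsp_null k M)). Qed.

Lemma lc_dim1 n d : has_dim (secs GX GY al be n) (msecs G ax ay n) d -> lc_dim G n 1 = d.
Proof. exact: (vdimE (gfam_subsp (gfam_msecs (cech_data_loc hG)) n)). Qed.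

Lemma lc_dim2 n d : has_dim (GW n) (ims GX GY al be n) d -> lc_dim G n 2 = d.
Proof. exact: (vdimE (gfam_subsp (gfam_ims (cech_data_loc hG)) n)). Qed.

Theorem lc_dim_shape gens : generated G gens -> exists A : seq int,
  [/\ exists N, forall n, n <= - N \/ N <= n -> lc_dim G n 0 = 0%N,
      exists N, forall n, N <= n -> lc_dim G n 1 = 0%N,
      exists N, forall n, n <= N -> lc_dim G n 1 = lc_dim G N 1,
      forall n, lc_dim G n 2 = h2sum A n & macaulay_bound A (fun n => lc_dim G n 1)].
Proof.
move=> hgens.
have [h0 [h1 [h2 [A [[e0 e1 e2] H]]]]] := lc_shape (cech_data_loc hG) hgens.
have E0 n : lc_dim G n 0 = h0 n := lc_dim0 (e0 n).
have E1 n : lc_dim G n 1 = h1 n := lc_dim1 (e1 n).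
have E2 n : lc_dim G n 2 = h2 n := lc_dim2 (e2 n).
exists A; case: H => [[N0 H0] [N1 H1] [N2 H2] H3 H4]; split.
- by exists N0 => n /H0; rewrite E0.
- by exists N1 => n /H1; rewrite E1.
- by exists N2 => n /H2; rewrite !E1.
- by move=> n; rewrite E2.
- by move=> n; have [E] := H4 n; rewrite -!E1; exists E.
Qed.

End Link.

Lemma mnm2_eq (m : 'X_{1..2}) : 'X_[m] = x ^+ (m ord0) * y ^+ (m ord_max) :> R.
Proof.
rewrite mpolyXE_id big_ord_recl big_ord_recl big_ord0 mulr1.
by congr (_ * 'X__ ^+ m _); apply: val_inj.
Qed.

Lemma mdeg2 (m : 'X_{1..2}) : mdeg m = (m ord0 + m ord_max)%N.
Proof.
rewrite mdegE big_ord_recl big_ord_recl big_ord0 addn0.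
by congr (_ + m _)%N; apply: val_inj.
Qed.

Lemma scale_mpolyE (V : lmodType R) (p : R) (v : V) :
  p *: v = \sum_(m <- msupp p) (p@_m)%:MP *: ('X_[m] *: v).
Proof.
rewrite {1}(mpolyE p) scaler_suml; apply: eq_bigr => m _.
by rewrite -mul_mpolyC scalerA.
Qed.

Lemma mon_in_mons (V : lmodType R) (c : int) (v : V) (m : 'X_{1..2}) :
  'X_[m] *: v \in mons (c + (mdeg m)%:Z) (c, v).
Proof.
have e : mon_dim (c + (mdeg m)%:Z) c = (mdeg m).+1 by rewrite /mon_dim; case: ifP; lia.
have im : (m ord0 < mon_dim (c + (mdeg m)%:Z) c)%N by rewrite e mdeg2; lia.
apply/(nthP 0); exists (m ord0 : nat); first by rewrite size_mons.
rewrite nth_mkseq //= /mon e /= mdeg2 mnm2_eq; congr ((_ * y ^+ _) *: _).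
by lia.
Qed.

Section Homogeneous.
Variables (M : lmodType R) (G : int -> M -> Prop).
Variable hG : is_grading G.

Lemma homog_x : (x : R) \is 1.-homog. Proof. by rewrite dhomogX /= mdeg1. Qed.
Lemma homog_y : (y : R) \is 1.-homog. Proof. by rewrite dhomogX /= mdeg1. Qed.
Lemma homog_C (c : k) : (c%:MP : R) \is 0.-homog.
Proof. by rewrite -[c%:MP]mulr1 mul_mpolyC; apply/dhomogZ/dhomog1. Qed.

Lemma grading_gfam : gfam G.
Proof.
have hN n v : G n v -> G n (- v).
  by move=> hv; rewrite -sub0r; apply: gradingB => //; apply: grading0.
split=> n; first split; first exact: grading0.
  move=> c u v hu hv; rewrite -[v]opprK; apply: gradingB => //; last exact: hN.
  by rewrite -[n]add0r; apply: gradingZ => //; apply: homog_C.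
move=> v hv; rewrite (addrC n 1); split; apply: (gradingZ hG (d := 1)) => //.
  exact: homog_x.
exact: homog_y.
Qed.

(** The homogeneous components of the generators generate [M], and every element is
a sum of homogeneous elements lying in the spans of monomial multiples; uniqueness of
homogeneous components then puts each [G n] in the span of its degree. *)
Lemma grading_generated : fin_gen M -> exists gens, generated G gens.
Proof.
move=> [s hs].
have hGf := grading_gfam.
have [gens [hg hsp]] : exists gens : seq (int * M),
    (forall g, g \in gens -> G g.1 g.2) /\
    forall v, v \in s -> exists c : nat -> R, v = \sum_(i < size gens) c i *: (nth (0, 0) gens i).2.
  elim: (s) => [|u t [gens [hg hsp]]]; first by exists [::].
  have [l [c [hc ->]]] := grading_sum hG u.
  exists ([seq (n, c n) | n <- l] ++ gens); split.
    by move=> g; rewrite mem_cat => /orP[/mapP[n _ ->]|/hg] //; apply: hc.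
  move=> v; rewrite inE => /orP[/eqP ->|/hsp[d ->]].
    exists (fun i => (i < size l)%N%:R).
    rewrite size_cat size_map big_split_ord /= [X in _ + X]big1 ?addr0 => [|i _]; last first.
      by rewrite ltnNge leq_addr scale0r.
    rewrite (big_nth 0) big_mkord; apply: eq_bigr => i _.
    by rewrite ltn_ord scale1r nth_cat size_map ltn_ord (nth_map 0).
  exists (fun i => if (size l <= i)%N then d (i - size l)%N else 0).
  rewrite size_cat size_map big_split_ord /= [X in X + _]big1 ?add0r => [|i _]; last first.
    by rewrite leqNgt ltn_ord scale0r.
  apply: eq_bigr => i _; rewrite leq_addr addKn nth_cat size_map.
  by rewrite ltnNge leq_addr addKn.
exists gens; split=> // n v hv.
pose A m := adjoins (@null _ M) (allmons m gens).
have sA m : subsp (A m) by apply: subsp_adjs; apply: subsp_null.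
have AG m w : A m w -> G m w.
  by apply: (adjs_allmons hGf) => // u ->; apply: grading0.
pose P w := exists l : seq (int * M), (forall e, e \in l -> A e.1 e.2) /\ w = \sum_(e <- l) e.2.
have PD u w : P u -> P w -> P (u + w).
  move=> [l [hl ->]] [l' [hl' ->]]; exists (l ++ l'); rewrite big_cat; split=> // e.
  by rewrite mem_cat => /orP[/hl|/hl'].
have P0 : P 0 by exists [::]; rewrite big_nil.
have PA m w : A m w -> P w.
  by move=> h; exists [:: (m, w)]; rewrite big_seq1; split=> // e; rewrite inE => /eqP ->.
have Pgen (p : R) g : g \in gens -> P (p *: g.2).
  move=> gg; rewrite scale_mpolyE; apply: (big_ind P) => // m _.
  apply: (PA (g.1 + (mdeg m)%:Z)); apply: subspZ => //; apply: adjs_mem.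
    exact: subsp_null.
  apply/flattenP; exists (mons (g.1 + (mdeg m)%:Z) g); first exact: map_f.
  by have := mon_in_mons g.1 g.2 m; case: g {gg}.
have [l [hl ev]] : P v.
  have /asboolP[c ->] := hs v; apply: (big_ind P) => // i _.
  have [|d ->] := hsp (s`_i); first exact: mem_nth.
  rewrite scaler_sumr; apply: (big_ind P) => // j _; rewrite scalerA.
  by apply: Pgen; apply: mem_nth.
(* C d collects the terms of degree d in the decomposition of v *)
pose C d := \sum_(e <- l | e.1 == d) e.2.
have CA d : A d (C d).
  rewrite /C big_seq_cond; apply: subsp_sum => // e /andP[/hl he /eqP <-].
  exact: he.
pose ds := undup (n :: map fst l).
have nds : n \in ds by rewrite mem_undup mem_head.
have sumC : \sum_(d <- ds) C d = v.
  rewrite ev /C (exchange_big_dep xpredT) //= big_seq [RHS]big_seq; apply: eq_bigr => e el.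
  rewrite -big_filter (_ : [seq i <- ds | e.1 == i] = [:: e.1]) ?big_seq1 //.
  rewrite (@eq_filter _ _ (pred1 e.1)) => [|i]; last by rewrite /= eq_sym.
  rewrite filter_pred1_uniq ?undup_uniq // mem_undup inE map_f ?orbT //.
have := grading_direct hG (s := ds) (c := fun d => C d - (if d == n then v else 0)).
move/(_ (undup_uniq _)) => h.
suff : C n - v = 0 by move/eqP; rewrite subr_eq0 => /eqP <-; exact: CA.
have := h _ _ n nds; rewrite eqxx; apply.
  move=> d; have Gd := AG d _ (CA d); apply: gradingB => //.
  by case: eqP => [->|_] //; apply: grading0.
rewrite sumrB sumC -big_mkcond -big_filter filter_pred1_uniq ?undup_uniq //.
by rewrite big_seq1 subrr.
Qed.

End Homogeneous.
End LC.

(** * Powers of the maximal ideal and quotients of R *)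

Section Polynomials.
Variable k : fieldType.
Local Notation R := {mpoly k[2]}.
Local Notation x := (vx k).
Local Notation y := (vy k).

Lemma mcoeff_XM (i : 'I_2) (q : R) (m : 'X_{1..2}) : m i = 0%N -> ('X_i * q)@_m = 0.
Proof.
move=> mi; apply: memN_msupp_eq0; rewrite mulrC (perm_mem (msuppMX _ _)).
by apply/mapP => -[m' _ em]; move: mi; rewrite em mnmDE mnm1E eqxx.
Qed.

Lemma div_X (i : 'I_2) (r : R) : (forall m, m \in msupp r -> (0 < m i)%N) ->
  exists q, r = 'X_i * q.
Proof.
move=> h; exists (\sum_(m <- msupp r) r@_m *: 'X_[m - U_(i)]).
rewrite {1}(mpolyE r) mulr_sumr big_seq [RHS]big_seq; apply: eq_bigr => m /h mi.
rewrite -scalerAr -mpolyXD addmC submK //.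
by apply/mnm_lepP => j; rewrite mnm1E; case: eqP => // <-.
Qed.

Lemma x_neq0 : x != 0. Proof. by rewrite -msupp_eq0 msuppX. Qed.
Lemma y_neq0 : y != 0. Proof. by rewrite -msupp_eq0 msuppX. Qed.

Lemma div_x1 (u v : R) : y * u = x * v -> exists r, u = x * r.
Proof.
move=> e; apply: div_X => m; rewrite mcoeff_msupp lt0n => um.
apply: contra um => /eqP m0; rewrite -(mcoeffMX u U_(ord_max) m) mulrC.
by rewrite [_ * u]e mcoeff_XM // mnmDE mnm1E m0.
Qed.

Lemma div_x t (u v : R) : y ^+ t * u = x * v -> exists r, u = x * r.
Proof.
elim: t v => [|t IH] v; first by rewrite mul1r => ->; exists v.
by rewrite exprS -mulrA => /div_x1[r /IH].
Qed.

(** Powers of [x] and [y] are coprime. *)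
Lemma div_xs s t (u v : R) : y ^+ t * u = x ^+ s * v ->
  exists r, u = x ^+ s * r /\ v = y ^+ t * r.
Proof.
elim: s u v => [|s IH] u v; first by rewrite mul1r => <-; exists u; rewrite mul1r.
rewrite exprS -mulrA => e; have [r er] := div_x e.
move: e; rewrite er mulrCA => /(mulfI x_neq0)/IH[r' [-> ->]].
by exists r'; rewrite mulrA.
Qed.

Lemma ring_gradingP n (p : R) :
  ring_grading n p <-> forall m, m \in msupp p -> (mdeg m)%:Z = n.
Proof.
case: n => d /=; first by split=> [/dhomogP h m /h -> //|h]; apply/dhomogP => m /h [].
split=> [-> m|h]; first by rewrite msupp0.
by apply/eqP; rewrite -msupp_eq0; case: (msupp p) h => // m s /(_ m); rewrite mem_head => /(_ isT).
Qed.

Lemma ring_gfam : gfam (@ring_grading k).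
Proof.
have mulX (i : 'I_2) n (p : R) : ring_grading n p -> ring_grading (n + 1) ('X_i * p).
  move=> /ring_gradingP h; apply/ring_gradingP => m.
  rewrite mulrC (perm_mem (msuppMX _ _)) => /mapP[m' /h <- ->].
  by rewrite mdegD mdeg1; lia.
split=> n; last by move=> v hv; split; apply: mulX.
split; first by apply/ring_gradingP => m; rewrite msupp0.
move=> c u v /ring_gradingP hu /ring_gradingP hv; apply/ring_gradingP => m.
rewrite [_ *: _]mul_mpolyC => /msuppD_le; rewrite mem_cat => /orP[/msuppZ_le|]; auto.
Qed.

Lemma ring_grading_neg n (p : R) : n < 0 -> ring_grading n p -> p = 0.
Proof. by case: n => d // _. Qed.

Lemma ring_grading1 : ring_grading 0 (1 : R).
Proof. exact: dhomog1. Qed.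

Lemma ring_grading_divx s n (r : R) : ring_grading (n + s%:Z) (x ^+ s * r) -> ring_grading n r.
Proof.
move=> /ring_gradingP h; apply/ring_gradingP => m mr.
have := h (U_(ord0) *+ s + m)%MM; rewrite mpolyXn mulrC (perm_mem (msuppMX _ _)).
by rewrite map_f // mdegD mdegMn mdeg1 => /(_ isT); lia.
Qed.

Lemma ring_expand n (p : R) : ring_grading n p ->
  adjoins (@null _ R^o) (mons n (0 : int, 1 : R^o)) p.
Proof.
move=> /ring_gradingP h.
have sA := subsp_adjs (mons n (0 : int, 1 : R^o)) (@subsp_null k R^o).
have -> : p = p *: (1 : R^o) by rewrite /GRing.scale /= mulr1.
rewrite scale_mpolyE big_seq; apply: subsp_sum => // m /h mn; apply: subspZ => //.
apply: adjs_mem; first exact: subsp_null.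
by have := @mon_in_mons k R^o 0 1 m; rewrite add0r mn.
Qed.

Lemma mon_dim_nat (d : nat) : mon_dim d%:Z 0 = d.+1.
Proof. by rewrite /mon_dim subr0. Qed.

(** The monomials of degree [n] form a basis of R_n. *)
Lemma ring_dim n : has_dim (@ring_grading k n) (@null _ R^o) (mon_dim n 0).
Proof.
have [n0|] := ltP n 0; first by rewrite mon_dim0 //; apply: has_dim0 => v; apply: ring_grading_neg.
case: n => // d _; rewrite mon_dim_nat.
pose mm (i : 'I_d.+1) : 'X_{1..2} := (U_(ord0) *+ i + U_(ord_max) *+ (d - i))%MM.
have eM (i : 'I_d.+1) : x ^+ i * y ^+ (d - i) = 'X_[mm i] :> R.
  by rewrite mpolyXD !mpolyXn.
have mE (i j : 'I_d.+1) : (mm i == mm j) = (i == j).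
  apply/eqP/eqP => [e|-> //]; apply: val_inj => /=.
  by have := congr1 (fun m : 'X_{1..2} => m ord0) e; rewrite !mnmDE !mulmnE !mnm1E /= !mul0n !addn0 !mul1n.
exists (fun i => x ^+ i * y ^+ (d - i)); split.
- move=> i; apply/ring_gradingP => m; rewrite eM msuppX inE => /eqP ->.
  by rewrite mdegD !mdegMn !mdeg1; have := ltn_ord i; lia.
- move=> c; rewrite /null => e i.
  have := congr1 (fun p : R => p@_(mm i)) e.
  rewrite raddf_sum (bigD1 i) //= big1 ?addr0 => [|j ji].
    by rewrite [_ *: _]mul_mpolyC mcoeffZ eM mcoeffX eqxx mulr1 mcoeff0.
  by rewrite [_ *: _]mul_mpolyC mcoeffZ eM mcoeffX mE (negPf ji) mulr0.
- move=> z /ring_expand.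
  pose P (w : R^o) := exists c : 'I_d.+1 -> k, null (w - \sum_i (c i)%:MP *: (x ^+ i * y ^+ (d - i) : R^o)).
  move: z; change (forall z, adjoins (@null _ R^o) (mons d (0 : int, 1 : R^o)) z -> P z).
  apply: adjs_min.
  + split; first by exists (fun=> 0); rewrite big1 ?subrr // => i _; rewrite mpolyC0 scale0r.
    move=> c u v [cu /eqP hu] [cv /eqP hv]; exists (fun i => c * cu i + cv i).
    move: hu hv; rewrite !subr_eq0 => /eqP -> /eqP ->; rewrite /null scaler_sumr -big_split /=.
    apply/eqP; rewrite subr_eq0; apply/eqP/eq_bigr => i _.
    by rewrite mpolyCD mpolyCM scalerDl scalerA.
  + by move=> v ->; exists (fun=> 0); rewrite big1 ?subrr // => i _; rewrite mpolyC0 scale0r.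
  + move=> v /(nthP 0)[i]; rewrite size_mons => id <-; rewrite nth_mkseq //.
    have e := mon_dim_nat d.
    rewrite /= e in id *; exists (fun j => (j == Ordinal id)%:R).
    rewrite (bigD1 (Ordinal id)) //= big1 => [|j /negPf ->]; last by rewrite mpolyC0 scale0r.
    rewrite eqxx mpolyC1 scale1r addr0 /mon e /=.
    by rewrite [_ *: _]mulr1 /null subrr.
Qed.

Lemma has_dim_eqZ (V : lmodType R) (Z B B' : V -> Prop) d : subsp Z ->
  (forall v, Z v -> (B v <-> B' v)) -> has_dim Z B d -> has_dim Z B' d.
Proof.
move=> hZ h; apply: (has_dim_rel (Rel := eq)) => //.
- by move=> c u u' v v' -> ->.
- by move=> z zz; exists z.
- by move=> z zz; exists z.
- by move=> z w zz _ <-; apply: h.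
Qed.

Lemma submod_mem (V : lmodType R) (s : seq V) v : v \in s -> v \in submod s.
Proof.
move=> /(nthP 0)[i hi <-]; apply/asboolP; exists (fun j => (j == Ordinal hi)%:R).
rewrite (bigD1 (Ordinal hi)) //= eqxx scale1r big1 ?addr0 // => j /negPf ->.
by rewrite scale0r.
Qed.

Local Notation mp t := (@max_pow_gens k t).

Lemma max_pow_mul t (p : R^o) : p \in submod (mp t) ->
  (x *: p \in submod (mp t.+1)) /\ (y *: p \in submod (mp t.+1)).
Proof.
move=> /asboolP[c ->]; rewrite !scaler_sumr.
split; apply: rpred_sum => i _; rewrite scale_comm; apply: rpredZ; apply: submod_mem.
  by apply/allpairsP; exists (x, (mp t)`_i); split; rewrite ?mem_head ?mem_nth.
by apply/allpairsP; exists (y, (mp t)`_i); split; rewrite ?inE ?eqxx ?orbT ?mem_nth.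
Qed.

Lemma max_pow_mon t i j : (t <= i + j)%N -> (x ^+ i * y ^+ j : R^o) \in submod (mp t).
Proof.
elim: t i j => [|t IH] i j h.
  rewrite -[_ * _]mulr1; apply: (rpredZ (x ^+ i * y ^+ j : R)).
  by apply: submod_mem; rewrite inE.
case: i h => [|i] h.
  case: j h => // j h; rewrite exprS mulrCA.
  by apply: (proj2 (max_pow_mul (IH 0%N j _))).
by rewrite exprS -mulrA; apply: (proj1 (max_pow_mul (IH i j _))).
Qed.

Lemma max_pow_supp t (p : R^o) m : p \in submod (mp t) -> m \in msupp (p : R) -> (t <= mdeg m)%N.
Proof.
have hom (q : R^o) : q \in mp t -> ring_grading t%:Z q.
  elim: t q => [|t IH] q; first by rewrite inE => /eqP ->; apply: ring_grading1.
  have -> : t.+1%:Z = t%:Z + 1 by lia.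
  move=> /allpairsP[[a b]]; rewrite /fst /snd => -[ha /IH hb ->].
  move: ha; rewrite !inE => /orP[] /eqP ->; [exact: gfam_x ring_gfam _ _ hb|exact: gfam_y ring_gfam _ _ hb].
move=> /asboolP[c ->]; rewrite mcoeff_msupp raddf_sum leqNgt => /eqP nz; apply/negP => lt.
apply: nz; apply: big1 => i _ /=.
have /hom /ring_gradingP hi : (mp t)`_i \in mp t by apply: mem_nth.
rewrite mcoeffM big1 // => -[m1 m2] /= /eqP em.
rewrite (memN_msupp_eq0 (p := (mp t)`_i)) ?mulr0 //; apply/negP => /hi [h2].
by move: lt; rewrite em mdegD h2 ltnNge leq_addl.
Qed.

Lemma max_pow_large t n (p : R^o) : t%:Z <= n -> ring_grading n p -> p \in submod (mp t).
Proof.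
move=> tn /ring_gradingP h; have -> : p = (p : R) *: (1 : R^o) by rewrite [RHS]mulr1.
rewrite scale_mpolyE big_seq; apply: rpred_sum => m /h mn; apply: rpredZ.
rewrite mnm2_eq [_ *: _]mulr1; apply: max_pow_mon.
by have := mdeg2 m; lia.
Qed.

(** The Hilbert function of R/m^t. *)
Definition artin_dim (t : nat) (n : int) : nat := if n < t%:Z then mon_dim n 0 else 0%N.

Lemma max_pow_dim t n : has_dim (@ring_grading k n) (fun p : R^o => p \in submod (mp t)) (artin_dim t n).
Proof.
rewrite /artin_dim; case: ltP => tn; last by apply: has_dim0 => p; apply: max_pow_large.
apply: has_dim_eqZ (ring_dim n); first exact: gfam_subsp ring_gfam n.
move=> p /ring_gradingP h; split=> [->|ps]; first exact: rpred0.
apply/eqP; rewrite -msupp_eq0; move: (@max_pow_supp t p) h; case: (msupp (p : R)) => // m s h1 h2.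
have := h1 m ps (mem_head _ _); have := h2 m (mem_head _ _); lia.
Qed.

Lemma klin_to_quotmod (s : seq R^o) : klin (to_quotmod s : R^o -> quotmod s).
Proof. by move=> c u v; rewrite to_quotmodD -to_quotmodZ. Qed.

Lemma to_quotmod_eq0 (s : seq R^o) v : to_quotmod s v = 0 <-> v \in submod s.
Proof.
rewrite -(klin0 (@klin_to_quotmod s)).
by split=> [/to_quotmodP|h]; [rewrite subr0|apply/to_quotmodP; rewrite subr0].
Qed.

Lemma to_quotmod_lin (s : seq R^o) (c : R) v : to_quotmod s (c *: v) = c *: to_quotmod s v.
Proof. by rewrite -to_quotmodZ. Qed.

Lemma quot_gfam (s : seq R^o) (G := quot_grading (@ring_grading k) (s := s)) : gfam G.
Proof.
split=> n; first split.
- exists 0; first exact: subsp0 (gfam_subsp ring_gfam n).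
  by rewrite (klin0 (@klin_to_quotmod s)).
- move=> c _ _ [u hu ->] [v hv ->]; exists (c%:MP *: u + v); last by rewrite klin_to_quotmod.
  exact: subsp_lin (gfam_subsp ring_gfam n) _ _ _ hu hv.
- by move=> _ [v /(gfam_xy ring_gfam)[h1 h2] ->]; rewrite -!to_quotmod_lin; split; eexists; try reflexivity.
Qed.

Lemma quot_dim (s : seq R^o) n d : has_dim (@ring_grading k n) (fun p : R^o => p \in submod s) d ->
  has_dim (quot_grading (@ring_grading k) (s := s) n) (@null _ (quotmod s)) d.
Proof.
refine (proj1 (has_dim_iso (@klin_to_quotmod s) (gfam_subsp ring_gfam n)
  (gfam_subsp (quot_gfam s) n) (@subsp_null k _) _ _ _ d)).
- by move=> v hv; exists v.
- by move=> v _; apply: to_quotmod_eq0.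
- by move=> _ [v hv ->]; exists v => //; rewrite /null subrr.
Qed.

End Polynomials.

(** * Local cohomology of modules of rank at most one *)

Section RankOne.
Variable k : fieldType.
Local Notation R := {mpoly k[2]}.
Local Notation x := (vx k).
Local Notation y := (vy k).
Variables (M X Y W : lmodType R) (G : int -> M -> Prop).
Variables (GX : int -> X -> Prop) (GY : int -> Y -> Prop) (GW : int -> W -> Prop).
Variables (a : M -> X) (b : M -> Y) (al : X -> W) (be : Y -> W).
Variable cd : cech_data G GX GY GW a b al be.

Local Notation XY := (X * Y)%type.
Local Notation secs := (secs GX GY al be).
Local Notation msecs := (msecs G a b).
Local Notation ims := (ims GX GY al be).
Local Notation tors := (tors G a b).

(** [M] is a graded ideal of R(s), embedded by [f], that contains all multiples of
[x ^+ T] and [y ^+ T]. The localizations do not distinguish it from R(s), so its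
sections are those of R(s). *)
Section Ideal.
Variables (f : M -> R^o) (s : int) (T : nat).
Variable f_lin : rlin f.
Variable f_inj : forall v, f v = 0 -> v = 0.
Variable f_graded : forall n v, G n v <-> ring_grading (s + n) (f v).
Variable f_x : forall r : R, exists v, f v = x ^+ T * r.
Variable f_y : forall r : R, exists v, f v = y ^+ T * r.

Lemma ideal_Z (c : R) v : f (c *: v) = c * f v. Proof. exact: rlinZ f_lin. Qed.

Lemma ideal_regular t (v : M) : x ^+ t *: v = 0 \/ y ^+ t *: v = 0 -> v = 0.
Proof.
have f0 : f 0 = 0 := klin0 (rlin_klin f_lin).
move=> h; apply: f_inj; have : x ^+ t * f v = 0 \/ y ^+ t * f v = 0.
  by case: h => h; [left|right]; rewrite -ideal_Z h.
by case=> /eqP; rewrite mulf_eq0 expf_eq0 ?(negPf (x_neq0 k)) ?(negPf (y_neq0 k)) andbF => /eqP.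
Qed.

Lemma ideal_a0 v : a v = 0 -> v = 0.
Proof. by move=> /(cd_kera cd)[t h]; apply: (@ideal_regular t); left. Qed.

Lemma ideal_inj u v : f u = f v -> u = v.
Proof.
move=> e; apply/eqP; rewrite -subr_eq0; apply/eqP/f_inj.
by rewrite (klinB (rlin_klin f_lin)) e subrr.
Qed.

Lemma ideal_tors n : has_dim (tors n) (@null _ M) 0.
Proof. by apply: has_dim0 => v [_ [/ideal_a0 h _]]. Qed.

(** [w] is the section [(r, r)] of R(s), written with the denominators [x ^+ T] and
[y ^+ T] because [r] itself need not lie in [M]. *)
Definition ideal_rel (r : R^o) (w : XY) : Prop := exists v v',
  [/\ f v = x ^+ T * r, f v' = y ^+ T * r, x ^+ T *: w.1 = a v & y ^+ T *: w.2 = b v'].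

Lemma ideal_rel0 : ideal_rel 0 0.
Proof.
exists 0, 0; rewrite !mulr0 (klin0 (rlin_klin f_lin)) !scaler0.
by rewrite (klin0 (rlin_klin (cd_a cd))) (klin0 (rlin_klin (cd_b cd))).
Qed.

Lemma ideal_rel_lin (c : k) u u' v v' : ideal_rel u u' -> ideal_rel v v' -> ideal_rel (c%:MP *: u + v) (c%:MP *: u' + v').
Proof.
move=> [p [q [e1 e2 e3 e4]]] [p' [q' [e1' e2' e3' e4']]].
exists (c%:MP *: p + p'), (c%:MP *: q + q').
split; rewrite ?f_lin ?(cd_a cd) ?(cd_b cd) ?e1 ?e2 ?e1' ?e2' -?e3 -?e4 -?e3' -?e4'.
- by rewrite [X in X + _]mulrCA -mulrDr.
- by rewrite [X in X + _]mulrCA -mulrDr.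
- by rewrite scalerDr scale_comm.
- by rewrite scalerDr scale_comm.
Qed.

Lemma ideal_total n (r : R^o) : ring_grading (s + n) r -> exists2 w, secs n w & ideal_rel r w.
Proof.
move=> hr; have [v ev] := f_x r; have [v' ev'] := f_y r.
have gv : G (n + T%:Z) v.
  by apply/f_graded; rewrite addrA ev; apply: (gfam_xs (ring_gfam k) T hr).
have gv' : G (n + T%:Z) v'.
  by apply/f_graded; rewrite addrA ev'; apply: (gfam_ys (ring_gfam k) T hr).
have [p gp ep] := divX_iter cd (cd_ga cd gv); have [q gq eq] := divY_iter cd (cd_gb cd gv').
exists (p, q); last by exists v, v'.
split=> //; apply/eqP; rewrite /diff1 /= subr_eq0; apply/eqP.
apply: (eq_of_inj (c := y ^+ T)); first by move=> w; exact: inj_iter (cd_yW cd).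
apply: (eq_of_inj (c := x ^+ T)); first by move=> w; exact: inj_iter (cd_xW cd).
rewrite -(rlinZ _ _ (cd_be cd)) -eq -(cd_comm cd) [RHS]scale_comm.
rewrite -(rlinZ (x ^+ T) p (cd_al cd)) -ep -!(rlinZ _ _ (cd_al cd)) -!(rlinZ _ _ (cd_a cd)).
by congr (al (a _)); apply: ideal_inj; rewrite !ideal_Z ev ev' mulrCA.
Qed.

Lemma ideal_onto n w : secs n w -> exists2 r : R^o, ring_grading (s + n) r & ideal_rel r w.
Proof.
case: w => p q [[/= gp gq] e].
have [i [u [gu eu]]] := cd_denX cd gp; have [j [u' [gu' eu']]] := cd_denY cd gq.
have epq : be q = al p by move/eqP: e; rewrite /diff1 /= subr_eq0 => /eqP.
have [r [er er']] : exists r, f u = x ^+ i * r /\ f u' = y ^+ j * r.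
  apply: div_xs; rewrite -!ideal_Z; congr f; apply/eqP; rewrite -subr_eq0; apply/eqP.
  have : al (a (y ^+ j *: u - x ^+ i *: u')) = 0.
    rewrite (klinB (rlin_klin (cd_a cd))) (klinB (rlin_klin (cd_al cd))).
    rewrite !(rlinZ _ _ (cd_a cd)) !(rlinZ _ _ (cd_al cd)) (cd_comm cd u') -eu -eu'.
    by rewrite (rlinZ _ _ (cd_al cd)) (rlinZ _ _ (cd_be cd)) epq scale_comm subrr.
  move=> /(cd_keral cd)[t]; rewrite -(rlinZ _ _ (cd_a cd)) => /ideal_a0 h.
  by apply: (@ideal_regular t); right.
exists r.
  by apply: (@ring_grading_divx _ i); rewrite -addrA -er; apply/f_graded.
have [v ev] := f_x r; have [v' ev'] := f_y r; exists v, v'; split=> //=.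
  apply: (eq_of_inj (c := x ^+ i)); first by move=> w; exact: inj_iter (cd_xX cd).
  rewrite scale_comm eu -!(rlinZ _ _ (cd_a cd)); congr a; apply: ideal_inj.
  by rewrite !ideal_Z er ev mulrCA.
apply: (eq_of_inj (c := y ^+ j)); first by move=> w; exact: inj_iter (cd_yY cd).
rewrite scale_comm eu' -!(rlinZ _ _ (cd_b cd)); congr b; apply: ideal_inj.
by rewrite !ideal_Z er' ev' mulrCA.
Qed.

Lemma ideal_secs n : has_dim (secs n) (@null _ XY) (mon_dim (s + n) 0).
Proof.
apply: (has_dim_rel ideal_rel0 ideal_rel_lin _ _ (@ideal_total n) (@ideal_onto n) _ (ring_dim k (s + n))).
- exact: gfam_subsp (ring_gfam k) _.
- exact: gfam_subsp (gfam_secs cd) n.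
- move=> r [p q] _ _ [v [v' [ev ev' /= ep eq]]]; split=> [r0|[p0 _]].
    have v0 : v = 0 by apply: f_inj; rewrite ev r0 mulr0.
    have v0' : v' = 0 by apply: f_inj; rewrite ev' r0 mulr0.
    congr (_, _).
      by apply: (inj_iter (cd_xX cd) (t := T)); rewrite ep v0 (klin0 (rlin_klin (cd_a cd))).
    by apply: (inj_iter (cd_yY cd) (t := T)); rewrite eq v0' (klin0 (rlin_klin (cd_b cd))).
  have v0 : v = 0 by apply: ideal_a0; rewrite -ep p0 scaler0.
  move/eqP: ev; rewrite v0 (klin0 (rlin_klin f_lin)) eq_sym mulf_eq0 expf_eq0.
  by rewrite (negPf (x_neq0 k)) andbF => /eqP.
Qed.

Lemma ideal_h1 n d :
  has_dim (@ring_grading k (s + n)) (fun r : R^o => exists v, r = f v) d ->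
  has_dim (secs n) (msecs n) d.
Proof.
apply: (has_dim_rel ideal_rel0 ideal_rel_lin _ _ (@ideal_total n) (@ideal_onto n)).
- exact: gfam_subsp (ring_gfam k) _.
- exact: gfam_subsp (gfam_secs cd) n.
- move=> r [p q] gr _ [v [v' [ev ev' /= ep eq]]]; split=> [[m em]|[m gm [em em']]].
    exists m; first by apply/f_graded; rewrite -em.
    have v1 : v = x ^+ T *: m by apply: ideal_inj; rewrite ev ideal_Z em.
    have v2 : v' = y ^+ T *: m by apply: ideal_inj; rewrite ev' ideal_Z em.
    congr (_, _).
      apply: (eq_of_inj (c := x ^+ T)); first by move=> w; exact: inj_iter (cd_xX cd).
      by rewrite ep v1 (rlinZ _ _ (cd_a cd)).
    apply: (eq_of_inj (c := y ^+ T)); first by move=> w; exact: inj_iter (cd_yY cd).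
    by rewrite eq v2 (rlinZ _ _ (cd_b cd)).
  exists m; apply: (mulfI (x := x ^+ T)); first by rewrite expf_eq0 (negPf (x_neq0 k)) andbF.
  rewrite -ev -ideal_Z; congr f; apply/eqP; rewrite -subr_eq0; apply/eqP/ideal_a0.
  by rewrite (klinB (rlin_klin (cd_a cd))) (rlinZ _ _ (cd_a cd)) -ep em subrr.
Qed.

Lemma ideal_h2 gens n : generated G gens -> has_dim (GW n) (ims n) (h2sum [:: - s] n).
Proof.
move=> hgens.
have [g [hg es]] := secs_gens cd ideal_secs.
have [h2 [hh2 [[N2 l2] e2]]] := h2_finite cd hgens hg.
have [N' hN'] := h2sum_large [:: - s].
suff -> : h2sum [:: - s] n = h2 n by [].
apply: (@diff2_uniq _ _ g (Num.max N2 N')) => // [m|m|m].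
- by rewrite ge_max => /andP[_ /hN'].
- by rewrite ge_max => /andP[/l2].
- have := es m; rewrite h2sum_diff2 /=.
  have -> : g (m + 2) = (- s == m + 2)%R.
    by have := es m; rewrite /mon_dim; case: eqP; do 3 case: ifP; lia.
  by rewrite addn0.
Qed.

End Ideal.

Lemma y_killed_W n z : (forall v : M, y *: v = 0) -> GW n z -> z = 0.
Proof.
move=> ky /(cd_denW cd)[t [v [_ e]]].
apply: (inj_iter (cd_yW cd) (t := t.+1)); apply: (inj_iter (cd_xW cd) (t := t)).
rewrite exprS -scalerA scale_comm e -(rlinZ _ _ (cd_al cd)) -(rlinZ _ _ (cd_a cd)).
by rewrite ky (klin0 (rlin_klin (cd_a cd))) (klin0 (rlin_klin (cd_al cd))).
Qed.

Lemma y_killed_Y n p : (forall v : M, y *: v = 0) -> GY n p -> p = 0.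
Proof.
move=> ky /(cd_denY cd)[t [v [_ e]]]; apply: (inj_iter (cd_yY cd) (t := t.+1)).
by rewrite exprS -scalerA e -(rlinZ _ _ (cd_b cd)) ky (klin0 (rlin_klin (cd_b cd))).
Qed.

Lemma y_killed_h2 n : (forall v : M, y *: v = 0) -> has_dim (GW n) (ims n) 0.
Proof.
move=> ky; apply: has_dim0 => z /(y_killed_W ky) ->.
exact: (subsp0 (gfam_subsp (gfam_ims cd) n)).
Qed.

Section Residue.
Variable kx : forall v : M, x *: v = 0.
Variable ky : forall v : M, y *: v = 0.

Lemma x_killed_X n p : GX n p -> p = 0.
Proof.
move=> /(cd_denX cd)[t [v [_ e]]]; apply: (inj_iter (cd_xX cd) (t := t.+1)).
by rewrite exprS -scalerA e -(rlinZ _ _ (cd_a cd)) kx (klin0 (rlin_klin (cd_a cd))).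
Qed.

Lemma residue_tors n d : has_dim (G n) (@null _ M) d -> has_dim (tors n) (@null _ M) d.
Proof.
apply: eq_has_dim => // v; split=> [hv|[]//]; split=> //.
by congr (_, _); [exact: x_killed_X (cd_ga cd hv)|exact: y_killed_Y ky (cd_gb cd hv)].
Qed.

Lemma residue_h1 n : has_dim (secs n) (msecs n) 0.
Proof.
apply: has_dim0 => -[p q] [[/= /x_killed_X -> /(y_killed_Y ky) ->] _].
exact: (subsp0 (gfam_subsp (gfam_msecs cd) n)).
Qed.

End Residue.

(** The shifts of [k[x]]: [y] acts as zero, and [M] is free over [k[x]] on a
generator [e] of degree [-s]. *)
Section Line.
Variables (s : int) (e : M).
Variable ky : forall v : M, y *: v = 0.
Variable ge : G (- s) e.
Variable e_free : forall (c : k) t, x ^+ t *: (c%:MP *: e) = 0 -> c = 0.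
Variable e_neg : forall n v, s + n < 0 -> G n v -> v = 0.
Variable e_span : forall (t : nat) n v, s + n = t%:Z -> G n v -> exists c : k, v = x ^+ t *: (c%:MP *: e).

Lemma line_ae_free (c : k) : a (c%:MP *: e) = 0 -> c = 0.
Proof. by move=> /(cd_kera cd)[t /e_free]. Qed.

Lemma line_tors n : has_dim (tors n) (@null _ M) 0.
Proof.
apply: has_dim0 => v [gv [av _]]; have [|] := ltP (s + n) 0; first by move=> /e_neg; apply.
case en : (s + n) => [t|t] // _; have [c ev] := e_span en gv.
have [t' h] := cd_kera cd av; rewrite ev in h *.
have -> : c = 0 by apply: (e_free (t := (t' + t)%N)); rewrite exprD -scalerA.
by rewrite mpolyC0 scale0r scaler0.
Qed.

Lemma line_h1 n : has_dim (secs n) (msecs n) (s + n < 0)%R.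
Proof.
have [n0|n0] := ltP (s + n) 0; last first.
  case en : (s + n) n0 => [d|//] _.
  apply: has_dim0 => -[p q] [[/= gp /(y_killed_Y ky) ->] _].
  have [t [v [gv ev]]] := cd_denX cd gp.
  have [|c ec] := e_span (t := (d + t)%N) _ gv; first by rewrite addrA en.
  exists (x ^+ d *: (c%:MP *: e)).
    rewrite (_ : n = - s + d%:Z); last by lia.
    by apply: gfam_xs (cd_G cd) _ _ _ (subspZ (gfam_subsp (cd_G cd) _) _ ge).
  congr (_, _); last first.
    apply/esym/(y_killed_Y (n := n) ky)/(cd_gb cd); rewrite (_ : n = - s + d%:Z); last by lia.
    by apply: gfam_xs (cd_G cd) _ _ _ (subspZ (gfam_subsp (cd_G cd) _) _ ge).
  apply: (eq_of_inj (c := x ^+ t)); first by move=> w; exact: inj_iter (cd_xX cd).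
  by rewrite ev ec -(rlinZ _ _ (cd_a cd)) addnC exprD -scalerA.
have [T eT] : exists T : nat, n + T%:Z = - s by exists (absz (- s - n)); lia.
have [|p0 gp0 ep0] := divX_iter cd (n := n) (t := T) (p := a e).
  by rewrite eT; apply: (cd_ga cd).
have y0 : GY n 0 by exact: (subsp0 (gfam_subsp (cd_GY cd) n)).
exists (fun=> (p0, 0)); split.
- move=> _; split; first by [].
  by rewrite /diff1 /= (klin0 (rlin_klin (cd_be cd))) sub0r (y_killed_W ky (cd_gal cd gp0)) oppr0.
- move=> c; rewrite big_ord_recl big_ord0 addr0 => -[v /(e_neg n0) ->].
  rewrite /diff0 (klin0 (rlin_klin (cd_a cd))) => -[cp _] i; rewrite ord1.
  by apply: line_ae_free; rewrite (rlinZ _ _ (cd_a cd)) ep0 scale_comm cp scaler0.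
- move=> [p q] [[/= gp /(y_killed_Y ky) ->] _].
  have [t [v [gv ev]]] := cd_denX cd gp.
  suff [c ->] : exists c : k, p = c%:MP *: p0.
    exists (fun=> c); rewrite big_ord_recl big_ord0 addr0.
    have -> : (c%:MP *: p0, 0) - c%:MP *: ((p0, 0) : XY) = 0.
      by congr (_, _) => /=; rewrite ?scaler0 subrr.
    exact: (subsp0 (gfam_subsp (gfam_msecs cd) n)).
  have [n1|] := ltP (s + (n + t%:Z)) 0.
    exists 0; rewrite mpolyC0 scale0r; apply: (inj_iter (cd_xX cd) (t := t)).
    by rewrite ev (e_neg n1 gv) (klin0 (rlin_klin (cd_a cd))).
  case en : (s + (n + t%:Z)) => [d|//] _; have [c ec] := e_span en gv.
  exists c; apply: (eq_of_inj (c := x ^+ t)); first by move=> w; exact: inj_iter (cd_xX cd).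
  rewrite ev ec !(rlinZ _ _ (cd_a cd)) ep0 scale_comm [RHS]scale_comm; congr (_ *: _).
  have -> : t = (d + T)%N by lia.
  by rewrite exprD -scalerA.
Qed.

End Line.
End RankOne.

(** * The tables of the pieces *)

Section Pieces.
Variable k : fieldType.
Local Notation R := {mpoly k[2]}.
Local Notation x := (vx k).
Local Notation y := (vy k).
Local Notation rg := (@ring_grading k).

Lemma ord2P (i : 'I_2) : i = ord0 \/ i = ord_max.
Proof. by case: i => -[|[|//]] h; [left|right]; apply: val_inj. Qed.

Lemma twist_gfam (M : lmodType R) (G : int -> M -> Prop) a : gfam G -> gfam (twist G a).
Proof.
move=> hG; split=> n; first exact: gfam_subsp hG (a + n).
by move=> v /(gfam_xy hG); rewrite -addrA.
Qed.

Lemma mons_shift (M : lmodType R) a n b (v : M) : mons n (b - a, v) = mons (a + n) (b, v).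
Proof.
have e : mon_dim n (b - a) = mon_dim (a + n) b by rewrite /mon_dim; do 2 case: ifP; lia.
by rewrite /mons /mon /= e.
Qed.

Section ResidueField.
Variable a : int.
Local Notation s := [:: x : R^o; y : R^o].
Local Notation G := (twist (quot_grading rg (s := s)) a).

Let hG : gfam G. Proof. exact/twist_gfam/quot_gfam. Qed.

Lemma killed_quot (s : seq R^o) (c : R) : (c : R^o) \in s -> forall v : quotmod s, c *: v = 0.
Proof.
move=> cs v; have [u ->] := quotmodW v; rewrite -to_quotmod_lin; apply/to_quotmod_eq0.
rewrite [c *: u](_ : _ = (u : R) *: (c : R^o)); last exact: mulrC.
by apply: rpredZ; apply: submod_mem.
Qed.

Lemma table_k n : [/\ lc_dim G n 0 = (a + n == 0)%R, lc_dim G n 1 = 0%N & lc_dim G n 2 = 0%N].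
Proof.
have kx : forall v : quotmod s, x *: v = 0 by apply: killed_quot; rewrite inE eqxx.
have ky : forall v : quotmod s, y *: v = 0 by apply: killed_quot; rewrite !inE eqxx orbT.
have cd := cech_data_loc hG; split.
- apply: lc_dim0; apply: (residue_tors cd kx ky); apply: quot_dim.
  have := max_pow_dim k 1 (a + n); rewrite /max_pow_gens /= !mulr1.
  congr has_dim; rewrite /artin_dim /mon_dim; case: eqP => [->//|]; case: ifP => //; case: ifP => //; lia.
- by apply: (lc_dim1 hG); apply: (residue_h1 cd kx ky).
- by apply: (lc_dim2 hG); apply: (y_killed_h2 cd _ ky).
Qed.

End ResidueField.

Section CoordinateLine.
Variable a : int.
Local Notation s := [:: y : R^o].
Local Notation G := (twist (quot_grading rg (s := s)) a).

Let hG : gfam G. Proof. exact/twist_gfam/quot_gfam. Qed.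

Lemma mem_submod_y (r : R^o) : r \in submod s <-> exists q : R, r = y * q.
Proof.
split=> [/asboolP[c ->]|[q ->]].
  by exists (c ord0); rewrite big_ord_recl big_ord0 addr0 mulrC.
rewrite mulrC; apply: (rpredZ (q : R)); apply: submod_mem; exact: mem_head.
Qed.

Lemma table_kx n : [/\ lc_dim G n 0 = 0%N, lc_dim G n 1 = (a + n < 0)%R & lc_dim G n 2 = 0%N].
Proof.
have ky : forall v : quotmod s, y *: v = 0 by apply: killed_quot; rewrite inE eqxx.
have cd := cech_data_loc hG.
pose e := to_quotmod s 1.
have xe (c : k) t : x ^+ t *: (c%:MP *: e) = to_quotmod s (c *: 'X_[(U_(ord0) *+ t)%MM]).
  rewrite /e -(to_quotmod_lin s c%:MP 1) -to_quotmod_lin; congr to_quotmod; rewrite -mpolyXn -mul_mpolyC.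
  by rewrite [LHS]mulrA mulr1 mulrC.
have m1 t : (U_(ord0 : 'I_2) *+ t)%MM ord_max = 0%N by rewrite mulmnE mnm1E mul0n.
have ge : G (- a) e.
  by exists 1 => //; rewrite addrN; exact: ring_grading1.
have free (c : k) t : x ^+ t *: (c%:MP *: e) = 0 -> c = 0.
  rewrite xe => /to_quotmod_eq0/mem_submod_y[q eq].
  have := mcoeff_XM q (m1 t); rewrite -[_ * q]eq.
  by rewrite mcoeffZ mcoeffX eqxx mulr1.
have neg m v : a + m < 0 -> G m v -> v = 0.
  by move=> am [u /(ring_grading_neg am) -> ->]; apply: klin0 (@klin_to_quotmod k s).
have span (t : nat) m v : a + m = t%:Z -> G m v -> exists c : k, v = x ^+ t *: (c%:MP *: e).
  move=> am [u /ring_gradingP hu ->]; exists ((u : R)@_(U_(ord0) *+ t)%MM); rewrite xe.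
  apply/to_quotmodP/mem_submod_y; apply: (div_X (i := ord_max)) => m'.
  rewrite mcoeff_msupp lt0n; apply: contra => /eqP m'0.
  rewrite mcoeffB mcoeffZ mcoeffX; have [<-|/eqP ne] := eqVneq (U_(ord0) *+ t)%MM m'.
    by rewrite mulr1 subrr.
  rewrite mulr0 subr0; apply: contraT; rewrite -mcoeff_msupp => /hu.
  rewrite am mdeg2 m'0 addn0 => -[et]; case: ne; rewrite -et; apply/mnmP => i.
  by rewrite mulmnE mnm1E; case: (ord2P i) => -> /=; rewrite ?mul1n ?mul0n.
split.
- by apply: lc_dim0; apply: (line_tors cd free neg span).
- by apply: (lc_dim1 hG); apply: (line_h1 cd ky ge free neg span).
- by apply: (lc_dim2 hG); apply: (y_killed_h2 cd _ ky).
Qed.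

End CoordinateLine.

Section Ring.
Variable a : int.
Local Notation G := (twist rg a).

Let hG : gfam G. Proof. exact/twist_gfam/ring_gfam. Qed.

Lemma table_R n : [/\ lc_dim G n 0 = 0%N, lc_dim G n 1 = 0%N & lc_dim G n 2 = h2sum [:: - a] n].
Proof.
have cd := cech_data_loc hG.
have lin : rlin (id : R^o -> R^o) by [].
have gr m v : G m v <-> ring_grading (a + m) (id v) by [].
have inj (v : R^o) : id v = 0 -> v = 0 by [].
have hx (r : R) : exists v : R^o, id v = x ^+ 0 * r by exists r; rewrite mul1r.
have hy (r : R) : exists v : R^o, id v = y ^+ 0 * r by exists r; rewrite mul1r.
have gen : generated G [:: (0 - a, 1 : R^o)].
  split=> [g|m v]; first by rewrite inE => /eqP ->; rewrite /twist addrCA subrr addr0; exact: ring_grading1.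
  by rewrite /allmons /= cats0 mons_shift; apply: ring_expand.
split.
- by apply: lc_dim0; apply: (ideal_tors cd lin inj).
- by apply: (lc_dim1 hG); apply: (ideal_h1 cd lin inj gr hx hy); apply: has_dim0 => v _; exists v.
- by apply: (lc_dim2 hG); apply: (ideal_h2 cd lin inj gr hx hy n gen).
Qed.

End Ring.

Section MaximalPower.
Variables (t : nat) (a : int).
Local Notation s := (max_pow_gens k t).
Local Notation M := (submod_type s).
Local Notation G := (twist (sub_grading rg (s := s)) a).

Lemma val_lin : rlin (val : M -> R^o).
Proof. by move=> c u v. Qed.

Lemma sub_gfam : gfam (sub_grading rg (s := s)).
Proof.
split=> n; first split.
- exact: subsp0 (gfam_subsp (ring_gfam k) n).
- by move=> c u v; apply: (subsp_lin (gfam_subsp (ring_gfam k) n)).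
- by move=> v; apply: (gfam_xy (ring_gfam k)).
Qed.

Let hG : gfam G. Proof. exact/twist_gfam/sub_gfam. Qed.

Lemma max_pow_sub (p : R^o) : p \in submod s -> exists v : M, val v = p.
Proof. by move=> h; exists (Sub p h); rewrite SubK. Qed.

(** Each monomial of degree at least [t] is a multiple of [x ^+ i * y ^+ (t - i)],
where [i] is the minimum of [t] and its [x]-degree. *)
Lemma max_pow_generated : exists gens, generated G gens.
Proof.
have /choice[e he] : forall i : 'I_t.+1, exists v : M, val v = x ^+ i * y ^+ (t - i).
  by move=> i; apply/max_pow_sub/max_pow_mon; have := ltn_ord i; lia.
exists [seq (t%:Z - a, e i) | i <- enum 'I_t.+1]; split.
  move=> _ /mapP[i _ ->] /=; rewrite /twist /sub_grading he addrC subrK.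
  have h1 := gfam_xs (ring_gfam k) i (gfam_ys (ring_gfam k) (t - i) (ring_grading1 k)).
  move: h1; rewrite add0r -PoszD subnK ?mulr1; last by have := ltn_ord i.
  by rewrite /GRing.scale /= !mulr1.
move=> n v gv; have /ring_gradingP hv := gv.
pose mi (m : 'X_{1..2}) : 'I_t.+1 := inord (minn (m ord0) t).
pose mr (m : 'X_{1..2}) : 'X_{1..2} := (m - (U_(ord0) *+ mi m + U_(ord_max) *+ (t - mi m)))%MM.
have miE m : mi m = minn (m ord0) t :> nat by rewrite inordK //; lia.
have degt m : m \in msupp (val v : R) -> (t <= mdeg m)%N.
  by apply: max_pow_supp; apply: valP.
have mE m : m \in msupp (val v : R) ->
    (U_(ord0) *+ mi m + U_(ord_max) *+ (t - mi m) + mr m)%MM = m.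
  move=> /degt; rewrite mdeg2 => td; rewrite addmC submK //.
  apply/mnm_lepP => i; rewrite mnmDE !mulmnE !mnm1E miE.
  by case: (ord2P i) => -> /=; lia.
have -> : v = \sum_(m <- msupp (val v : R)) ((val v : R)@_m)%:MP *: ('X_[mr m] *: e (mi m)).
  apply: val_inj; rewrite (big_morph _ (klinD (rlin_klin val_lin)) (klin0 (rlin_klin val_lin))).
  rewrite {1}(mpolyE (val v : R)) big_seq [RHS]big_seq; apply: eq_bigr => m mv.
  rewrite !(rlinZ _ _ val_lin) he -mul_mpolyC; congr (_ * _).
  by rewrite -{1}(mE m mv) !mpolyXD mulrC !mpolyXn.
rewrite big_seq; apply: subsp_sum => [|m mv].
  by apply: subsp_adjs; apply: subsp_null.
apply: subspZ; first by apply: subsp_adjs; apply: subsp_null.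
apply: adjs_mem; first exact: subsp_null.
apply/flattenP; exists (mons n (t%:Z - a, e (mi m))).
  by apply/mapP; exists (t%:Z - a, e (mi m)) => //; apply: map_f; rewrite mem_enum.
have <- : t%:Z - a + (mdeg (mr m))%:Z = n; last exact: mon_in_mons.
have := hv m mv; rewrite -{1}(mE m mv) !mdegD !mdegMn !mdeg1.
by have := ltn_ord (mi m); lia.
Qed.

Lemma table_mt n : [/\ lc_dim G n 0 = 0%N, lc_dim G n 1 = artin_dim t (a + n) &
  lc_dim G n 2 = h2sum [:: - a] n].
Proof.
have cd := cech_data_loc hG.
have gr m v : G m v <-> ring_grading (a + m) (val v : R) by [].
have inj (v : M) : val v = 0 -> v = 0 by move=> h; apply: val_inj.
have hx (r : R) : exists v : M, val v = x ^+ t * r.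
  apply: max_pow_sub; rewrite mulrC; apply: (rpredZ (r : R)).
  by have := @max_pow_mon k t t 0; rewrite mulr1 addn0; apply.
have hy (r : R) : exists v : M, val v = y ^+ t * r.
  apply: max_pow_sub; rewrite mulrC; apply: (rpredZ (r : R)).
  by have := @max_pow_mon k t 0 t; rewrite mul1r; apply.
have [gens hgens] := max_pow_generated.
split.
- by apply: lc_dim0; apply: (ideal_tors cd val_lin inj).
- apply: (lc_dim1 hG); apply: (ideal_h1 cd val_lin inj gr hx hy).
  apply: has_dim_eqZ (max_pow_dim k t (a + n)); first exact: gfam_subsp (ring_gfam k) _.
  move=> r _; split=> [/max_pow_sub[v ev]|[v ->]]; first by exists v.
  exact: valP.
- by apply: (lc_dim2 hG); apply: (ideal_h2 cd val_lin inj gr hx hy n hgens).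
Qed.

Lemma artin_columnE n : artin_column k t a n = (artin_dim t (a + n))%:R.
Proof.
rewrite /artin_column /hilbert; congr (_ %:R); apply: vdimE; first exact: subsp_null.
exact: quot_dim (max_pow_dim k t (a + n)).
Qed.

End MaximalPower.
End Pieces.

(** * Peeling off the largest generator *)

(** If [h n] is smaller than the number of multiples in degree [n] of the largest
generator, it is smaller than that number for every generator, and none can
contribute to the growth. *)
Lemma bound_gap (A : seq int) (h : int -> nat) a n : macaulay_bound A h ->
  (forall c, c \in A -> c <= a) -> (h n < mon_dim n a)%N -> (h (n + 1)%R <= h n)%N.
Proof.
move=> mb am lt; have [E [E1 E2 E3 E4]] := mb n.
case: E E1 E2 E3 E4 => [|e E] E1 _ E3 E4; first by rewrite addn0 in E4.
have ea : e <= a.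
  by apply: am; rewrite -has_pred1 has_count; apply: leq_trans (E1 e); rewrite /= eqxx.
have := leq_trans (mem_mon_dim_le n (mem_head e E)) E3; move: lt ea; rewrite /mon_dim.
by do 2 case: ifP; lia.
Qed.

Lemma bound_zero (A : seq int) (h : int -> nat) a : macaulay_bound A h ->
  (forall c, c \in A -> c <= a) -> h a = 0%N -> forall n, a <= n -> h n = 0%N.
Proof.
move=> mb am h0; apply: int_up => // n an hn.
have := bound_gap mb am (n := n); rewrite hn => /(_ _) le; apply/eqP; rewrite -leqn0 le //.
by rewrite /mon_dim an.
Qed.

(** Removing the largest generator [a], and from [h] as much of the Hilbert
function of R(-a) as fits, preserves the growth bound. In the list [E] for [h], the
element [a] can replace any other, as its multiples are the fewest; it is then
dropped. *)
Lemma bound_peel (A : seq int) (h : int -> nat) a : macaulay_bound A h ->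
  a \in A -> (forall c, c \in A -> c <= a) ->
  macaulay_bound (rem a A) (fun n => h n - mon_dim n a)%N.
Proof.
move=> mb aA am n; have [E [E1 E2 E3 E4]] := mb n.
have EA e : e \in E -> e <= a.
  move=> eE; apply: am; rewrite -has_pred1 has_count; apply: leq_trans (E1 e).
  by rewrite -has_count has_pred1.
have cr c : count_mem c (rem a A) = (count_mem c A - (a == c))%N.
  by rewrite count_rem aA.
have [an|na] := leP a (n + 1); last first.
  exists E; split=> //.
  - move=> c; rewrite cr; have [<-|] := eqVneq a c; last by rewrite subn0.
    rewrite (_ : count_mem a E = 0%N) //; apply/count_memPn/negP => /E2; lia.
  - by rewrite mon_dim0 ?subn0 //; lia.
  - by rewrite !mon_dim0 ?subn0 //; lia.
rewrite mon_dimS //; case: E E1 E2 E3 E4 EA => [|e0 E0] E1 E2 E3 E4 EA.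
  exists [::]; split=> //; first by rewrite big_nil.
  by move: E4; rewrite /= !addn0; lia.
move: (e0 :: E0) (mem_head e0 E0) E1 E2 E3 E4 EA => E e0E E1 E2 E3 E4 EA.
pose e := if a \in E then a else e0.
have eE : e \in E by rewrite /e; case: ifP.
have ce c : count_mem c (rem e E) = (count_mem c E - (e == c))%N by rewrite count_rem eE.
have dea : (mon_dim n a <= mon_dim n e)%N by have := EA e eE; rewrite /mon_dim; do 2 case: ifP; lia.
have sE : (\sum_(c <- E) mon_dim n c = mon_dim n e + \sum_(c <- rem e E) mon_dim n c)%N.
  by rewrite (big_rem e).
have dah : (mon_dim n a <= h n)%N.
  by apply: leq_trans dea (leq_trans _ E3); rewrite sE leq_addr.
have zE : size E = (size (rem e E)).+1.
  by rewrite size_rem // prednK //; case: (E) eE.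
exists (rem e E); split=> [c|c|/=|/=].
- rewrite ce cr; have h1 := E1 c; have [ac|ac] := eqVneq a c; last first.
    by rewrite subn0 (leq_trans (leq_subr _ _)).
  move: h1; rewrite /e -ac; case: ifP => aE h1; first by rewrite eqxx leq_sub2r.
  rewrite (_ : count_mem a E = 0%N) //; apply/count_memPn; rewrite aE //.
- by move=> /mem_rem /E2.
- by rewrite leq_subRL //; apply: leq_trans E3; rewrite sE leq_add2r.
- by move: E4 dah; rewrite zE; move: (mon_dim n a) (h n) (h _) (size _); lia.
Qed.

Definition admissible (A : seq int) (h : int -> nat) : Prop :=
  [/\ exists N, forall n, N <= n -> h n = 0%N,
      exists N, forall n, n <= N -> h n = h N & macaulay_bound A h].

Lemma admissible_peel A h a : admissible A h -> a \in A -> (forall c, c \in A -> c <= a) ->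
  admissible (rem a A) (fun n => h n - mon_dim n a)%N.
Proof.
move=> [[N1 h1] [N2 h2] mb] aA am; split; last exact: bound_peel.
  by exists N1 => n /h1 ->.
exists (Num.min N2 (a - 1)) => n; rewrite le_min => /andP[n1 n2].
rewrite (h2 n n1) (h2 (Num.min N2 (a - 1))); last by rewrite ge_min lexx.
by rewrite !mon_dim0 //; lia.
Qed.

(** In cross-multiplied form, the ratio of [min (h (a + m)) (m + 1)] to [m + 1] is
nonincreasing; its successive differences are the coefficients of step 3. *)
Lemma peel_ratio A h a (m : nat) : macaulay_bound A h ->
  (forall c, c \in A -> c <= a) ->
  (minn (h (a + m.+1%:Z)%R) m.+2 * m.+1 <= minn (h (a + m%:Z)%R) m.+1 * m.+2)%N.
Proof.
move=> mb am; have d : mon_dim (a + m%:Z) a = m.+1 by rewrite /mon_dim; case: ifP; lia.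
have := bound_gap mb am (n := a + m%:Z); rewrite d (_ : a + m%:Z + 1 = a + m.+1%:Z); last by lia.
have [le _|lt /(_ isT) le] := leqP m.+1 (h (a + m%:Z)).
  by rewrite mulnC leq_mul2l geq_minr orbT.
by apply: leq_mul => //; rewrite geq_min le.
Qed.

Lemma int_max (P : int -> Prop) n0 N : P n0 -> (forall n, P n -> n <= N) ->
  exists a, is_max P a.
Proof.
move=> p0 pN; pose Q (j : nat) := `[< P (N - j%:Z) >].
have [|j /asboolP hj jmin] := ex_minnP (P := Q).
  exists (absz (N - n0)); apply/asboolP; have := pN _ p0 => h.
  by rewrite gez0_abs ?subr_ge0 // subKr.
exists (N - j%:Z); split=> // n pn; have nN := pN n pn.
have := jmin (absz (N - n)); rewrite /Q gez0_abs ?subr_ge0 // subKr => h.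
by have := h (introT (asboolP _) pn); lia.
Qed.

(** * Runs of the algorithm *)

Section Algorithm.
Variable k : fieldType.
Local Notation piece_table := (piece_table k).

Lemma piece_table_k a j : [/\ piece_table (Sk a) j ht0 = (a + j == 0)%R%:R,
  piece_table (Sk a) j ht1 = 0 & piece_table (Sk a) j ht2 = 0].
Proof.
have [t0 t1 t2] := table_k k a j; pose cast (n : nat) : rat := n%:R.
by split; [exact: (congr1 cast t0)|exact: (congr1 cast t1)|exact: (congr1 cast t2)].
Qed.

Lemma piece_table_kx a j : [/\ piece_table (Skx a) j ht0 = 0,
  piece_table (Skx a) j ht1 = (a + j < 0)%R%:R & piece_table (Skx a) j ht2 = 0].
Proof.
have [t0 t1 t2] := table_kx k a j; pose cast (n : nat) : rat := n%:R.
by split; [exact: (congr1 cast t0)|exact: (congr1 cast t1)|exact: (congr1 cast t2)].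
Qed.

Lemma piece_table_R a j : [/\ piece_table (SR a) j ht0 = 0,
  piece_table (SR a) j ht1 = 0 & piece_table (SR a) j ht2 = (h2sum [:: - a] j)%:R].
Proof.
have [t0 t1 t2] := table_R k a j; pose cast (n : nat) : rat := n%:R.
by split; [exact: (congr1 cast t0)|exact: (congr1 cast t1)|exact: (congr1 cast t2)].
Qed.

Lemma piece_table_mt t a j : [/\ piece_table (Sm t a) j ht0 = 0,
  piece_table (Sm t a) j ht1 = (artin_dim t (a + j))%:R & piece_table (Sm t a) j ht2 = (h2sum [:: - a] j)%:R].
Proof.
have [t0 t1 t2] := table_mt k t a j; pose cast (n : nat) : rat := n%:R.
by split; [exact: (congr1 cast t0)|exact: (congr1 cast t1)|exact: (congr1 cast t2)].
Qed.

Lemma lincomb_cat D D' j i : lincomb k (D ++ D') j i = lincomb k D j i + lincomb k D' j i.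
Proof. by rewrite /lincomb big_cat. Qed.

Lemma lincomb1 c S j i : lincomb k [:: (c, S)] j i = c * piece_table S j i.
Proof. by rewrite /lincomb big_seq1. Qed.

Definition all_positive (D : seq (rat * piece)) := all (fun p => (0 < p.1) && piece_ok p.2) D.

Variable H0 : table.

(** The invariant that turns the output into a decomposition of the initial table
[H0] once the current table [H] is zero. *)
Definition accounts_for (H : table) (out : seq (rat * piece)) : Prop :=
  all_positive out /\ forall j i, H j i = H0 j i - lincomb k out j i.

Lemma accounts_for_emit H out D : accounts_for H out -> all_positive D -> accounts_for (table_sub H (lincomb k D)) (out ++ D).
Proof.
move=> [o1 o2] oD; split; first by rewrite /all_positive all_cat; apply/andP.
by move=> j i; rewrite /table_sub o2 lincomb_cat opprD addrA.
Qed.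

Definition run_succeeds (st : state) : Prop :=
  (forall (j : int) (i : 'I_3), st_table st j i = 0) /\
  is_decomposition k (st_output st) H0.

(** The tables met after step 1; [A] lists the generators still to be peeled off. *)
Definition has_shape (H : table) (h : int -> nat) (A : seq int) : Prop :=
  forall j, [/\ H j ht0 = 0, H j ht1 = (h j)%:R & H j ht2 = (h2sum A j)%:R].

Lemma ord3P (i : 'I_3) : [\/ i = ht0, i = ht1 | i = ht2].
Proof.
by case: i => -[|[|[|//]]] hi; [apply: Or31|apply: Or32|apply: Or33]; apply: val_inj.
Qed.

Lemma finished_ends H out : accounts_for H out -> (forall j i, H j i = 0) ->
  terminates_in k run_succeeds (State Finished H out).
Proof.
move=> [o1 o2] hz; apply: terminates_now => //; split=> //; split=> // j i.
by apply/esym/eqP; rewrite -subr_eq0 -opprB -o2 hz oppr0.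
Qed.

Lemma step4_inv H out st' : step k (State Step4 H out) st' ->
  ((forall n, ~ step4_set H n) /\ st' = State Finished H out) \/
  exists2 b, is_max (step4_set H) b & st' = emit k Step4 H out [:: (1, Skx (- b))].
Proof. by move=> hs; inversion hs; subst; [left|right; exists b]. Qed.

Lemma step4_setE H h n : has_shape H h [::] -> (forall n, h (n + 1)%R <= h n)%N ->
  step4_set H n <-> (h n < h (n - 1)%R)%N.
Proof.
move=> hH mono; rewrite /step4_set /= /tcol subrK.
have [_ -> _] := hH (n - 1); have [_ -> _] := hH n.
have := mono (n - 1); rewrite subrK leq_eqVlt => /orP[/eqP ->|lt].
  by rewrite subrr ltnn; split=> [[]|].
by rewrite lt; split=> // _ /eqP; rewrite subr_eq0 eqr_nat => /eqP e; rewrite e ltnn in lt.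
Qed.

(** Each round of step 4 lowers the value [c] of [h] near minus infinity by one. *)
Lemma step4_ends c H out h : accounts_for H out -> has_shape H h [::] ->
  (forall n, h (n + 1)%R <= h n)%N -> (exists N, forall n, N <= n -> h n = 0%N) ->
  (exists N, forall n, n <= N -> h n = c) ->
  terminates_in k run_succeeds (State Step4 H out).
Proof.
elim: c H out h => [|c IH] H out h ho hH mono [N1 h1] [N2 h2].
  have hz n : h n = 0%N.
    have [/h2 //|/ltW] := leP n N2; move: n; apply: int_up => [|n _ hn]; first exact: h2.
    by apply/eqP; rewrite -leqn0 -hn mono.
  have emp n : ~ step4_set H n by move/(step4_setE n hH mono); rewrite !hz.
  apply: terminates_later; first by exists (State Finished H out); apply: step_4_empty.
  move=> st' /step4_inv[[_ ->]|[b [/emp //]]].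
  apply: finished_ends => // j i; have [e0 e1 e2] := hH j.
  by case: (ord3P i) => ->; rewrite ?e0 ?e1 ?e2 ?hz // /h2sum big_nil.
have [b0 hb0] : exists b, is_max (step4_set H) b.
  have [n0 hn0] : exists n0, step4_set H n0.
    apply: contrapT => /forallNP nex.
    have cst n : N2 <= n -> h n = c.+1.
      move: n; apply: int_up => [|n _ hn]; first exact: h2.
      have := nex (n + 1) => /(contra_not (step4_setE (n + 1) hH mono).2).
      rewrite addrK hn => /negP; rewrite -leqNgt => m2; have := mono n; rewrite hn => m1.
      by apply/eqP; rewrite eqn_leq m1 m2.
    have := cst (Num.max N1 N2); rewrite h1 ?le_max ?lexx ?orbT //.
    by move=> /(_ isT).
  apply: (int_max (n0 := n0) (N := N1)) => // n /(step4_setE n hH mono).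
  by have [//|lt] := leP n N1; rewrite !h1 //; lia.
apply: terminates_later.
  by exists (emit k Step4 H out [:: (1, Skx (- b0))]); apply: step_4_sub.
move=> st' /step4_inv[[emp _]|[b [hb bmax] ->]]; first by case: hb0 => /emp.
have tk := piece_table_kx (- b).
have hb' := (step4_setE b hH mono).1 hb.
have zb n : b <= n -> h n = 0%N.
  have eqn m : b <= m -> h (m + 1) = h m.
    move=> bm; apply/eqP; rewrite eqn_leq mono /= leqNgt; apply/negP => lt.
    have /bmax : step4_set H (m + 1) by apply/(step4_setE _ hH mono); rewrite addrK.
    lia.
  have eqb : forall m, b <= m -> h m = h b.
    by apply: int_up => // m bm <-; apply: eqn.
  move=> bn; rewrite (eqb n bn) -(eqb (Num.max N1 b)); last by rewrite le_max lexx orbT.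
  by rewrite h1 // le_max lexx.
have pb n : n < b -> (0 < h n)%N.
  move=> nb; have : n <= b - 1 by lia.
  move: n {nb}; apply: int_down => [|n nb hn]; first by apply: leq_ltn_trans hb'.
  by apply: leq_trans hn _; have := mono (n - 1); rewrite subrK.
apply: (IH _ _ (fun n => h n - (n < b)%R)%N).
- exact: accounts_for_emit.
- move=> j; rewrite /table_sub !lincomb1 !mul1r; have [e0 e1 e2] := hH j.
  have [t0 t1 t2] := tk j; rewrite t0 t1 t2 e0 e1 e2 !subr0; split=> //.
  rewrite (_ : - b + j < 0 = (j < b)); last by lia.
  rewrite natrB //; case: ltP => // /pb //.
- move=> n; have := mono n.
  have [n1|n1] := ltP (n + 1) b; first by rewrite (_ : n < b); lia.
  by rewrite (zb _ n1).
- by exists N1 => n /h1 ->.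
- exists (Num.min N2 (b - 1)) => n; rewrite le_min => /andP[/h2 -> nb].
  by rewrite (_ : n < b) ?subn1 //; lia.
Qed.

(** The second difference of the Hilbert function of H^2(R(-a)) is concentrated in
degree [a - 2], so step 2 selects the largest element of [A]. *)
Lemma step2_setE H h A n : has_shape H h A -> step2_set H n <-> n \in A.
Proof.
move=> hH; rewrite /step2_set /= /tcol.
have [_ _ ->] := hH (n - 2); have [_ _ ->] := hH (n - 2 + 1); have [_ _ ->] := hH (n - 2 + 1 + 1).
have := h2sum_diff2 A (n - 2); rewrite subrK (_ : n - 2 + 1 + 1 = n); last by lia.
move=> e; have := congr1 (fun m : nat => m%:R : rat) e; rewrite !natrD => e'.
set u := (h2sum A (n - 2))%:R in e' *; set v := (h2sum A (n - 2 + 1))%:R in e' *.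
set w := (h2sum A n)%:R in e' *.
have -> : u - v - (v - w) = (count_mem n A)%:R by lra.
rewrite -has_pred1 has_count; split=> [ne|gt e0].
  by rewrite lt0n; apply/eqP => c0; apply: ne; rewrite c0.
by move/eqP: e0; rewrite pnatr_eq0 => /eqP c0; rewrite c0 in gt.
Qed.

Lemma step2_inv H out st' : step k (State Step2 H out) st' ->
  [\/ (forall n, ~ step2_set H n) /\ st' = State Step4 H out,
      exists a, [/\ is_max (step2_set H) a, H a ht1 = 0 &
        st' = emit k Step2 H out [:: (1, SR (- a))]] |
      exists a, [/\ is_max (step2_set H) a, 0 < H a ht1 & st' = State (Step3 a) H out]].
Proof.
move=> hs; inversion hs; subst; [apply: Or31|apply: Or32|apply: Or33]; first by [].
  by exists a.
by exists a.
Qed.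

Definition step3_pieces (a : int) (r : seq rat) : seq (rat * piece) :=
  [seq p <- [seq (r`_n, Sm n.+1 (- a)) | n <- iota 0 (size r)] | p.1 != 0].

Lemma step3_inv H out a st' : step k (State (Step3 a) H out) st' ->
  exists r : seq rat, [/\ forall c, c \in r -> 0 <= c,
    forall j, step3_column H a j = \sum_(n < size r) r`_n * artin_column k n.+1 (- a) j &
    st' = emit k Step2 H out (step3_pieces a r)].
Proof. by move=> hs; inversion hs; subst; exists r. Qed.

Lemma step3_positive a (r : seq rat) : (forall c, c \in r -> 0 <= c) -> all_positive (step3_pieces a r).
Proof.
move=> r0; rewrite /all_positive /step3_pieces all_filter all_map; apply/allP => n.
rewrite mem_iota add0n => /andP[_ nr] /=; apply/implyP => nz.
by rewrite andbT lt_neqAle eq_sym nz r0 // mem_nth.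
Qed.

Lemma step3_lincomb a (r : seq rat) j i :
  lincomb k (step3_pieces a r) j i = \sum_(n < size r) r`_n * piece_table (Sm n.+1 (- a)) j i.
Proof.
rewrite /lincomb big_filter big_map.
rewrite (_ : iota 0 (size r) = index_iota 0 (size r)); last by rewrite /index_iota subn0.
rewrite big_mkord.
rewrite big_mkcond; apply: eq_bigr => n _ /=.
by case: eqP => [->|]; rewrite ?mul0r.
Qed.

Lemma step3_columnE H h A a j : has_shape H h A ->
  step3_column H a j = (minn (h j) (mon_dim j a))%:R.
Proof.
move=> hH; rewrite /step3_column; have [_ -> _] := hH j.
have [aj|ja] := leP a j; last by rewrite mon_dim0 // minn0.
have -> : (j - a + 1)%:~R = (mon_dim j a)%:R :> rat.
  by rewrite pmulrn /mon_dim aj; congr (_%:~R); lia.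
by case: leqP => h1; [rewrite min_l|rewrite min_r] => //; rewrite ler_nat // ltnW.
Qed.

Lemma artin_dim_shift (n : nat) a j :
  artin_dim n.+1 (- a + j) = if j < a + n.+1%:Z then mon_dim j a else 0%N.
Proof.
rewrite /artin_dim (_ : (- a + j < n.+1%:Z) = (j < a + n.+1%:Z)); last by lia.
case: ifP => // _; rewrite /mon_dim; do 2 case: ifP; lia.
Qed.

(** The system of step 3 is triangular; its solution is
[r n = kap n - kap (n + 1)], where [kap n = K (a + n) / (n + 1)]. *)
Lemma step3_solution H h A a : has_shape H h A -> admissible A h -> (forall c, c \in A -> c <= a) ->
  exists r : seq rat, (forall c, c \in r -> 0 <= c) /\
    forall j, step3_column H a j = \sum_(n < size r) r`_n * artin_column k n.+1 (- a) j.
Proof.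
move=> hH [[N hN] _ mb] am.
pose K (m : nat) : nat := minn (h (a + m%:Z)) m.+1.
pose kap (m : nat) : rat := (K m)%:R / m.+1%:R.
have decr m : kap m.+1 <= kap m.
  rewrite /kap ler_pdivrMr ?ltr0Sn // mulrAC ler_pdivlMr ?ltr0Sn // -!natrM ler_nat.
  exact: (peel_ratio m mb am).
pose L := absz (Num.max 0 (N - a)).
have kz m : (L <= m)%N -> kap m = 0.
  by move=> Lm; rewrite /kap /K hN ?min0n ?mul0r //; move: Lm; rewrite /L; lia.
exists (mkseq (fun m => kap m - kap m.+1) L); split.
  by move=> _ /mapP[m _ ->]; rewrite subr_ge0.
move=> j; rewrite (step3_columnE a j hH) size_mkseq.
have [ja|aj] := ltP j a.
  rewrite mon_dim0 // minn0 big1 // => n _; rewrite artin_columnE artin_dim_shift mon_dim0 //.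
  by case: ifP; rewrite mulr0.
have [m em] : exists m : nat, j = a + m%:Z by exists (absz (j - a)); lia.
have dj : mon_dim j a = m.+1 by rewrite em /mon_dim; case: ifP; lia.
have term (n : 'I_L) : (mkseq (fun m => kap m - kap m.+1) L)`_n * artin_column k n.+1 (- a) j =
    (if (m <= n)%N then kap n - kap n.+1 else 0) * m.+1%:R.
  rewrite nth_mkseq // artin_columnE artin_dim_shift dj (_ : (j < _) = (m <= n)%N); last by rewrite em; lia.
  by case: ifP; rewrite // mulr0 mul0r.
rewrite (eq_bigr _ (fun n _ => term n)) -mulr_suml -big_mkcond /=.
have [Lm|mL] := leqP L m.
  rewrite big_pred0 ?mul0r => [|n]; last by have := ltn_ord n; lia.
  have := kz m Lm; rewrite /kap => /eqP; rewrite mulf_eq0 invr_eq0 !pnatr_eq0 orbF.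
  by rewrite /K dj em => /eqP ->.
rewrite -(big_mkord (fun n => (m <= n)%N) (fun n => kap n - kap n.+1)).
rewrite (@big_cat_nat _ _ _ m) //=; last exact: ltnW.
rewrite [X in X + _]big_nat_cond [X in X + _]big_pred0 ?add0r => [|n]; last by lia.
have -> : \sum_(m <= n < L | (m <= n)%N) (kap n - kap n.+1) = kap m.
  rewrite big_nat_cond (eq_bigl (fun n => (m <= n < L)%N)) => [|n]; last by lia.
  rewrite -big_nat (eq_bigr (fun n => - (kap n.+1 - kap n))) => [|n _]; last by rewrite opprB.
  by rewrite sumrN telescope_sumr ?(ltnW mL) // (kz L) // sub0r opprK.
by rewrite /kap divfK ?pnatr_eq0 // /K dj em.
Qed.

Lemma h2sum_rem A a j : a \in A -> h2sum A j = (h2sum [:: a] j + h2sum (rem a A) j)%N.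
Proof. by move=> aA; rewrite /h2sum (big_rem a aA) /= big_seq1. Qed.

(** Every round removes the largest element of [A]. After step 3 the second column
loses exactly one copy of that of R(-a), because the coefficients of step 3 sum to
one: this is the equation in degree [a], where [h] is positive. When [A] is empty,
the growth bound says that [h] is nonincreasing, as step 4 requires. *)
Lemma step2_ends m H out h A : (size A <= m)%N -> accounts_for H out -> has_shape H h A -> admissible A h ->
  terminates_in k run_succeeds (State Step2 H out).
Proof.
elim: m H out h A => [|m IH] H out h A sA ho hH gA.
  have A0 : A = [::] by apply/size0nil/eqP; rewrite -leqn0.
  rewrite A0 in hH gA; have emp n : ~ step2_set H n by move=> /(step2_setE n hH).
  apply: terminates_later; first by exists (State Step4 H out); apply: step_2_empty.
  move=> st' /step2_inv[[_ ->]|[a [[/emp //]]]|[a [[/emp //]]]].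
  have [hi [N lo] mb] := gA.
  apply: (step4_ends (c := h N)) ho hH _ hi _; last by exists N.
  move=> n; have [E [E1 _ _ E4]] := mb n.
  by case: E E1 E4 => [|e E] E1; [rewrite addn0|have := E1 e; rewrite /= eqxx].
have [A0|An] := eqVneq A [::]; first by apply: (IH H out h A) => //; rewrite A0.
have setE n := step2_setE n hH.
have peel a : is_max (step2_set H) a -> a \in A /\ forall c, c \in A -> c <= a.
  by move=> [/setE aA am]; split=> // c /setE /am.
have sr a : a \in A -> (size (rem a A) <= m)%N by move=> aA; rewrite size_rem // -subn1 leq_subLR add1n.
have [a0 ha0] : exists a, is_max (step2_set H) a.
  have [N hN] : exists N : int, forall c, c \in A -> c <= N.
    elim: (A) => [|c l [N hN]]; first by exists 0.
    exists (Num.max c N) => d; rewrite inE le_max => /orP[/eqP ->|/hN ->].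
      by rewrite lexx.
    by rewrite orbT.
  case: (A) An setE hN => // c l _ setE hN.
  by apply: (int_max (n0 := c) (N := N)) => [|n /setE /hN //]; apply/setE/mem_head.
apply: terminates_later.
  have [_ ea _] := hH a0; have [z|nz] := eqVneq (H a0 ht1) 0.
    by exists (emit k Step2 H out [:: (1, SR (- a0))]); apply: step_2_sub.
  exists (State (Step3 a0) H out); apply: step_2_go => //.
  by rewrite lt_neqAle eq_sym nz ea ler0n.
move=> st' /step2_inv[[emp _]|[a [amax Ha ->]]|[a [amax Ha ->]]].
- by case: ha0 => /emp.
- have [aA am] := peel a amax; have [hi lo mb] := gA.
  have ha : h a = 0%N by have [_ e _] := hH a; move/eqP: Ha; rewrite e pnatr_eq0 => /eqP.
  have hd n : (h n - mon_dim n a)%N = h n.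
    have [na|an] := ltP n a; first by rewrite mon_dim0 // subn0.
    by rewrite (bound_zero mb am ha an).
  apply: (IH _ _ (fun n => h n - mon_dim n a)%N (rem a A)); [exact: sr|exact: accounts_for_emit| |exact: admissible_peel].
  move=> j; have [e0 e1 e2] := hH j; have [t0 t1 t2] := piece_table_R (- a) j.
  rewrite /table_sub !lincomb1 !mul1r t0 t1 t2 e0 e1 e2 !subr0 hd opprK; split=> //.
  by rewrite (h2sum_rem j aA) natrD addrC addKr.
- have [aA am] := peel a amax; apply: terminates_later.
    have [r [r0 hr]] := step3_solution hH gA am.
    by exists (emit k Step2 H out (step3_pieces a r)); apply: step_3.
  move=> st'' /step3_inv[r [r0 hr ->]].
  apply: (IH _ _ (fun n => h n - mon_dim n a)%N (rem a A)); [exact: sr| | |exact: admissible_peel].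
    by apply: accounts_for_emit ho _; apply: step3_positive.
  have sum1 : \sum_(n < size r) r`_n = 1.
    have := hr a; rewrite (step3_columnE a a hH).
    have daa : mon_dim a a = 1%N by rewrite /mon_dim lexx subrr.
    have ha : (0 < h a)%N by have [_ e _] := hH a; move: Ha; rewrite e ltr0n.
    rewrite daa (minn_idPr ha) => e; apply: etrans (esym e); apply: eq_bigr => n _.
    by rewrite artin_columnE artin_dim_shift daa ltrDl mulr1.
  move=> j; have [e0 e1 e2] := hH j.
  rewrite /table_sub !step3_lincomb e0 e1 e2; split.
  + rewrite big1 ?subr0 // => n _.
    by have [-> _ _] := piece_table_mt n.+1 (- a) j; rewrite mulr0.
  + have -> : \sum_(n < size r) r`_n * piece_table (Sm n.+1 (- a)) j ht1 = step3_column H a j.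
      rewrite hr; apply: eq_bigr => n _; rewrite artin_columnE.
      by have [_ -> _] := piece_table_mt n.+1 (- a) j.
    by rewrite (step3_columnE a j hH) -natrB ?geq_minl // minnE subKn ?leq_subr // ; congr (_%:R); lia.
  + have -> : \sum_(n < size r) r`_n * piece_table (Sm n.+1 (- a)) j ht2 = (h2sum [:: a] j)%:R.
      transitivity ((\sum_(n < size r) r`_n) * (h2sum [:: a] j)%:R); last by rewrite sum1 mul1r.
      rewrite mulr_suml; apply: eq_bigr => n _.
      by have [_ _ ->] := piece_table_mt n.+1 (- a) j; rewrite opprK.
    by rewrite (h2sum_rem j aA) natrD addrC addKr.
Qed.

Lemma step1_inv H out st' : step k (State Step1 H out) st' ->
  exists s : seq int, [/\ uniq s, forall n, H n ht0 <> 0 <-> n \in s &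
    st' = emit k Step2 H out [seq (H n ht0, Sk (- n)) | n <- s]].
Proof.
move=> hs; inversion hs; subst; exists s; split=> // n.
by match goal with h : forall n, reflect _ _ |- _ => apply: (rwP (h n)) end.
Qed.

(** The pieces k(-n) have no cohomology outside H^0, so step 1 clears that column
and leaves the others unchanged. *)
Lemma step1_ends (h0 h1 : int -> nat) A :
  (forall j, [/\ H0 j ht0 = (h0 j)%:R, H0 j ht1 = (h1 j)%:R & H0 j ht2 = (h2sum A j)%:R]) ->
  (exists N, forall n, n <= - N \/ N <= n -> h0 n = 0%N) -> admissible A h1 ->
  terminates_in k run_succeeds (State Step1 H0 [::]).
Proof.
move=> hH [N hN] gA; apply: terminates_later.
  pose l := [seq - N + i%:Z | i <- iota 0 (absz (N + N))].
  pose s := [seq n <- l | H0 n ht0 != 0].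
  exists (emit k Step2 H0 [::] [seq (H0 n ht0, Sk (- n)) | n <- s]); apply: step_1.
    by rewrite filter_uniq // map_inj_uniq ?iota_uniq // => i j /addrI[].
  move=> n; rewrite mem_filter; apply: (iffP andP) => [[/eqP //]|nz].
  split; first exact/eqP.
  have hn : h0 n <> 0%N by move=> z; apply: nz; have [-> _ _] := hH n; rewrite z.
  have nN : ~ (n <= - N \/ N <= n) by move=> /hN.
  apply/mapP; exists (absz (n + N)); first by rewrite mem_iota; lia.
  by lia.
move=> st' /step1_inv[s [us hs ->]].
apply: (step2_ends (leqnn (size A)) (h := h1)) gA.
  apply: accounts_for_emit; first by split=> // j i; rewrite /lincomb big_nil subr0.
  rewrite /all_positive all_map; apply/allP => n /hs nz; rewrite /= andbT lt_neqAle eq_sym.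
  by have [e _ _] := hH n; rewrite {2}e ler0n andbT; apply/eqP.
move=> j; have [e0 e1 e2] := hH j; rewrite /table_sub /lincomb !big_map e1 e2; split.
- rewrite (eq_bigr (fun n => if n == j then H0 n ht0 else 0)) => [|n _].
    rewrite -big_mkcond -big_filter; have [js|njs] := boolP (j \in s).
      by rewrite filter_pred1_uniq // big_seq1 subrr.
    rewrite big_filter big_hasC ?subr0; last by rewrite has_pred1.
    by apply: contrapT => nz; case/negP: njs; apply/hs.
  have [p0 _ _] := piece_table_k (- n) j; rewrite [X in _ * X]p0 /=.
  by rewrite addrC subr_eq0 eq_sym; case: ifP; rewrite ?mulr1 ?mulr0.
- rewrite big1 ?subr0 // => n _.
  by have [_ p1 _] := piece_table_k (- n) j; rewrite [X in _ * X]p1 mulr0.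
- rewrite big1 ?subr0 // => n _.
  by have [_ _ p2] := piece_table_k (- n) j; rewrite [X in _ * X]p2 mulr0.
Qed.

End Algorithm.

Theorem mainTheorem3 (k : fieldType) (M : lmodType {mpoly k[2]})
    (G : int -> M -> Prop) (hG : is_grading G) (hM : fin_gen M) :
  terminates_in k
    (fun st : state =>
       (forall (j : int) (i : 'I_3), st_table st j i = 0) /\
       is_decomposition k (st_output st) (lc_table G))
    (State Step1 (lc_table G) [::]).
Proof.
have [gens hgens] := grading_generated hG hM.
have [A [hi0 hi1 lo1 e2 mb]] := lc_dim_shape (grading_gfam hG) hgens.
apply: (@step1_ends k (lc_table G) (fun n => lc_dim G n 0) (fun n => lc_dim G n 1) A) => // j.
split; [by []|by []|exact: (congr1 (fun n : nat => n%:R : rat) (e2 j))].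
Qed.
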